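(* Let $L$ be a Laakso space with associated sequence of integers $(j_i)_{i\ge1}$, $j_i\ge2$, and with Hausdorff dimension $Q$ between one and two, constructed as in the context. Let $d_0=1$ and $d_n=\prod_{i=1}^{n}j_i^{-1}$ for $n\ge1$. Let $A$ be the Laplacian on $L$ defined in the context. Then the spectrum of $A$ is $$\sigma(A)=\bigcup_{n=0}^{\infty}\bigcup_{k=0}^{\infty}\left\{\frac{k^{2}\pi^{2}}{d_n^{2}}\right\}\cup\bigcup_{n=2}^{\infty}\bigcup_{k=1}^{\infty}\left\{\frac{k^{2}\pi^{2}}{4d_n^{2}}\right\}\cup\bigcup_{n=1}^{\infty}\bigcup_{k=0}^{\infty}\left\{\frac{(2k+1)^{2}\pi^{2}}{4d_n^{2}}\right\}.$$
   Context: Construction of the Laakso space. Let $(j_i)_{i\ge1}$ be the sequence of integers $j_i\ge 2$ associated to the space, $d_0=1$, $d_n=\prod_{i=1}^n j_i^{-1}$. Let $F_0=[0,1]$ with Lebesgue measure $\mu_0$. For $n\ge1$, $F_n$ is obtained from two copies of $F_{n-1}$, i.e. from $F_{n-1}\times\{0,1\}$, by identifying $(x,0)$ with $(x,1)$ for every $x\in F_{n-1}$ whose horizontal coordinate (its image in $F_0=[0,1]$) is an $n$-th level wormhole location. These locations are the numbers $i\,d_n$ with $0<i<d_n^{-1}$ that are not integer multiples of $d_{n-1}$, so wormholes of different levels never share a horizontal coordinate. The map $\phi_{n,n-1}:F_n\to F_{n-1}$ is the natural projection forgetting the copy index, and $\mu_n$ is the probability measure on $F_n$ giving each of the two copies of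 $F_{n-1}$ one half of $\mu_{n-1}$. Each $F_n$ is a metric graph whose vertices are the wormholes of levels at most $n$ together with the boundary points (of degree one) at horizontal coordinates $0$ and $1$. Its edges are horizontal segments with their Euclidean lengths. The Laakso space is the projective limit $L=\lim_{\leftarrow}F_i=\{\{x_i\}\in\prod_iF_i:\phi_{i,i-1}(x_i)=x_{i-1}\ \text{for all } i\ge1\}$, with coordinate projections $\Phi_n:L\to F_n$, its path (geodesic) metric, and the limit measure $\mu_\infty$ characterized by $\int_{F_n}\mathbb{I}_B\,d\mu_n=\int_L\mathbb{I}_B\circ\Phi_n\,d\mu_\infty$ for measurable $B\subset F_n$. The restriction that the Hausdorff dimension is between one and two corresponds to using exactly two copies of $F_{n-1}$ at each step; when $j_i=j$ for all $i$ the dimension is $Q=1+\ln 2/\ln j$. The Laplacian. $A_n$ is the self-adjoint operator on $L^2(F_n,\mu_n)$ acting by $A_nf=-f''$ on each edge. Its domain $\mathrm{Dom}(A_n)$ consists of the (continuous) functions on $F_n$ that are twice differentiable on each edge (in the $L^2$/Sobolev sense) and such that at each vertex the one-sided first derivatives along the incident edges sum to zero (Kirchhoff conditions; Neumann at degree-one vertices). Put $\mathcal{D}_n=\{f\circ\Phi_n:f\in\mathrm{Dom}(A_n)\}\subset L^2(L,\mu_\infty)$, with $A_n(f\circ\Phi_n)=(A_nf)\circ\Phi_n$. These are increasing: $\mathcal{D}_n\subset\mathcal{D}_{n+1}$ and $A_{n+1}$ extends $A_n$. $A$ is the minimal self-adjoint operator on $L^2(L,\mu_\infty)$ extending all the $(A_n,\mathcal{D}_n)$;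 its domain is the closure of $\bigcup_{n\ge0}\mathcal{D}_n$ in the graph norm $\|u\|_{L^2}+\|Au\|_{L^2}$. *)

(* Defs.v *)
From HB Require Import structures.
From mathcomp Require Import all_boot all_order all_algebra.
From mathcomp Require Import generic_quotient complex.
From mathcomp Require Import all_classical all_reals all_analysis.

Set Implicit Arguments.
Unset Strict Implicit.
Unset Printing Implicit Defensive.

Import Order.TTheory GRing.Theory Num.Theory.
Import numFieldTopology.Exports numFieldNormedType.Exports.

Local Open Scope classical_set_scope.
Local Open Scope ring_scope.
Local Open Scope quotient_scope.
Local Open Scope complex_scope.

(* The two copies X * {false} and X * {true} of X, with (x, false) and (x, true)
   identified whenever the coordinate h x satisfies P. *)
Section Gluing.
Variables (R : Type) (X : choiceType) (h : X -> R) (P : pred R).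

Definition glue_rel (p q : X * bool) : bool :=
  (p.1 == q.1) && ((p.2 == q.2) || P (h p.1)).

Fact glue_rel_refl : reflexive glue_rel.
Proof. by move=> p; rewrite /glue_rel !eqxx. Qed.

Fact glue_rel_sym : symmetric glue_rel.
Proof.
move=> p q; rewrite /glue_rel (eq_sym p.2) [q.1 == _]eq_sym.
by case: eqP => // ->.
Qed.

Fact glue_rel_trans : transitive glue_rel.
Proof.
move=> q p r; rewrite /glue_rel => /andP[/eqP -> pq] /andP[/eqP <- qr].
rewrite eqxx /=; case/orP: pq => [/eqP -> //|->]; by rewrite orbT.
Qed.

Canonical glue_equiv :=
  EquivRel glue_rel glue_rel_refl glue_rel_sym glue_rel_trans.

Definition glued : Type := {eq_quot glue_equiv}.
HB.instance Definition _ := Choice.on glued.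

Definition glue_pt (x : X) (b : bool) : glued := \pi_({eq_quot glue_equiv}) (x, b).

Definition glue_proj (z : glued) : X := (repr (z : {eq_quot glue_equiv})).1.

Lemma glue_ptK (x : X) (b : bool) : glue_proj (glue_pt x b) = x.
Proof.
rewrite /glue_proj /glue_pt.
have /eqmodP : repr (\pi_({eq_quot glue_equiv}) (x, b)) =
  (x, b) %[mod_eq glue_equiv] by rewrite reprK.
by move=> /andP[/eqP].
Qed.

End Gluing.

Section Graphs.
Variables (R : realType) (j : nat -> nat).

(* d_n = 1 / (j_1 ... j_n), the length of the edges of F_n; j 0 is never used. *)
Definition mesh (n : nat) : R := \prod_(1 <= i < n.+1) (j i)%:R^-1.

Definition wormhole (n : nat) : pred R := fun x =>
  `[< (exists i : nat, [/\ (0 < i)%N, i%:R < (mesh n)^-1 & x = i%:R * mesh n]) /\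
      ~ (exists m : nat, x = m%:R * mesh n.-1) >].

Definition unit_itv : Type := {x : R | 0 <= x <= 1}.
HB.instance Definition _ := Choice.on unit_itv.

Fact unit_itv0_subproof : 0 <= (0 : R) <= 1.
Proof. by rewrite lexx ler01. Qed.

Definition unit_itv0 : unit_itv := exist _ 0 unit_itv0_subproof.

(* The quotient at step n + 1 depends on the horizontal coordinate of F_n, so both
   are built by the same recursion. *)
Record level := Level { carrier : choiceType; hcoord : carrier -> R }.

Fixpoint graph_level (n : nat) : level :=
  if n is m.+1 then
    let X := graph_level m in
    @Level (glued (@hcoord X) (wormhole m.+1))
           (fun z => @hcoord X (glue_proj z))
  else @Level unit_itv (fun x => sval x).

(* graph n is F_n; its elements are points of the metric graph, not vertices. *)
Definition graph (n : nat) : choiceType := carrier (graph_level n).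

Definition copy (n : nat) (x : graph n) (b : bool) : graph n.+1 :=
  @glue_pt R (graph n) (@hcoord (graph_level n)) (wormhole n.+1) x b.

Definition phi (n : nat) (z : graph n.+1) : graph n :=
  @glue_proj R (graph n) (@hcoord (graph_level n)) (wormhole n.+1) z.

(* The Borel sigma-algebra of F_(n+1): since each copy of F_n is a closed subset,
   a set is Borel iff its traces on both copies are. *)
Fixpoint Fmeasurable (n : nat) : set (graph n) -> Prop :=
  match n return set (graph n) -> Prop with
  | 0 => fun B => measurable [set sval x | x in B]
  | m.+1 => fun B => forall b : bool, @Fmeasurable m [set x | B (copy x b)]
  end.

Fixpoint Fmeas (n : nat) : set (graph n) -> \bar R :=
  match n return set (graph n) -> \bar R with
  | 0 => fun B => lebesgue_measure [set sval x | x in B]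
  | m.+1 => fun B =>
      ((2^-1)%:E * @Fmeas m [set x | B (copy x false)] +
       (2^-1)%:E * @Fmeas m [set x | B (copy x true)])%E
  end.

(* The point with horizontal coordinate x (junk outside [0, 1]) lying on the
   copy of [0, 1] that is selected by the bits a 0, ..., a n.-1. *)
Fixpoint chart (n : nat) (a : nat -> bool) (x : R) : graph n :=
  match n return graph n with
  | 0 => insubd unit_itv0 x
  | m.+1 => copy (chart m a x) (a m)
  end.

(* Every i d_n with 0 < i < 1/d_n is a wormhole location of exactly one level
   m <= n, so the edges of F_n are the segments between consecutive multiples
   of d_n, on each of the 2^n copies of [0, 1]. *)
Definition edge (n : nat) : finType :=
  ('I_(\prod_(1 <= i < n.+1) j i) * n.-tuple bool)%type.

Definition bits (n : nat) (w : n.-tuple bool) : nat -> bool := nth false w.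

Definition edge_pt (n : nat) (e : edge n) : R -> graph n := chart n (bits e.2).

Definition edge_lo (n : nat) (e : edge n) : R := (e.1 : nat)%:R * mesh n.
Definition edge_hi (n : nat) (e : edge n) : R := (e.1 : nat).+1%:R * mesh n.

(* u is in H^2(a, b), with first and second derivatives u1 and u2: u and u1 are
   absolutely continuous on [a, b], u' = u1, u1' = u2 and u2 is in L^2. *)
Definition sobolev2 (a b : R) (u u1 u2 : R -> R) : Prop :=
  [/\ measurable_fun `[a, b] u2,
      lebesgue_measure.-integrable `[a, b] (EFin \o (fun x => u2 x ^+ 2)),
      forall x, a <= x <= b ->
        u1 x = u1 a + \int[lebesgue_measure]_(t in `[a, x]) u2 t
    & forall x, a <= x <= b ->
        u x = u a + \int[lebesgue_measure]_(t in `[a, x]) u1 t].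

(* The graph of A_n on real functions, i.e. - f'' = g with Kirchhoff conditions:
   f is in the domain and A_n f = g almost everywhere. F_n has the quotient
   topology, so f is continuous iff it is on each copy of [0, 1]. Derivatives at a
   vertex are taken along the edges, away from the vertex, hence the minus sign at
   right endpoints; the sums are empty at points that are not vertices, and
   at degree-one vertices they give the Neumann condition. *)
Definition laplR (n : nat) (f g : graph n -> R) : Prop :=
  (forall w : n.-tuple bool,
     {within `[0, 1], continuous (f \o chart n (bits w))}) /\
  exists f1 : edge n -> R -> R,
    (forall e : edge n,
       sobolev2 (edge_lo e) (edge_hi e) (f \o edge_pt e) (f1 e)
         (fun x => - g (edge_pt e x))) /\
    (forall v : graph n,
       \sum_(e : edge n | edge_pt e (edge_lo e) == v) f1 e (edge_lo e) -
       \sum_(e : edge n | edge_pt e (edge_hi e) == v) f1 e (edge_hi e) = 0).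

(* A_n has real coefficients: it acts on real and imaginary parts. *)
Definition lapl (n : nat) (f g : graph n -> R[i]) : Prop :=
  laplR (fun x => complex.Re (f x)) (fun x => complex.Re (g x)) /\
  laplR (fun x => complex.Im (f x)) (fun x => complex.Im (g x)).

Record laakso : Type := Laakso {
  Phi : forall n, graph n;
  PhiP : forall n, phi (Phi n.+1) = Phi n }.

Fact laakso0_subproof (n : nat) :
  phi (chart n.+1 (fun=> false) 0) = chart n (fun=> false) 0.
Proof. exact: glue_ptK. Qed.

Definition laakso0 : laakso := Laakso laakso0_subproof.

HB.instance Definition _ := gen_eqMixin laakso.
HB.instance Definition _ := gen_choiceMixin laakso.
HB.instance Definition _ := isPointed.Build laakso laakso0.

Definition cylinders : set (set laakso) :=
  [set C | exists n (B : set (graph n)),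
     Fmeasurable B /\ C = [set x | B (Phi x n)]].

Definition laaksoM := g_sigma_algebraType cylinders.

(* mu_infty: the push-forward of mu by each Phi_n is mu_n. *)
Definition limit_measure (mu : {measure set laaksoM -> \bar R}) : Prop :=
  forall n (B : set (graph n)),
    Fmeasurable B -> mu [set x | B (Phi x n)] = Fmeas B.

End Graphs.

(* Operators on the complex space L^2(mu) are given by their graphs, as relations
   between representatives of the classes modulo mu-a.e. equality. *)
Section Operators.
Context d (T : measurableType d) (R : realType).
Variable mu : {measure set T -> \bar R}.

Definition L2norm (u : T -> R[i]) : \bar R :=
  Lnorm mu 2%:E (fun x => (ComplexField.Normc.normc (u x))%:E).

Definition L2 (u : T -> R[i]) : Prop :=
  [/\ measurable_fun setT (fun x => complex.Re (u x)),
      measurable_fun setT (fun x => complex.Im (u x)) & (L2norm u < +oo)%E].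

Definition graph_closure (A : (T -> R[i]) -> (T -> R[i]) -> Prop)
    (u v : T -> R[i]) : Prop :=
  [/\ L2 u, L2 v &
      forall eps : R, 0 < eps -> exists f g, A f g /\
        (L2norm (fun x => (u x - f x)%R) + L2norm (fun x => (v x - g x)%R) < eps%:E)%E].

(* A - z is a bijection from the domain of A onto L^2 with bounded inverse;
   (A - z) u = f is written A u = z u + f. *)
Definition resolvent_set (A : (T -> R[i]) -> (T -> R[i]) -> Prop) : set R[i] :=
  [set z |
    [/\ (forall u, A u (fun x => z * u x) -> {ae mu, forall x, u x = 0}),
        (forall f, L2 f -> exists u, A u (fun x => z * u x + f x))
      & exists M : R, forall u f, L2 f -> A u (fun x => z * u x + f x) ->
          (L2norm u <= M%:E * L2norm f)%E]].

Definition spectrum (A : (T -> R[i]) -> (T -> R[i]) -> Prop) : set R[i] :=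
  ~` resolvent_set A.

End Operators.

(* The union over n of the operators (A_n, D_n), an operator since A_(n+1) extends
   A_n. The closure below is their minimal self-adjoint extension. *)
Definition laakso_cyl_laplacian (R : realType) (j : nat -> nat)
    (u v : laaksoM R j -> R[i]) : Prop :=
  exists n (f g : graph R j n -> R[i]),
    [/\ lapl f g, u = (fun x => f (Phi x n)) & v = (fun x => g (Phi x n))].

Definition laakso_laplacian (R : realType) (j : nat -> nat)
    (mu : {measure set laaksoM R j -> \bar R}) :
    (laaksoM R j -> R[i]) -> (laaksoM R j -> R[i]) -> Prop :=
  graph_closure mu (@laakso_cyl_laplacian R j).

(* Main.v *)
(* Let [S] be a finite set of wormhole levels with maximum [n]. The functions on [L] that
   change sign under exchange of the two copies at exactly the levels in [S] are of the form
   F(x) chi(bits), where chi is the Walsh function of [S] and [x] the horizontal coordinate.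
   Such a function descends to a Kirchhoff function iff [F] vanishes at the wormholes of the
   levels in [S], has no kink at the others, and satisfies Neumann conditions at 0 and 1.
   Consecutive zeros forced in this way are d_n or 2 d_n apart (never more, as two consecutive
   multiples of d_n cannot both be multiples of d_(n-1)), so on each such gap [F] is a Dirichlet,
   mixed or, for the empty [S], Neumann eigenfunction of an interval. These functions are
   orthogonal and diagonalize [A]. They are complete: on one gap, multiplication by the cosine
   of the rescaled coordinate maps each eigenfunction into the span of its neighbours, so a
   function orthogonal to all of them is orthogonal to e_0 times every polynomial in this
   cosine, hence in the limit to indicators of rays; sums over gaps, Walsh inversion and
   Dynkin's lemma then give all Borel sets. As the eigenvalues are discrete in the plane, the
   spectrum of the closure is exactly the set of eigenvalues. *)
Require Import Defs.
From mathcomp Require Import all_boot all_order all_algebra.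
From mathcomp Require Import ring lra zify.
From mathcomp Require Import generic_quotient complex.
From mathcomp Require Import all_classical all_reals all_analysis measurable_realfun.
Set Implicit Arguments.
Unset Strict Implicit.
Unset Printing Implicit Defensive.

Import Order.TTheory GRing.Theory Num.Theory.
Import numFieldTopology.Exports numFieldNormedType.Exports.
Local Open Scope classical_set_scope.
Local Open Scope ring_scope.
Local Open Scope quotient_scope.
Local Open Scope complex_scope.

(** * Square-integrable real functions *)

(** The closure is handled only through Fourier coefficients: once a complete orthogonal family of
    eigenfunctions is known, a pair (u, v) of L^2 functions lies in it exactly when c_i(v) = lam_i
    c_i(u) for all i, so inverting A - z becomes division by lam_i - z. Two points need care. A
    cylinder function of level n has to be tested against eigenfunctions of deeper sectors as well;
    both coefficients are then 0, because exchanging copies at a level beyond n changes the sign of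
    the eigenfunction alone. And boundedness of the inverse asks for a positive distance from z to
    all eigenvalues at once: as every 1 / d_n is an integer, each eigenvalue is the square of an
    integer multiple of pi / 2, whatever the sector. The same integrality makes the first family of
    the statement equal to the set of all k^2 pi^2, the Neumann eigenvalues of [0, 1] in the empty
    sector. The second family starts at n = 2 because the midpoint of a gap of length 2 d_n is a
    multiple of d_(n-1) strictly between 0 and 1; the third comes from the mixed conditions on the
    gap [0, d_n]. *)

Section RealL2.
Context d (T : measurableType d) (R : realType).
Variable mu : {measure set T -> \bar R}.
Hypothesis mu_fin : (mu setT < +oo)%E.
Implicit Types (u v w : T -> R).

(** Measurability of [u] is asked separately, since [u ^+ 2] forgets the sign of [u]. *)
Definition sq_int (u : T -> R) : Prop :=
  measurable_fun setT u /\ mu.-integrable setT (EFin \o (fun x => u x ^+ 2)).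

Definition ip (u v : T -> R) : R := \int[mu]_x (u x * v x).

Lemma sq_int_mul u v : sq_int u -> sq_int v ->
  mu.-integrable setT (EFin \o (fun x => u x * v x)).
Proof.
move=> [mu_ iu] [mv iv].
apply: (@le_integrable _ _ _ mu _ measurableT _
  (EFin \o (fun x => u x ^+ 2 + v x ^+ 2))).
- by apply/measurable_EFinP; exact: measurable_funM.
- move=> x _; rewrite /= lee_fin [leRHS]ger0_norm; last by rewrite addr_ge0// sqr_ge0.
  by rewrite ler_norml; apply/andP; split; nra.
- exact: (integrableD measurableT iu iv).
Qed.

Lemma eq_sq_int u v : u =1 v -> sq_int u -> sq_int v.
Proof. by move=> /funext ->. Qed.

Lemma sq_int_bounded (u : T -> R) (M : R) : measurable_fun setT u ->
  (forall x, `|u x| <= M) -> sq_int u.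
Proof.
move=> mu_ uM; split=> //.
apply: measurable_bounded_integrable => //.
  exact: measurable_funX.
exists (M ^+ 2); split; first exact: num_real.
move=> K MK x _; rewrite /= normrX (le_trans _ (ltW MK))// lerXn2r ?nnegrE//.
exact: le_trans (uM x).
Qed.

Lemma sq_intZ (c : R) u : sq_int u -> sq_int (fun x => c * u x).
Proof.
move=> [mu_ iu]; split.
  by apply: measurable_funM.
have := integrableZl measurableT (c ^+ 2) iu.
apply: eq_integrable => //.
by move=> x _; rewrite /= -EFinM exprMn.
Qed.

Lemma sq_intD u v : sq_int u -> sq_int v -> sq_int (fun x => u x + v x).
Proof.
move=> Hu Hv; have iuv := sq_int_mul Hu Hv; case: Hu Hv => mu_ iu [mv iv]; split.
  exact: measurable_funD.
have := integrableD measurableT (integrableD measurableT iu iv)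
  (integrableZl measurableT 2 iuv).
apply: eq_integrable => //.
by move=> x _; rewrite /= -!EFinD; congr EFin; rewrite sqrrD -mulr_natl; ring.
Qed.

Lemma sq_int0 : sq_int (fun=> 0).
Proof. by apply: (@sq_int_bounded _ 0) => // x; rewrite normr0. Qed.

Lemma sq_intB u v : sq_int u -> sq_int v -> sq_int (fun x => u x - v x).
Proof.
move=> Hu Hv; apply: (@eq_sq_int (fun x => u x + -1 * v x)).
  by move=> x; rewrite mulN1r.
by apply: sq_intD => //; exact: sq_intZ.
Qed.

Lemma sq_int_sum (I : Type) (r : seq I) (u : I -> T -> R) :
  (forall i, sq_int (u i)) -> sq_int (fun x => \sum_(i <- r) u i x).
Proof.
move=> Hu; elim: r => [|i r ih]; first by apply: eq_sq_int sq_int0 => x; rewrite big_nil.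
by apply: eq_sq_int (sq_intD (Hu i) ih) => x; rewrite big_cons.
Qed.

Lemma sq_int_integrable u : sq_int u -> mu.-integrable setT (EFin \o u).
Proof.
move=> Hu; have H1 : sq_int (fun=> 1).
  by apply: (@sq_int_bounded _ 1) => // x; rewrite normr1.
by have := sq_int_mul Hu H1; apply: eq_integrable => // x _; rewrite /= mulr1.
Qed.

Lemma ipC u v : ip u v = ip v u.
Proof. by apply: eq_Rintegral => x _; rewrite mulrC. Qed.

Lemma eq_ip u u' v v' : u =1 u' -> v =1 v' -> ip u v = ip u' v'.
Proof. by move=> /funext -> /funext ->. Qed.

Lemma ipDl u v w : sq_int u -> sq_int v -> sq_int w ->
  ip (fun x => u x + v x) w = ip u w + ip v w.
Proof.
move=> Hu Hv Hw; rewrite /ip.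
rewrite -RintegralD//; [|exact: sq_int_mul..].
by apply: eq_Rintegral => x _; rewrite mulrDl.
Qed.

Lemma ipZl (c : R) u w : sq_int u -> sq_int w ->
  ip (fun x => c * u x) w = c * ip u w.
Proof.
move=> Hu Hw; rewrite /ip -RintegralZl//; last exact: sq_int_mul.
by apply: eq_Rintegral => x _; rewrite mulrA.
Qed.

Lemma ipDr u v w : sq_int u -> sq_int v -> sq_int w ->
  ip w (fun x => u x + v x) = ip w u + ip w v.
Proof. by move=> *; rewrite ipC ipDl// (ipC u) (ipC v). Qed.

Lemma ipZr (c : R) u w : sq_int u -> sq_int w ->
  ip w (fun x => c * u x) = c * ip w u.
Proof. by move=> *; rewrite ipC ipZl// ipC. Qed.

Lemma ipBl u v w : sq_int u -> sq_int v -> sq_int w ->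
  ip (fun x => u x - v x) w = ip u w - ip v w.
Proof.
move=> Hu Hv Hw; rewrite -mulN1r -(ipZl _ Hv Hw) -ipDl//; last exact: sq_intZ.
by apply: eq_ip => // x; rewrite mulN1r.
Qed.

Lemma ipBr u v w : sq_int u -> sq_int v -> sq_int w ->
  ip w (fun x => u x - v x) = ip w u - ip w v.
Proof. by move=> *; rewrite ipC ipBl// (ipC u) (ipC v). Qed.

Lemma ip0l w : ip (fun=> 0) w = 0.
Proof. by rewrite /ip; under eq_Rintegral do rewrite mul0r; rewrite /Rintegral integral0. Qed.

Lemma ip_suml (I : Type) (r : seq I) (u : I -> T -> R) w :
  (forall i, sq_int (u i)) -> sq_int w ->
  ip (fun x => \sum_(i <- r) u i x) w = \sum_(i <- r) ip (u i) w.
Proof.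
move=> Hu Hw; elim: r => [|i r ih].
  by rewrite big_nil -[RHS](ip0l w); apply: eq_ip => // x; rewrite big_nil.
rewrite big_cons -ih -(ipDl (Hu i) _ Hw); last exact: sq_int_sum.
by apply: eq_ip => // x; rewrite big_cons.
Qed.

Lemma ip_sumr (I : Type) (r : seq I) (u : I -> T -> R) w :
  (forall i, sq_int (u i)) -> sq_int w ->
  ip w (fun x => \sum_(i <- r) u i x) = \sum_(i <- r) ip w (u i).
Proof. by move=> *; rewrite ipC ip_suml//; apply: eq_bigr => i _; rewrite ipC. Qed.

Lemma ip_ge0 u : 0 <= ip u u.
Proof. by apply: Rintegral_ge0 => x _; rewrite -expr2 sqr_ge0. Qed.

Lemma ip_selfB u v : sq_int u -> sq_int v ->
  ip (fun x => u x - v x) (fun x => u x - v x) = ip u u - 2 * ip u v + ip v v.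
Proof.
move=> Hu Hv; rewrite ipBl ?ipBr//; try exact: sq_intB.
by rewrite (ipC v u); ring.
Qed.

(** The quadratic polynomial t -> |u - t v|^2 is nonnegative; it is evaluated at its minimum. The
    form is only semidefinite on functions, hence the separate case of a null [v]. *)
Lemma cauchy_schwarz u v : sq_int u -> sq_int v -> ip u v ^+ 2 <= ip u u * ip v v.
Proof.
move=> Hu Hv.
have key t : 0 <= ip u u - 2 * t * ip u v + t ^+ 2 * ip v v.
  have := ip_ge0 (fun x => u x - t * v x).
  rewrite ip_selfB ?ipZr ?ipZl//; [|exact: sq_intZ..].
  by move/le_trans; apply; rewrite le_eqVlt; apply/orP; left; apply/eqP; ring.
have [C0|C0] := eqVneq (ip v v) 0.
  have [->|B0] := eqVneq (ip u v) 0; first by rewrite expr0n /= C0 mulr0.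
  (* For a null [v] the polynomial is affine in t; this t makes it equal to -1. *)
  have := key ((ip u u + 1) / (2 * ip u v)); rewrite C0 mulr0 addr0.
  have -> : 2 * ((ip u u + 1) / (2 * ip u v)) * ip u v = ip u u + 1 by field.
  by lra.
have Cp : 0 < ip v v by rewrite lt_neqAle eq_sym C0 ip_ge0.
have := key (ip u v / ip v v).
have -> : ip u u - 2 * (ip u v / ip v v) * ip u v + (ip u v / ip v v) ^+ 2 * ip v v
   = ip u u - ip u v ^+ 2 / ip v v by field.
by rewrite subr_ge0 ler_pdivrMr.
Qed.

(** This makes null members of a family harmless: every coefficient along them is 0. *)
Lemma ip_eq0_l u v : sq_int u -> sq_int v -> ip u u = 0 -> ip u v = 0.
Proof.
move=> Hu Hv u0; have := cauchy_schwarz Hu Hv; rewrite u0 mul0r => h.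
by apply/eqP; rewrite -sqrf_eq0 eq_le h sqr_ge0.
Qed.

Lemma ip_self_ereal u : sq_int u -> (ip u u)%:E = (\int[mu]_x ((u x ^+ 2)%:E))%E.
Proof.
move=> [mu_ iu]; rewrite /ip /Rintegral fineK; first by under eq_integral do rewrite -expr2.
rewrite (_ : (fun x => _) = EFin \o (fun x => u x ^+ 2)).
  exact: integrable_fin_num.
by apply/funext => x; rewrite /= expr2.
Qed.

Lemma eq_ae_ip u u' v : measurable_fun setT u -> measurable_fun setT u' ->
  measurable_fun setT v -> {ae mu, forall x, u x = u' x} -> ip u v = ip u' v.
Proof.
move=> Hu Hu' Hv uu'; congr fine; apply: ae_eq_integral => //.
- by apply/measurable_EFinP; exact: measurable_funM.
- by apply/measurable_EFinP; exact: measurable_funM.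
- by apply: filterS uu' => x -> _.
Qed.

End RealL2.

Lemma cvg_EFin_comp (R : realType) (u : nat -> R) (l : R) :
  u @ \oo --> l -> (fun n => (u n)%:E) @ \oo --> l%:E.
Proof. by move=> ul; apply: cvg_EFin => //; exact: nearW. Qed.

(** * Bessel, Riesz-Fischer and Parseval for an orthogonal family *)

Section OrthogonalExpansion.
Context d (T : measurableType d) (R : realType).
Variable mu : {measure set T -> \bar R}.
Hypothesis mu_fin : (mu setT < +oo)%E.
Variable e : nat -> T -> R.
Hypothesis e_sq : forall i, sq_int mu (e i).
Hypothesis e_orth : forall i k, i != k -> ip mu (e i) (e k) = 0.
(* Null vectors are allowed in the family: this dispenses with enumerating exactly the
   admissible indices. *)
Hypothesis e_norm : forall i, ip mu (e i) (e i) = 0 \/ ip mu (e i) (e i) = 1.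

Local Notation ip := (ip mu).
Local Notation sq_int := (sq_int mu).

Definition psum (a : nat -> R) (N : nat) (x : T) : R := \sum_(i < N) a i * e i x.

Lemma sq_int_psum a N : sq_int (psum a N).
Proof. by apply: (sq_int_sum mu_fin) => i; exact: sq_intZ. Qed.

Lemma ip_psum a N v : sq_int v -> ip (psum a N) v = \sum_(i < N) a i * ip (e i) v.
Proof.
move=> Hv; rewrite /psum (ip_suml mu_fin)//; last by move=> i; exact: sq_intZ.
by apply: eq_bigr => i _; rewrite ipZl.
Qed.

Lemma ip_psum_e a N k :
  ip (psum a N) (e k) = if (k < N)%N then a k * ip (e k) (e k) else 0.
Proof.
rewrite ip_psum//; case: ifPn => kN.
  rewrite (bigD1 (Ordinal kN))//= big1 ?addr0// => i ik.
  by rewrite e_orth ?mulr0.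
rewrite big1// => i _; rewrite e_orth ?mulr0//.
by apply: contra kN => /eqP <-.
Qed.

Lemma ip_psum_psum a N M : (M <= N)%N ->
  ip (psum a M) (psum a N) = \sum_(i < M) a i ^+ 2 * ip (e i) (e i).
Proof.
move=> MN; rewrite ip_psum; last exact: sq_int_psum.
apply: eq_bigr => i _; rewrite ipC ip_psum_e (leq_trans (ltn_ord i) MN).
by rewrite expr2 !mulrA.
Qed.

Lemma e_norm_le1 i : 0 <= ip (e i) (e i) <= 1.
Proof. by case: (e_norm i) => ->; rewrite ?lexx ?ler01. Qed.

(** Pythagoras on the indices from [M] to [N]; only an inequality because null vectors contribute
    nothing on the left. *)
Lemma psum_dist a N M : (M <= N)%N ->
  ip (fun x => psum a N x - psum a M x) (fun x => psum a N x - psum a M x) <=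
  \sum_(i < N) a i ^+ 2 - \sum_(i < M) a i ^+ 2.
Proof.
move=> MN; rewrite ip_selfB ?sq_int_psum//; try exact: sq_int_psum.
rewrite (ipC _ (psum a N) (psum a M)) !ip_psum_psum//.
rewrite -!(big_mkord xpredT (fun i => a i ^+ 2 * ip (e i) (e i))).
rewrite -!(big_mkord xpredT (fun i => a i ^+ 2)).
rewrite !(big_cat_nat (leq0n M) MN)/=.
have : \sum_(M <= i < N) a i ^+ 2 * ip (e i) (e i) <= \sum_(M <= i < N) a i ^+ 2.
  by apply: ler_sum => i _; rewrite ler_piMr ?sqr_ge0//; case/andP: (e_norm_le1 i).
by lra.
Qed.

Section RieszFischer.
Variables (a : nat -> R) (C : R).
Hypothesis aC : forall N, \sum_(i < N) a i ^+ 2 <= C.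

Let S N := \sum_(i < N) a i ^+ 2.
Let l := limn S.

Let S_nd : nondecreasing_seq S.
Proof.
apply/nondecreasing_seqP => n; rewrite /S big_ord_recr /= lerDl; exact: sqr_ge0.
Qed.

Let S_cvg : S @ \oo --> l.
Proof.
have /cvg_ex[l' Sl] := nondecreasing_is_cvgn S_nd (ex_intro _ C (fun y '(ex_intro2 N _ yN) =>
   eq_ind _ (fun z => z <= C) (aC N) _ yN)).
by rewrite /l (cvg_lim _ Sl).
Qed.

Let S_le N : S N <= l.
Proof. by apply: nondecreasing_cvgn_le => //; apply/cvg_ex; exists l. Qed.

Let fast k : exists N, (k <= N)%N /\ l - S N <= (2^-1) ^+ k ^+ 2.
Proof.
have /cvgrPdist_le /(_ ((2^-1) ^+ k ^+ 2)) := S_cvg.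
have h0 : 0 < (2^-1 : R) ^+ k ^+ 2 by rewrite !exprn_gt0// invr_gt0.
move=> /(_ h0)[N _ HN]; exists (maxn N k); split; first exact: leq_maxr.
by have := HN (maxn N k) (leq_maxl _ _); rewrite ger0_norm ?subr_ge0.
Qed.

(** The partial sums are Cauchy in L^2, and a subsequence with tails below 4^(-k) has increments
    that are summable almost everywhere. Its pointwise limit is the function sought, and Fatou's
    lemma turns the Cauchy estimate into the distance bound of the third clause, from which the
    first two follow. *)
Lemma riesz_fischer : exists u, [/\ sq_int u,
  (forall i, ip u (e i) = a i * ip (e i) (e i)) &
  (forall M, ip (fun x => u x - psum a M x) (fun x => u x - psum a M x) <=
    limn (fun N => \sum_(i < N) a i ^+ 2) - \sum_(i < M) a i ^+ 2)].
Proof.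
have /choice[N HN] := fast.
pose v k := psum a (N k).
pose g k x := v k.+1 x - v k x.
have v_sq k : sq_int (v k) by exact: sq_int_psum.
have g_sq k : sq_int (g k) by exact: sq_intB.
have g_small k : ip (g k) (g k) <= (2^-1) ^+ k ^+ 2.
  (* The chosen indices [N k] need not increase with [k], so both orders occur. *)
  rewrite /g /v; have [le|/ltnW le] := leqP (N k) (N k.+1).
    apply: le_trans (psum_dist a le) _; apply: le_trans (HN k).2.
    by rewrite lerD2r S_le.
  have -> : ip (fun x => psum a (N k.+1) x - psum a (N k) x)
     (fun x => psum a (N k.+1) x - psum a (N k) x) =
     ip (fun x => psum a (N k) x - psum a (N k.+1) x)
     (fun x => psum a (N k) x - psum a (N k.+1) x).
    by apply: eq_Rintegral => x _; ring.
  apply: le_trans (psum_dist a le) _.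
  apply: (@le_trans _ _ (l - S (N k.+1))); first by rewrite lerD2r S_le.
  apply: le_trans (HN k.+1).2 _.
  rewrite lerXn2r ?nnegrE ?exprn_ge0 ?invr_ge0// exprS ler_piMl ?exprn_ge0 ?invr_ge0//.
  by rewrite invf_le1 ?ler1n.
have mg k : measurable_fun setT (EFin \o (fun x => `|g k x|)).
  apply/measurable_EFinP; apply: measurableT_comp => //; exact: (g_sq k).1.
pose m := fine (mu setT).
have int_g k : (\int[mu]_x (`|g k x|)%:E <= ((2^-1) ^+ k * ((1 + m) / 2))%:E)%E.
  have i1 : mu.-integrable setT (EFin \o (fun x => 2 ^+ k / 2 * g k x ^+ 2)).
    exact: (integrableZl measurableT _ (g_sq k).2).
  have i2 : mu.-integrable setT (EFin \o (fun=> (2^-1) ^+ k / 2 : R)).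
    apply: measurable_bounded_integrable => //.
    exists ((2^-1) ^+ k / 2); split; first exact: num_real.
    move=> K /ltW + x _; apply: le_trans.
    by rewrite ger0_norm// divr_ge0// exprn_ge0// invr_ge0.
  (* Weighted AM-GM, y <= 2^k y^2 / 2 + 2^(-k) / 2: on a finite measure space it turns the L^2 bound
     4^(-k) into an L^1 bound of order 2^(-k). *)
  apply: (@le_trans _ _ (\int[mu]_x ((2 ^+ k / 2 * g k x ^+ 2 + (2^-1) ^+ k / 2)%:E))%E).
    apply: ge0_le_integral => //.
    - exact: mg.
    - apply/measurable_EFinP; apply: measurable_funD => //.
      by apply: measurable_funM => //; apply: measurable_funX; exact: (g_sq k).1.
    move=> x _; rewrite lee_fin -(real_normK (num_real (g k x))) exprVn.
    set y := `|g k x|; have p0 : 0 < 2 ^+ k :> R by rewrite exprn_gt0.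
    have -> : 2 ^+ k / 2 * y ^+ 2 + (2 ^+ k)^-1 / 2 =
      y + (2 ^+ k)^-1 / 2 * (2 ^+ k * y - 1) ^+ 2.
      field; exact: lt0r_neq0.
    by rewrite lerDl mulr_ge0 ?sqr_ge0// divr_ge0// invr_ge0 ltW.
  under eq_integral do rewrite EFinD.
  rewrite (integralD_EFin measurableT i1 i2).
  have -> : (\int[mu]_x ((2 ^+ k / 2 * g k x ^+ 2)%:E) = (2 ^+ k / 2 * ip (g k) (g k))%:E)%E.
    rewrite EFinM (ip_self_ereal (g_sq k)) -integralZl//; exact: (g_sq k).2.
  rewrite integral_cst// -(@fineK _ (mu setT)); last by rewrite ge0_fin_numE.
  rewrite -EFinM -EFinD lee_fin -/m.
  apply: (@le_trans _ _ (2 ^+ k / 2 * (2^-1) ^+ k ^+ 2 + (2^-1) ^+ k / 2 * m)).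
    by rewrite lerD2r ler_wpM2l// divr_ge0// exprn_ge0.
  have p0 : 2 ^+ k != 0 :> R by rewrite expf_neq0.
  by rewrite le_eqVlt; apply/orP; left; apply/eqP; rewrite exprVn; field.
have m0 : 0 <= (1 + m) / 2 by rewrite divr_ge0// addr_ge0// fine_ge0.
have sum_fin : (\int[mu]_x (\sum_(0 <= k <oo) (`|g k x|)%:E) < +oo)%E.
  rewrite integral_nneseries//.
  apply: (@le_lt_trans _ _ (\sum_(0 <= k <oo) ((2^-1) ^+ k * ((1 + m) / 2))%:E)%E).
    apply: lee_nneseries => [k _ _|k _]; last exact: int_g.
    by apply: integral_ge0 => x _; rewrite lee_fin normr_ge0.
  have c : series (geometric ((1 + m) / 2) (2^-1 : R)) @ \oo --> ((1 + m) / 2) / (1 - 2^-1).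
    by apply: cvg_geometric_series; rewrite ger0_norm ?invr_ge0// invf_lt1// ltr1n.
  rewrite (_ : (\sum_(0 <= k <oo) _)%E = (((1 + m) / 2) / (1 - 2^-1))%:E) ?ltry//.
  apply/cvg_lim => //; rewrite (_ : (fun _ => _) = (fun n => (series (geometric ((1 + m) / 2) (2^-1 : R)) n)%:E)).
    exact: cvg_EFin_comp.
  apply/funext => n; rewrite /= sumEFin; congr EFin; rewrite /series /=.
  by apply: eq_bigr => i _; rewrite /= mulrC.
have ae_fin : {ae mu, forall x, (\sum_(0 <= k <oo) (`|g k x|)%:E < +oo)%E}.
  have ms : measurable_fun setT (fun x => (\sum_(0 <= k <oo) (`|g k x|)%:E)%E).
    apply: (@ge0_emeasurable_sum _ _ _ setT (fun k x => (`|g k x|)%:E) xpredT) => //.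
    by move=> k _; exact: mg.
  have s0 x : (0 <= \sum_(0 <= k <oo) (`|g k x|)%:E)%E.
    by apply: nneseries_ge0 => *; rewrite lee_fin normr_ge0.
  have : mu.-integrable setT (fun x => (\sum_(0 <= k <oo) (`|g k x|)%:E)%E).
    by apply/integrableP; split=> //; under eq_integral do rewrite gee0_abs//.
  move=> /(integrable_ae measurableT); apply: filterS => x /(_ I).
  by rewrite ge0_fin_numE.
have ae_cvg : {ae mu, forall x, cvgn (fun k => v k x)}.
  apply: filterS ae_fin => x xfin.
  have : cvgn (series (fun k => g k x)).
    apply: normed_cvg; apply: nondecreasing_is_cvgn.
      by apply/nondecreasing_seqP => n; rewrite -[leRHS]/(series (fun k => `|g k x|) n.+1) seriesSr lerDl normr_ge0.
    exists (fine (\sum_(0 <= k <oo) (`|g k x|)%:E)%E) => _ [n _ <-].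
    rewrite -lee_fin fineK; last first.
      by rewrite ge0_fin_numE//; apply: nneseries_ge0 => *; rewrite lee_fin normr_ge0.
    rewrite /series /= -sumEFin.
    by apply: nneseries_lim_ge => *; rewrite lee_fin normr_ge0.
  have -> : series (fun k => g k x) = (fun k => v k x - v 0 x).
    by apply/funext => n; rewrite /series /= telescope_sumr.
  move=> h; have -> : (fun k => v k x) = (fun k => (v k x - v 0 x) + v 0 x).
    by apply/funext => k; rewrite subrK.
  by apply: is_cvgD => //; exact: is_cvg_cst.
(* The upper limit is defined and measurable everywhere, and agrees with the limit wherever the
   latter exists. *)
pose u x := fine (limn_esup (fun k => (v k x)%:E)).
have mu_ : measurable_fun setT u.
  apply: measurableT_comp => //.
  apply: (@measurable_fun_limn_esup _ _ _ _ (fun k x => (v k x)%:E)) => k.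
  apply/measurable_EFinP; exact: (v_sq k).1.
have u_lim : {ae mu, forall x, (fun k => v k x) @ \oo --> u x}.
  apply: filterS ae_cvg => x /cvg_ex[y vy].
  suff -> : u x = y by [].
  have vyE : (fun k => (v k x)%:E) @ \oo --> y%:E by apply: cvg_EFin_comp.
  rewrite /u is_cvg_limn_esupE; last by apply/cvg_ex; exists y%:E.
  by rewrite (cvg_lim _ vyE).
have fat M : (\int[mu]_x (((u x - psum a M x) ^+ 2)%:E) <= (l - S M)%:E)%E.
  have mM : measurable_fun setT (psum a M) by exact: (sq_int_psum a M).1.
  have mf k : measurable_fun setT (fun x => ((v k x - psum a M x) ^+ 2)%:E).
    apply/measurable_EFinP; apply: measurable_funX; apply: measurable_funB => //.
    exact: (v_sq k).1.
  apply: (@le_trans _ _ (\int[mu]_x (limn_einf (fun k => ((v k x - psum a M x) ^+ 2)%:E)))%E).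
    rewrite le_eqVlt; apply/orP; left; apply/eqP.
    apply: ae_eq_integral => //.
    - by apply/measurable_EFinP; apply: measurable_funX; exact: measurable_funB.
    - rewrite /limn_einf; apply: measurableT_comp => //.
      apply: (@measurable_fun_limn_esup _ _ _ _ (fun k x => (- ((v k x - psum a M x) ^+ 2)%:E)%E)).
      by move=> k; exact: measurableT_comp.
    apply: filterS u_lim => x vu _.
    have c : (fun k => ((v k x - psum a M x) ^+ 2)%:E) @ \oo -->
        ((u x - psum a M x) ^+ 2)%:E.
      apply: cvg_EFin_comp; rewrite expr2.
      rewrite (_ : (fun _ => _) = (fun k => (v k x - psum a M x) * (v k x - psum a M x))).
        by apply: cvgM; apply: cvgB => //; exact: cvg_cst.
      by apply/funext => k; rewrite expr2.
    rewrite is_cvg_limn_einfE; last by apply/cvg_ex; eexists; exact: c.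
    by rewrite (cvg_lim _ c).
  apply: le_trans (fatou mu measurableT mf _) _.
    by move=> k x _; rewrite lee_fin sqr_ge0.
  rewrite limn_einf_lim; apply: lime_le; first exact: is_cvg_einfs.
  near=> n.
  (* The infimum over the tail from [n] is bounded by its term at [maxn n M], whose partial sum has
     at least [M] terms because [k <= N k]. *)
  apply: (@le_trans _ _ (\int[mu]_x (((v (maxn n M) x - psum a M x) ^+ 2)%:E))%E).
    by apply: ereal_inf_lbound; exists (maxn n M) => //=; exact: leq_maxl.
  rewrite -ip_self_ereal; last by apply: sq_intB => //; exact: sq_int_psum.
  rewrite lee_fin; have le : (M <= N (maxn n M))%N.
    exact: leq_trans (leq_maxr n M) (HN _).1.
  by apply: le_trans (psum_dist a le) _; rewrite lerD2r S_le.
have d_sq M : sq_int (fun x => u x - psum a M x).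
  have mM : measurable_fun setT (fun x => u x - psum a M x).
    by apply: measurable_funB => //; exact: (sq_int_psum a M).1.
  split=> //; apply/integrableP; split.
    by apply/measurable_EFinP; exact: measurable_funX.
  under eq_integral do rewrite gee0_abs ?lee_fin ?sqr_ge0//.
  by apply: le_lt_trans (fat M) _; rewrite ltry.
have u_sq : sq_int u.
  apply: eq_sq_int (d_sq 0%N) => x; by rewrite /psum big_ord0 subr0.
have u_dist M : ip (fun x => u x - psum a M x) (fun x => u x - psum a M x) <= l - S M.
  by rewrite -lee_fin ip_self_ereal//; exact: fat.
exists u; split => // i.
have lim0 : (fun M => l - S M) @ \oo --> (0 : R).
  by rewrite -(subrr l); apply: cvgB => //; exact: cvg_cst.
(* The squared defect of the [i]-th coefficient is at most the squared distance from [u] to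
   [psum a M] for each [M > i], and this tends to 0. *)
apply/eqP; rewrite -subr_eq0 -sqrf_eq0 eq_le sqr_ge0 andbT.
apply: (ler_cvg_to (cvg_cst ((ip u (e i) - a i * ip (e i) (e i)) ^+ 2)) lim0).
near=> M; apply: le_trans (u_dist M).
have -> : ip u (e i) - a i * ip (e i) (e i) = ip (fun x => u x - psum a M x) (e i).
  rewrite ipBl//; last exact: sq_int_psum.
  rewrite ip_psum_e ifT//; near: M; exact: nbhs_infty_gt.
apply: le_trans (cauchy_schwarz (d_sq M) (e_sq i)) _.
by rewrite ler_piMr ?ip_ge0//; case/andP: (e_norm_le1 i).
Unshelve. all: by end_near. Qed.

End RieszFischer.

Lemma coef_norm v i : sq_int v -> ip v (e i) * ip (e i) (e i) = ip v (e i).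
Proof.
by move=> Hv; case: (e_norm i) => h; rewrite h ?mulr1// mulr0 ipC ip_eq0_l.
Qed.

Lemma ip_residual v N (r := fun x => v x - psum (fun i => ip v (e i)) N x) : sq_int v ->
  ip r r = ip v v - \sum_(i < N) ip v (e i) ^+ 2.
Proof.
move=> Hv; pose a i := ip v (e i); have Hs := sq_int_psum a N.
rewrite /r -/a ip_selfB// ip_psum_psum// (ipC _ v) ip_psum//.
rewrite (eq_bigr (fun i : 'I_N => a i ^+ 2)); last by move=> i _; rewrite ipC expr2.
rewrite [X in _ + X](eq_bigr (fun i : 'I_N => a i ^+ 2)); last first.
  by move=> i _; rewrite expr2 -mulrA coef_norm.
by ring.
Qed.

Lemma bessel v N : sq_int v -> \sum_(i < N) ip v (e i) ^+ 2 <= ip v v.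
Proof. by move=> Hv; rewrite -subr_ge0 -ip_residual// ip_ge0. Qed.

Hypothesis e_complete : forall v, sq_int v -> (forall i, ip v (e i) = 0) ->
  {ae mu, forall x, v x = 0}.

(** The Riesz-Fischer function with the coefficients of [v] differs from [v] by something orthogonal
    to the family, hence null by completeness; its distance bound therefore holds for [v]. *)
Lemma parseval v : sq_int v ->
  [/\ (fun N => \sum_(i < N) ip v (e i) ^+ 2) @ \oo --> ip v v &
   (fun N => ip (fun x => v x - psum (fun i => ip v (e i)) N x)
               (fun x => v x - psum (fun i => ip v (e i)) N x)) @ \oo --> (0 : R)].
Proof.
move=> Hv; pose a i := ip v (e i).
have [u [Hu ua ud]] := @riesz_fischer a _ (fun N => bessel N Hv).
have vu : {ae mu, forall x, v x - u x = 0}.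
  apply: e_complete; first exact: sq_intB.
  by move=> i; rewrite ipBl// ua coef_norm// subrr.
set l := limn _ in ud.
have S_cvg : (fun N => \sum_(i < N) ip v (e i) ^+ 2) @ \oo --> l.
  apply: nondecreasing_is_cvgn.
    by apply/nondecreasing_seqP => n; rewrite big_ord_recr /= lerDl; exact: sqr_ge0.
  by exists (ip v v) => _ [n _ <-]; exact: bessel.
have dist_eq N : ip (fun x => v x - psum a N x) (fun x => v x - psum a N x) =
    ip v v - \sum_(i < N) a i ^+ 2 by exact: ip_residual.
have dist_cvg : (fun N => ip (fun x => v x - psum a N x) (fun x => v x - psum a N x))
    @ \oo --> (0 : R).
  have tail0 : (fun N => l - \sum_(i < N) a i ^+ 2) @ \oo --> (l - l : R).
    by apply: cvgB => //; exact: cvg_cst.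
  rewrite subrr in tail0.
  apply: (squeeze_cvgr _ (cvg_cst 0) tail0).
  near=> N; rewrite ip_ge0/=; apply: le_trans (ud N).
  have Hs := sq_int_psum a N.
  rewrite (@eq_ae_ip _ _ _ mu _ (fun x => u x - psum a N x)).
  + rewrite ipC (@eq_ae_ip _ _ _ mu _ (fun x => u x - psum a N x))//.
    * exact: (sq_intB Hv Hs).1.
    * exact: (sq_intB Hu Hs).1.
    * exact: (sq_intB Hu Hs).1.
    * by apply: filterS vu => x /eqP; rewrite subr_eq0 => /eqP ->.
  + exact: (sq_intB Hv Hs).1.
  + exact: (sq_intB Hu Hs).1.
  + exact: (sq_intB Hv Hs).1.
  + by apply: filterS vu => x /eqP; rewrite subr_eq0 => /eqP ->.
split=> //.
have -> : (fun N => \sum_(i < N) ip v (e i) ^+ 2) =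
  (fun N => ip v v - ip (fun x => v x - psum a N x) (fun x => v x - psum a N x)).
  by apply/funext => N; rewrite dist_eq subKr.
have : (fun N => ip v v - ip (fun x => v x - psum a N x) (fun x => v x - psum a N x))
    @ \oo --> ip v v - 0 by apply: cvgB => //; exact: cvg_cst.
by rewrite subr0.
Unshelve. all: by end_near. Qed.

End OrthogonalExpansion.

(** * The spectrum of a diagonal operator *)

Section ResolventArithmetic.
Context (R : realFieldType).
(** In complex terms: z c + c' = l c gives c' = (l - z) c, so |c'|^2 = |l - z|^2 |c|^2, with z = x +
    iy, c = p + iq and c' = c1 + i c2. *)
Lemma resolvent_coef_le (l x y p q c1 c2 del : R) :
  x * p - y * q + c1 = l * p -> x * q + y * p + c2 = l * q ->
  del <= (l - x) ^+ 2 + y ^+ 2 -> del * (p ^+ 2 + q ^+ 2) <= c1 ^+ 2 + c2 ^+ 2.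
Proof.
move=> h1 h2 h.
have -> : c1 = (l - x) * p + y * q by rewrite -[LHS](addKr (x * p - y * q)) h1; ring.
have -> : c2 = (l - x) * q - y * p by rewrite -[LHS](addKr (x * q + y * p)) h2; ring.
have -> : ((l - x) * p + y * q) ^+ 2 + ((l - x) * q - y * p) ^+ 2 =
  ((l - x) ^+ 2 + y ^+ 2) * (p ^+ 2 + q ^+ 2) by ring.
by apply: ler_wpM2r => //; rewrite addr_ge0// sqr_ge0.
Qed.

(** Together with [resolvent_im], the real and imaginary parts of (c1 + i c2) / (l - (x + iy)). *)
Definition resolvent_re (l x y c1 c2 : R) : R := ((l - x) * c1 - y * c2) / ((l - x) ^+ 2 + y ^+ 2).
Definition resolvent_im (l x y c1 c2 : R) : R := ((l - x) * c2 + y * c1) / ((l - x) ^+ 2 + y ^+ 2).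

Lemma resolvent_reE (l x y c1 c2 : R) : 0 < (l - x) ^+ 2 + y ^+ 2 ->
  x * resolvent_re l x y c1 c2 - y * resolvent_im l x y c1 c2 + c1 =
  l * resolvent_re l x y c1 c2.
Proof. by move=> D; rewrite /resolvent_re /resolvent_im; field; rewrite gt_eqF. Qed.

Lemma resolvent_imE (l x y c1 c2 : R) : 0 < (l - x) ^+ 2 + y ^+ 2 ->
  x * resolvent_im l x y c1 c2 + y * resolvent_re l x y c1 c2 + c2 =
  l * resolvent_im l x y c1 c2.
Proof. by move=> D; rewrite /resolvent_re /resolvent_im; field; rewrite gt_eqF. Qed.

Lemma resolvent_sqr (l x y c1 c2 : R) : 0 < (l - x) ^+ 2 + y ^+ 2 ->
  resolvent_re l x y c1 c2 ^+ 2 + resolvent_im l x y c1 c2 ^+ 2 =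
  (c1 ^+ 2 + c2 ^+ 2) / ((l - x) ^+ 2 + y ^+ 2).
Proof. by move=> D; rewrite /resolvent_re /resolvent_im; field; rewrite gt_eqF. Qed.

Lemma resolvent0 (l x y : R) : resolvent_re l x y 0 0 = 0 /\ resolvent_im l x y 0 0 = 0.
Proof. by rewrite /resolvent_re /resolvent_im !mulr0 subr0 addr0 mul0r. Qed.

Lemma sumsqr_le0 (p q : R) : p ^+ 2 + q ^+ 2 <= 0 -> p = 0 /\ q = 0.
Proof.
move=> h; have : p ^+ 2 + q ^+ 2 == 0 by rewrite eq_le h addr_ge0// sqr_ge0.
by rewrite paddr_eq0 ?sqr_ge0// !sqrf_eq0 => /andP[/eqP -> /eqP ->].
Qed.

End ResolventArithmetic.

Section ComplexL2.
Context d (T : measurableType d) (R : realType).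
Variable mu : {measure set T -> \bar R}.
Hypothesis mu_fin : (mu setT < +oo)%E.
Implicit Types (u v w : T -> R[i]).

Local Notation ip := (ip mu).
Local Notation sq_int := (sq_int mu).
Local Notation re u := (fun x => complex.Re (u x)).
Local Notation im u := (fun x => complex.Im (u x)).

Definition sqnorm u : R := ip (re u) (re u) + ip (im u) (im u).

Lemma sqnorm_ge0 u : 0 <= sqnorm u.
Proof. by rewrite addr_ge0// ip_ge0. Qed.

Lemma normc_sqr (z : R[i]) :
  ComplexField.Normc.normc z ^+ 2 = complex.Re z ^+ 2 + complex.Im z ^+ 2.
Proof. by case: z => a b /=; rewrite sqr_sqrtr// addr_ge0// sqr_ge0. Qed.

Lemma L2normE u :
  L2norm mu u = ((\int[mu]_x ((complex.Re (u x) ^+ 2 + complex.Im (u x) ^+ 2)%:E)) `^ 2^-1)%E.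
Proof.
rewrite /L2norm unlock; congr (_ `^ _)%E; apply: eq_integral => x _.
rewrite -normc_sqr /= ger0_norm; last by case: (u x) => a b; exact: sqrtr_ge0.
rewrite powR_mulrn//; by case: (u x) => a b; exact: sqrtr_ge0.
Qed.

Lemma L2P u : L2 mu u <-> sq_int (re u) /\ sq_int (im u).
Proof.
split=> [[mr mi uoo]|[[mr ir] [mi ii]]]; last first.
  split => //; rewrite L2normE poweR_lty//.
  under eq_integral do rewrite EFinD.
  rewrite integralD_EFin//.
  by rewrite lte_add_pinfty//; apply: integrable_lty.
have m2r : measurable_fun setT (fun x => complex.Re (u x) ^+ 2) by exact: measurable_funX.
have m2i : measurable_fun setT (fun x => complex.Im (u x) ^+ 2) by exact: measurable_funX.
have int_fin : (\int[mu]_x ((complex.Re (u x) ^+ 2 + complex.Im (u x) ^+ 2)%:E) < +oo)%E.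
  rewrite ltey; apply/eqP => h; move: uoo.
  by rewrite L2normE h poweRyr ?ltxx// invr_eq0 pnatr_eq0.
split; split => //; apply/integrableP; split; try exact/measurable_EFinP.
- apply: le_lt_trans int_fin; apply: ge0_le_integral => //.
  + exact/measurable_EFinP/measurableT_comp.
  + by apply/measurable_EFinP; exact: measurable_funD.
  + by move=> x _; rewrite lee_fin ger0_norm ?sqr_ge0// lerDl sqr_ge0.
- apply: le_lt_trans int_fin; apply: ge0_le_integral => //.
  + exact/measurable_EFinP/measurableT_comp.
  + by apply/measurable_EFinP; exact: measurable_funD.
  + by move=> x _; rewrite lee_fin ger0_norm ?sqr_ge0// lerDr sqr_ge0.
Qed.

Lemma L2norm_sqnorm u : L2 mu u -> L2norm mu u = (Num.sqrt (sqnorm u))%:E.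
Proof.
move=> /L2P[Hr Hi]; rewrite L2normE.
under eq_integral do rewrite EFinD.
rewrite integralD_EFin//; [|exact: Hr.2|exact: Hi.2].
rewrite -!ip_self_ereal// -EFinD poweR_EFin; congr EFin.
by rewrite -/(sqnorm u) powR12_sqrt// sqnorm_ge0.
Qed.

Lemma reB u v : re (fun x => u x - v x) = fun x => complex.Re (u x) - complex.Re (v x).
Proof. by apply/funext => x; case: (u x) (v x) => ? ? []. Qed.

Lemma imB u v : im (fun x => u x - v x) = fun x => complex.Im (u x) - complex.Im (v x).
Proof. by apply/funext => x; case: (u x) (v x) => ? ? []. Qed.

Lemma L2_sub u v : L2 mu u -> L2 mu v -> L2 mu (fun x => u x - v x).
Proof.
by move=> /L2P[ur ui] /L2P[vr vi]; apply/L2P; rewrite reB imB; split; exact: sq_intB.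
Qed.

Section SpectralTheorem.
Variables (e : nat -> T -> R) (lam : nat -> R).
Hypothesis e_sq : forall i, sq_int (e i).
Hypothesis e_orth : forall i k, i != k -> ip (e i) (e k) = 0.
Hypothesis e_norm : forall i, ip (e i) (e i) = 0 \/ ip (e i) (e i) = 1.
Hypothesis e_complete : forall v : T -> R, sq_int v -> (forall i, ip v (e i) = 0) ->
  {ae mu, forall x, v x = 0}.

Variable A0 : (T -> R[i]) -> (T -> R[i]) -> Prop.
Hypothesis A0_coef : forall f g, A0 f g ->
  [/\ L2 mu f, L2 mu g,
   (forall i, ip (re g) (e i) = lam i * ip (re f) (e i)) &
   (forall i, ip (im g) (e i) = lam i * ip (im f) (e i))].
Hypothesis A0_psum : forall (a b : nat -> R) (N : nat),
  A0 (fun x => psum e a N x +i* psum e b N x)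
     (fun x => psum e (fun i => lam i * a i) N x +i* psum e (fun i => lam i * b i) N x).

Lemma coef_le w i : L2 mu w ->
  `|ip (re w) (e i)| <= Num.sqrt (sqnorm w) /\ `|ip (im w) (e i)| <= Num.sqrt (sqnorm w).
Proof.
move=> /L2P[wr wi]; have /andP[n0 n1] := e_norm_le1 e_norm i.
split; rewrite -sqrtr_sqr; apply: ler_wsqrtr.
- apply: le_trans (cauchy_schwarz wr (e_sq i)) _.
  apply: (@le_trans _ _ (ip (re w) (re w))); first by rewrite ler_piMr ?ip_ge0.
  by rewrite lerDl ip_ge0.
- apply: le_trans (cauchy_schwarz wi (e_sq i)) _.
  apply: (@le_trans _ _ (ip (im w) (im w))); first by rewrite ler_piMr ?ip_ge0.
  by rewrite lerDr ip_ge0.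
Qed.

Lemma sqnorm_psum_cvg w : L2 mu w ->
  (fun N => sqnorm (fun x => w x -
     (psum e (fun i => ip (re w) (e i)) N x +i* psum e (fun i => ip (im w) (e i)) N x)))
   @ \oo --> (0 : R).
Proof.
move=> /L2P[wr wi].
have [_ cr] := parseval mu_fin e_sq e_orth e_norm e_complete wr.
have [_ ci] := parseval mu_fin e_sq e_orth e_norm e_complete wi.
have c := cvgD cr ci; rewrite addr0 in c.
have E N : sqnorm (fun x => w x -
     (psum e (fun i => ip (re w) (e i)) N x +i* psum e (fun i => ip (im w) (e i)) N x)) =
   ip (fun x => complex.Re (w x) - psum e (fun i => ip (re w) (e i)) N x)
      (fun x => complex.Re (w x) - psum e (fun i => ip (re w) (e i)) N x) +
   ip (fun x => complex.Im (w x) - psum e (fun i => ip (im w) (e i)) N x)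
      (fun x => complex.Im (w x) - psum e (fun i => ip (im w) (e i)) N x).
  by rewrite /sqnorm; congr (_ + _); apply: eq_Rintegral => x _ /=; case: (w x).
by under eq_fun do rewrite E; exact: c.
Qed.

(** Coefficients are continuous for the L^2 norm, so the relation between them survives the closure.
    Conversely, truncating the expansions of [u] and [v] at the same rank gives a pair in [A0], and
    both truncations converge by Parseval. Hence the closure is the maximal operator multiplying
    coefficients by [lam]. *)
Lemma graph_closureP u v : graph_closure mu A0 u v <->
  [/\ L2 mu u, L2 mu v,
   (forall i, ip (re v) (e i) = lam i * ip (re u) (e i)) &
   (forall i, ip (im v) (e i) = lam i * ip (im u) (e i))].
Proof.
split=> [[Hu Hv H]|[Hu Hv Hr Hi]].
  have key i eps : 0 < eps ->
      `|ip (re v) (e i) - lam i * ip (re u) (e i)| <= (1 + `|lam i|) * eps /\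
      `|ip (im v) (e i) - lam i * ip (im u) (e i)| <= (1 + `|lam i|) * eps.
    move=> /H[f [g [/A0_coef[Hf Hg fgr fgi]]]].
    have Huf := L2_sub Hu Hf; have Hvg := L2_sub Hv Hg.
    rewrite !L2norm_sqnorm// -EFinD lte_fin => ltep.
    have [cvr cvi] := coef_le i Hvg; have [cur cui] := coef_le i Huf.
    have p0 := sqrtr_ge0 (sqnorm (fun x => u x - f x)).
    have q0 := sqrtr_ge0 (sqnorm (fun x => v x - g x)).
    have est (P Q : R) : `|P| <= Num.sqrt (sqnorm (fun x => v x - g x)) ->
        `|Q| <= Num.sqrt (sqnorm (fun x => u x - f x)) -> `|P - lam i * Q| <= (1 + `|lam i|) * eps.
      have l0 := normr_ge0 (lam i).
      move=> hP hQ; apply: le_trans (ler_normB _ _) _; rewrite normrM.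
      by apply: le_trans (lerD hP (ler_wpM2l l0 hQ)) _; nra.
    move: Hu Hv Hf Hg => /L2P[ur ui] /L2P[vr vi] /L2P[fr fi] /L2P[gr gi].
    split.
      have -> : ip (re v) (e i) - lam i * ip (re u) (e i) =
         ip (re (fun x => v x - g x)) (e i) - lam i * ip (re (fun x => u x - f x)) (e i).
        rewrite !reB !ipBl// fgr; ring.
      exact: est.
    have -> : ip (im v) (e i) - lam i * ip (im u) (e i) =
       ip (im (fun x => v x - g x)) (e i) - lam i * ip (im (fun x => u x - f x)) (e i).
      rewrite !imB !ipBl// fgi; ring.
    exact: est.
  have small (y c : R) : 0 < c -> (forall eps, 0 < eps -> `|y| <= c * eps) -> y = 0.
    move=> c0 h; apply/eqP; apply: contraT => y0.
    have yp : 0 < `|y| by rewrite normr_gt0.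
    have e0 : 0 < `|y| / (2 * c) by rewrite divr_gt0// mulr_gt0.
    have := h _ e0; have -> : c * (`|y| / (2 * c)) = `|y| / 2 by field; rewrite gt_eqF.
    lra.
  have c0 i : 0 < 1 + `|lam i| by rewrite ltr_wpDr.
  split=> // i; apply/eqP; rewrite -subr_eq0; apply/eqP; apply: (small _ _ (c0 i)) => eps eps0.
    by case: (key i eps eps0).
  by case: (key i eps eps0).
split=> // eps eps0.
(* Each of the two norms will be at most eps / 4, so that their sum stays strictly below eps. *)
have h4 : 0 < (eps / 4) ^+ 2 by rewrite exprn_gt0// divr_gt0.
have /cvgr0Pnorm_lt /(_ _ h4)[N1 _ HN1] := sqnorm_psum_cvg Hu.
have /cvgr0Pnorm_lt /(_ _ h4)[N2 _ HN2] := sqnorm_psum_cvg Hv.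
pose N := maxn N1 N2.
have := A0_psum (fun i => ip (re u) (e i)) (fun i => ip (im u) (e i)) N.
set f := fun x => _; set g := fun x => _ => Afg.
have [Hf Hg _ _] := A0_coef Afg.
exists f, g; split=> //.
rewrite !L2norm_sqnorm; [|exact: L2_sub..].
have gE : (fun x => v x - (psum e (fun i => ip (re v) (e i)) N x +i*
    psum e (fun i => ip (im v) (e i)) N x)) = fun x => v x - g x.
  by rewrite (funext Hr) (funext Hi).
have := HN1 N (leq_maxl _ _); rewrite /= ger0_norm ?sqnorm_ge0// => /ltW/ler_wsqrtr.
have := HN2 N (leq_maxr _ _); rewrite /= ger0_norm ?sqnorm_ge0// => /ltW/ler_wsqrtr.
have e4 : 0 <= eps / 4 by rewrite divr_ge0// ltW.
rewrite gE -/f sqrtr_sqr (ger0_norm e4) => h1 h2.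
have h2' : Num.sqrt (sqnorm (fun x => u x - f x)) <= eps / 4 := h2.
by rewrite -EFinD lte_fin; apply: le_lt_trans (lerD h2' h1) _; lra.
Qed.

(** A normalized [e k] is an eigenvector, so injectivity fails at [lam k]. Away from these values
    the coefficients of [f] are divided by [lam i - z]; the uniform lower bound [delta] on
    [|lam i - z|] keeps the quotients square-summable and makes [delta^-1] a bound for the
    inverse. *)
Lemma spectral_theorem :
  (forall z : R[i], (forall i, ip (e i) (e i) = 1 -> z != (lam i)%:C) ->
    exists2 delta : R, 0 < delta & forall i, ip (e i) (e i) = 1 ->
      delta ^+ 2 <= (lam i - complex.Re z) ^+ 2 + complex.Im z ^+ 2) ->
  spectrum mu (graph_closure mu A0) =
  [set (lam i)%:C | i in [set i | ip (e i) (e i) = 1]].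
Proof.
move=> discrete; apply/seteqP; split=> [z|_ [k /= ek <-]]; last first.
  case=> inj _ _.
  have : graph_closure mu A0 (fun x => (e k x)%:C) (fun x => (lam k)%:C * (e k x)%:C).
    apply/graph_closureP.
    have rE : (fun x => complex.Re ((lam k)%:C * (e k x)%:C)) = fun x => lam k * e k x.
      by apply/funext => x /=; rewrite mulr0 subr0.
    have iE : (fun x => complex.Im ((lam k)%:C * (e k x)%:C)) = fun x => 0.
      by apply/funext => x /=; rewrite mulr0 mul0r addr0.
    have z0 i : ip (fun=> 0) (e i) = 0 by exact: ip0l.
    split.
    - by apply/L2P; split=> //=; exact: sq_int0.
    - by apply/L2P; rewrite rE iE; split; [exact: sq_intZ|exact: sq_int0].
    - move=> i; rewrite rE ipZl//=; have [->//|ki] := eqVneq i k.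
      by rewrite e_orth ?mulr0// eq_sym.
    - by move=> i; rewrite iE /= !z0 mulr0.
  move=> /inj h.
  have : ip (e k) (e k) = 0.
    have m0 : measurable_fun setT (fun _ : T => 0 : R) by exact: measurable_cst.
    rewrite (@eq_ae_ip _ _ _ mu (e k) (fun=> 0))//; [|exact: (e_sq k).1|exact: (e_sq k).1|].
      exact: ip0l.
    by apply: filterS h => x [].
  by rewrite ek => /eqP; rewrite oner_eq0.
apply: contra_notP => /= znot.
have [delta d0 Hd] : exists2 delta : R, 0 < delta & forall i, ip (e i) (e i) = 1 ->
      delta ^+ 2 <= (lam i - complex.Re z) ^+ 2 + complex.Im z ^+ 2.
  apply: discrete => i ei; apply/eqP => zE; apply: znot; by exists i.
case: z znot Hd => x y znot /= Hd {discrete znot}.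
have null (u : T -> R) i : sq_int u -> ip (e i) (e i) = 0 -> ip u (e i) = 0.
  by move=> Hu ei; rewrite ipC ip_eq0_l.
have reE u f : re (fun t => (x +i* y) * u t + f t) =
    fun t => (x * complex.Re (u t) + (- y) * complex.Im (u t)) + complex.Re (f t).
  by apply/funext => t; case: (u t) (f t) => a b [c d'] /=; ring.
have imE u f : im (fun t => (x +i* y) * u t + f t) =
    fun t => (x * complex.Im (u t) + y * complex.Re (u t)) + complex.Im (f t).
  by apply/funext => t; case: (u t) (f t) => a b [c d'] /=; ring.
have coefP u f i : L2 mu u -> L2 mu f ->
    (ip (re (fun t => (x +i* y) * u t + f t)) (e i) =
      x * ip (re u) (e i) - y * ip (im u) (e i) + ip (re f) (e i)) *
    (ip (im (fun t => (x +i* y) * u t + f t)) (e i) =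
      x * ip (im u) (e i) + y * ip (re u) (e i) + ip (im f) (e i)).
  move=> /L2P[ur ui] /L2P[fr fi]; rewrite reE imE.
  have s1 : sq_int (fun t => x * complex.Re (u t) + (- y) * complex.Im (u t)).
    by apply: sq_intD; exact: sq_intZ.
  have s2 : sq_int (fun t => x * complex.Im (u t) + y * complex.Re (u t)).
    by apply: sq_intD; exact: sq_intZ.
  have z1 c := @sq_intZ _ _ _ mu c _ ur.
  have z2 c := @sq_intZ _ _ _ mu c _ ui.
  by split; rewrite !ipDl// !ipZl//; ring.
have affine u f : L2 mu u -> L2 mu f -> L2 mu (fun t => (x +i* y) * u t + f t).
  move=> /L2P[ur ui] /L2P[fr fi]; apply/L2P; rewrite reE imE.
  by split; apply: sq_intD => //; apply: sq_intD; exact: sq_intZ.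
have coef_bound u f i : L2 mu f ->
    graph_closure mu A0 u (fun t => (x +i* y) * u t + f t) ->
    delta ^+ 2 * (ip (re u) (e i) ^+ 2 + ip (im u) (e i) ^+ 2) <=
    ip (re f) (e i) ^+ 2 + ip (im f) (e i) ^+ 2.
  move=> Hf /graph_closureP[Hu _ /(_ i) hr /(_ i) hi].
  move: hr hi; rewrite !(coefP u f i Hu Hf) => hr hi.
  move: Hu Hf => /L2P[ur ui] /L2P[fr fi].
  case: (e_norm i) => ei; last exact: resolvent_coef_le hr hi (Hd i ei).
  rewrite (null _ _ ur ei) (null _ _ ui ei) (null _ _ fr ei) (null _ _ fi ei).
  by rewrite expr0n addr0 mulr0.
split.
- move=> u Au.
  have L0 : L2 mu (fun=> 0 : R[i]) by apply/L2P; split; exact: sq_int0.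
  have Au0 : graph_closure mu A0 u (fun t => (x +i* y) * u t + 0).
    by have -> : (fun t => (x +i* y) * u t + 0) = (fun t => (x +i* y) * u t)
      by apply/funext => t; rewrite addr0.
  have z0 i : ip (fun=> 0) (e i) = 0 by exact: ip0l.
  have [/L2P[ur ui] _ _ _] := (graph_closureP _ _).1 Au.
  have coef0 i : ip (re u) (e i) = 0 /\ ip (im u) (e i) = 0.
    have := coef_bound _ _ i L0 Au0; rewrite /= !z0 expr0n /= addr0.
    by rewrite pmulr_rle0 ?exprn_gt0// => /sumsqr_le0.
  have r0 := e_complete ur (fun i => (coef0 i).1).
  have i0 := e_complete ui (fun i => (coef0 i).2).
  by apply: filterS2 r0 i0 => t; case: (u t) => a b /= -> ->.
- move=> f Hf; have /L2P[fr fi] := Hf.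
  pose a i := resolvent_re (lam i) x y (ip (re f) (e i)) (ip (im f) (e i)).
  pose b i := resolvent_im (lam i) x y (ip (re f) (e i)) (ip (im f) (e i)).
  (* At a null [e i] the number [lam i] is not kept away from z, but the coefficients of [f] vanish
     there. *)
  have ab0 i : ip (e i) (e i) = 0 -> a i = 0 /\ b i = 0.
    by move=> ei; rewrite /a /b (null _ _ fr ei) (null _ _ fi ei); exact: resolvent0.
  have Dp i : ip (e i) (e i) = 1 -> 0 < (lam i - x) ^+ 2 + y ^+ 2.
    by move=> ei; apply: lt_le_trans (Hd i ei); rewrite exprn_gt0.
  have ab i : a i ^+ 2 + b i ^+ 2 <=
      (ip (re f) (e i) ^+ 2 + ip (im f) (e i) ^+ 2) / delta ^+ 2.
    case: (e_norm i) => ei.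
      have [-> ->] := ab0 i ei.
      by rewrite (null _ _ fr ei) (null _ _ fi ei) expr0n addr0 mul0r.
    have Dd := Hd i ei; rewrite /a /b (resolvent_sqr _ _ (Dp i ei)).
    rewrite ler_wpM2l//; first by rewrite addr_ge0// sqr_ge0.
    by rewrite lef_pV2// posrE ?exprn_gt0// Dp.
  have C0 N : \sum_(i < N) (a i ^+ 2 + b i ^+ 2) <=
      (ip (re f) (re f) + ip (im f) (im f)) / delta ^+ 2.
    apply: (@le_trans _ _ (\sum_(i < N)
      (ip (re f) (e i) ^+ 2 + ip (im f) (e i) ^+ 2) / delta ^+ 2)).
      by apply: ler_sum => i _; exact: ab.
    rewrite -mulr_suml big_split /= ler_wpM2r ?invr_ge0 ?sqr_ge0//.
    by apply: lerD; exact: (bessel mu_fin).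
  have Ca N : \sum_(i < N) a i ^+ 2 <= (ip (re f) (re f) + ip (im f) (im f)) / delta ^+ 2.
    by apply: le_trans (C0 N); apply: ler_sum => i _; rewrite lerDl sqr_ge0.
  have Cb N : \sum_(i < N) b i ^+ 2 <= (ip (re f) (re f) + ip (im f) (im f)) / delta ^+ 2.
    by apply: le_trans (C0 N); apply: ler_sum => i _; rewrite lerDr sqr_ge0.
  have [u1 [u1_sq u1a _]] := riesz_fischer mu_fin e_sq e_orth e_norm Ca.
  have [u2 [u2_sq u2b _]] := riesz_fischer mu_fin e_sq e_orth e_norm Cb.
  pose u t := u1 t +i* u2 t.
  have Hu : L2 mu u by apply/L2P.
  exists u; apply/graph_closureP; split=> //; first exact: affine.
    move=> i; rewrite !(coefP u f i Hu Hf) u1a u2b.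
    case: (e_norm i) => ei; last by rewrite ei !mulr1; exact: resolvent_reE (Dp i ei).
    by rewrite ei (null _ _ fr ei) !mulr0 subr0 addr0.
  move=> i; rewrite !(coefP u f i Hu Hf) u1a u2b.
  case: (e_norm i) => ei; last by rewrite ei !mulr1; exact: resolvent_imE (Dp i ei).
  by rewrite ei (null _ _ fi ei) !mulr0 !addr0.
- exists delta^-1 => u f Hf Au.
  have [Hu _ _ _] := (graph_closureP _ _).1 Au.
  rewrite !L2norm_sqnorm// -EFinM lee_fin.
  have /L2P[ur ui] := Hu; have /L2P[fr fi] := Hf.
  have [cur _] := parseval mu_fin e_sq e_orth e_norm e_complete ur.
  have [cui _] := parseval mu_fin e_sq e_orth e_norm e_complete ui.
  have [cfr _] := parseval mu_fin e_sq e_orth e_norm e_complete fr.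
  have [cfi _] := parseval mu_fin e_sq e_orth e_norm e_complete fi.
  (* The bound holds for each coefficient; Parseval passes from finite sums to the norms. *)
  have le : delta ^+ 2 * sqnorm u <= sqnorm f.
    have c1 : (fun N => delta ^+ 2 *
       (\sum_(i < N) ip (re u) (e i) ^+ 2 + \sum_(i < N) ip (im u) (e i) ^+ 2))
       @ \oo --> delta ^+ 2 * sqnorm u.
      by apply: cvgM; [exact: cvg_cst|exact: cvgD].
    have c2 : (fun N => \sum_(i < N) ip (re f) (e i) ^+ 2 + \sum_(i < N) ip (im f) (e i) ^+ 2)
       @ \oo --> sqnorm f by exact: cvgD.
    apply: (ler_cvg_to c1 c2); apply: nearW => N.
    rewrite -!big_split /= mulr_sumr; apply: ler_sum => i _; exact: coef_bound.
  rewrite -(ler_pM2l d0) mulrA divff ?gt_eqF// mul1r.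
  rewrite -(ger0_norm (ltW d0)) -sqrtr_sqr -sqrtrM ?sqr_ge0//.
  exact: ler_wsqrtr.
Qed.

End SpectralTheorem.
End ComplexL2.

(** * Absolutely continuous functions on an interval *)

Section IntegrationByParts.
Context (R : realType).
Notation leb := (@lebesgue_measure R).

(* Fubini on the half-plane [s <= t]. *)
Lemma fubini_triangle (f g : R -> R) :
  leb.-integrable setT (EFin \o f) -> leb.-integrable setT (EFin \o g) ->
  [/\ leb.-integrable setT (EFin \o (fun s => f s * \int[leb]_(t in `[s, +oo[) g t)),
      leb.-integrable setT (EFin \o (fun t => g t * \int[leb]_(s in `]-oo, t]) f s)) &
  \int[leb]_s (f s * \int[leb]_(t in `[s, +oo[) g t) =
  \int[leb]_t (g t * \int[leb]_(s in `]-oo, t]) f s)].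
Proof.
move=> intf intg.
have mf : measurable_fun setT f by apply/measurable_EFinP; exact: (measurable_int leb intf).
have mg : measurable_fun setT g by apply/measurable_EFinP; exact: (measurable_int leb intg).
pose D := [set z : R * R | z.1 <= z.2].
have mD : measurable D.
  have -> : D = (fun z : R * R => z.1 - z.2) @^-1` `]-oo, 0].
    by apply/seteqP; split=> z; rewrite /D /= in_itv /= subr_le0.
  rewrite -[X in measurable X]setTI; apply: measurable_funB => //.
pose F (z : R * R) : \bar R := (f z.1 * g z.2 * \1_D z)%:E.
have mF : measurable_fun setT F.
  apply/measurable_EFinP; apply: measurable_funM => //.
  by apply: measurable_funM; exact: measurableT_comp.
have intF : (leb \x leb)%E.-integrable setT F.
  apply/integrable12ltyP => //.
  apply: (@le_lt_trans _ _ (\int[leb]_s (`|f s|%:E * \int[leb]_t (`|g t|)%:E))%E).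
    apply: ge0_le_integral => //.
    - by move=> s _; exact: integral_ge0.
    - by apply: (@measurable_fun_fubini_tonelli_F _ _ _ _ R leb (abse \o F)) => //=; exact: measurableT_comp.
    - apply: emeasurable_funM => //; apply/measurable_EFinP; exact: measurableT_comp.
    move=> s _; rewrite -ge0_integralZl//; last first.
      by apply/measurable_EFinP; exact: measurableT_comp.
    apply: ge0_le_integral => //.
    - by apply: measurableT_comp => //; apply: measurableT_comp => //; exact: pair1_measurable.
    - by apply: emeasurable_funM => //; apply/measurable_EFinP; exact: measurableT_comp.
    move=> t _; rewrite -EFinM lee_fin !normrM ler_piMr ?mulr_ge0//.
    by rewrite indicE; case: (_ \in _); rewrite ?normr1 ?normr0.
  have /integrableP[_ ltf] := intf; have /integrableP[_ ltg] := intg.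
  rewrite ge0_integralZr//; last 2 first.
    by apply/measurable_EFinP; exact: measurableT_comp.
    by apply: integral_ge0.
  by apply: lte_mul_pinfty => //; [exact: integral_ge0|rewrite ge0_fin_numE//; exact: integral_ge0].
have restr (h : R -> R) (A : set (measurableTypeR R)) : measurable A -> leb.-integrable setT (EFin \o h) ->
    leb.-integrable setT (EFin \o (h \_ A)).
  move=> mA ih; rewrite -restrict_EFin; apply: (integrable_mkcond _ mA).1.
  exact: (integrableS measurableT mA (@subsetT _ A) ih).
have slice (c : R) (h : R -> R) (A : set (measurableTypeR R)) : measurable A -> leb.-integrable setT (EFin \o h) ->
    (\int[leb]_t (c * (h \_ A) t)%:E = (c * \int[leb]_(t in A) h t)%:E)%E.
  move=> mA ih; have ir := restr h A mA ih.
  rewrite Rintegral_mkcond EFinM /Rintegral fineK; last exact: integrable_fin_num.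
  by rewrite -integralZl//; apply: eq_integral => t _; rewrite EFinM.
have FE : fubini_F leb F = EFin \o (fun s => f s * \int[leb]_(t in `[s, +oo[) g t).
  apply/funext => s; rewrite /= -slice//; apply: eq_integral => t _.
  rewrite /F /D indicE patchE /= -mulrA; congr (_ * _)%:E.
  have -> : ((s, t) \in [set z : R * R | z.1 <= z.2]) = (t \in `[s, +oo[%classic).
    by apply/idP/idP; rewrite !inE /= in_itv /= andbT.
  by case: (_ \in _); rewrite ?mulr1 ?mulr0.
have GE : fubini_G leb F = EFin \o (fun t => g t * \int[leb]_(s in `]-oo, t]) f s).
  apply/funext => t; rewrite /= -slice//; apply: eq_integral => s _.
  rewrite /F /D indicE patchE /= (mulrC (f s)) -mulrA; congr (_ * _)%:E.
  have -> : ((s, t) \in [set z : R * R | z.1 <= z.2]) = (s \in `]-oo, t]%classic).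
    by apply/idP/idP; rewrite !inE /= ?in_itv /=.
  by case: (_ \in _); rewrite ?mulr1 ?mulr0.
split.
- by rewrite -FE; exact: (integrable_fubini_F intF).
- have /integrableP[_ ltf] := intf.
  (* The inner integral is bounded by the L^1 norm of [f], so [C] times [g] dominates. *)
  pose C := fine (\int[leb]_s (`|f s|)%:E)%E.
  have CE : (\int[leb]_s (`|f s|)%:E)%E = C%:E.
    by rewrite fineK// ge0_fin_numE//; exact: integral_ge0.
  have ic := integrableZl measurableT C intg.
  apply: (le_integrable measurableT _ _ ic).
    by rewrite -GE; exact: (measurable_fubini_G intF).
  move=> t _; rewrite /= lee_fin !normrM mulrC ler_wpM2r//.
  apply: le_trans (ler_norm _); rewrite -lee_fin -CE.
  have -> : (`|\int[leb]_(s in `]-oo, t]) f s|%:E =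
    `| \int[leb]_(s in `]-oo, t]) (f s)%:E |)%E.
    by apply: EFin_normr_Rintegral => //; exact: integrableS intf.
  apply: (le_trans (le_abse_integral _ _ _)) => //.
    by apply: measurable_funTS; exact/measurable_EFinP.
  apply: ge0_subset_integral => //; exact/measurable_EFinP/measurableT_comp.
rewrite /Rintegral; apply: (congr1 fine).
transitivity (\int[leb]_s (fubini_F leb F s))%E; first by rewrite FE.
transitivity (\int[leb]_t (fubini_G leb F t))%E; last by rewrite GE.
exact: (Fubini intF).
Qed.

Lemma setI_itv_cy_cc (a b s : R) : a <= s ->
  `[s, +oo[%classic `&` `[a, b]%classic = `[s, b]%classic :> set R.
Proof.
move=> as_; apply/seteqP; split=> x /=; rewrite !in_itv /= ?andbT.
  by move=> [-> /andP[_ ->]].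
by move=> /andP[sx ->]; rewrite sx (le_trans as_).
Qed.

Lemma setI_itv_yc_cc (a b t : R) : t <= b ->
  `]-oo, t]%classic `&` `[a, b]%classic = `[a, t]%classic :> set R.
Proof.
move=> tb; apply/seteqP; split=> x /=; rewrite !in_itv /= ?andbT.
  by move=> [-> /andP[-> _]].
by move=> /andP[ax xt]; rewrite ax xt (le_trans xt).
Qed.

(** Absolute continuity in integrated form: [p1] is a density of [p], and no pointwise derivative is
    involved. *)
Definition primitive_on (a b : R) (p p1 : R -> R) : Prop :=
  leb.-integrable `[a, b] (EFin \o p1) /\
  forall x, a <= x <= b -> p x = p a + \int[leb]_(t in `[a, x]) p1 t.

(** Cut off to [a, b], the inner integrals of [fubini_triangle] are q b - q s and p t - p a. The
    integral of p1 (q b - q) thus equals that of q1 (p - p a), and expanding both gives the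
    formula. *)
Lemma integration_by_parts_ac (a b : R) (p p1 q q1 : R -> R) : a <= b ->
  primitive_on a b p p1 -> primitive_on a b q q1 ->
  [/\ leb.-integrable `[a, b] (EFin \o (fun x => p1 x * q x)),
      leb.-integrable `[a, b] (EFin \o (fun x => p x * q1 x)) &
  \int[leb]_(x in `[a, b]) (p1 x * q x) + \int[leb]_(x in `[a, b]) (p x * q1 x) =
  p b * q b - p a * q a].
Proof.
move=> ab [ip1 pE] [iq1 qE].
have mab : measurable (`[a, b]%classic : set (measurableTypeR R)) by [].
pose f := p1 \_ `[a, b]; pose g := q1 \_ `[a, b].
have intf : leb.-integrable setT (EFin \o f).
  by rewrite /f -restrict_EFin; apply: (integrable_mkcond _ mab).1.
have intg : leb.-integrable setT (EFin \o g).
  by rewrite /g -restrict_EFin; apply: (integrable_mkcond _ mab).1.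
have [if_ ig_ fubini] := fubini_triangle intf intg.
have hE s : a <= s <= b -> \int[leb]_(t in `[s, +oo[) g t = q b - q s.
  move=> /andP[as_ sb].
  rewrite /g -Rintegral_mkcondr.
  rewrite (setI_itv_cy_cc _ as_) (qE s); last by rewrite as_ sb.
  rewrite (qE b); last by rewrite ab lexx.
  have := @Rintegral_itvB R q1 (BLeft a) (BRight b) s iq1.
  rewrite !bnd_simp => /(_ as_ sb); rewrite Rintegral_itv_obnd_cbnd.
    by move=> <-; rewrite opprD addrACA subrr add0r.
  apply: integrableS iq1; [exact: measurable_itv|exact: measurable_itv|].
  by apply: subset_itvr; rewrite bnd_simp.
have kE t : a <= t <= b -> \int[leb]_(s in `]-oo, t]) f s = p t - p a.
  move=> /andP[at_ tb].
  rewrite /f -Rintegral_mkcondr.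
  rewrite (setI_itv_yc_cc _ tb) (pE t); last by rewrite at_ tb.
  by rewrite addrAC subrr add0r.
have ig1 : leb.-integrable `[a, b] (EFin \o (fun x => p1 x * (q b - q x))).
  have := integrableS measurableT mab (@subsetT _ _) if_.
  apply: (eq_integrable mab) => x; rewrite inE => xab /=.
  by rewrite (hE _ xab) /f patchE (mem_set xab).
have ig2 : leb.-integrable `[a, b] (EFin \o (fun x => q1 x * (p x - p a))).
  have := integrableS measurableT mab (@subsetT _ _) ig_.
  apply: (eq_integrable mab) => x; rewrite inE => xab /=.
  by rewrite (kE _ xab) /g patchE (mem_set xab).
have eqI : \int[leb]_(x in `[a, b]) (p1 x * (q b - q x)) =
           \int[leb]_(x in `[a, b]) (q1 x * (p x - p a)).
  rewrite Rintegral_mkcond [RHS]Rintegral_mkcond.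
  transitivity (\int[leb]_s (f s * \int[leb]_(t in `[s, +oo[) g t)).
    apply: eq_Rintegral => x _; rewrite /f !patchE; case: ifPn => [|_]; last by rewrite mul0r.
    by rewrite inE => xab; rewrite hE.
  rewrite fubini; apply: eq_Rintegral => x _; rewrite /g !patchE.
  case: ifPn => [|_]; last by rewrite mul0r.
  by rewrite inE => xab; rewrite kE.
have i1 : leb.-integrable `[a, b] (EFin \o (fun x => p1 x * q x)).
  have := integrableB mab (integrableZl mab (q b) ip1) ig1.
  by apply: (eq_integrable mab) => x _; rewrite /= -EFinB mulrBr (mulrC (q b)) subKr.
have i2 : leb.-integrable `[a, b] (EFin \o (fun x => p x * q1 x)).
  have := integrableD mab (integrableZl mab (p a) iq1) ig2.
  apply: (eq_integrable mab) => x _; rewrite /= -EFinD mulrBr (mulrC (p a)) addrC subrK.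
  by rewrite mulrC.
split; [exact: i1|exact: i2|].
have e1 : \int[leb]_(x in `[a, b]) (p1 x * (q b - q x)) =
    q b * \int[leb]_(x in `[a, b]) p1 x - \int[leb]_(x in `[a, b]) (p1 x * q x).
  rewrite -(RintegralZl _ mab ip1) -(RintegralB mab (integrableZl mab (q b) ip1) i1).
  by apply: eq_Rintegral => x _; rewrite mulrBr (mulrC (q b)).
have e2 : \int[leb]_(x in `[a, b]) (q1 x * (p x - p a)) =
    \int[leb]_(x in `[a, b]) (p x * q1 x) - p a * \int[leb]_(x in `[a, b]) q1 x.
  rewrite -(RintegralZl _ mab iq1) -(RintegralB mab i2 (integrableZl mab (p a) iq1)).
  by apply: eq_Rintegral => x _; rewrite mulrBr (mulrC (p a)) (mulrC (p x)).
have abb : a <= b <= b by rewrite ab lexx.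
have := pE b abb; have := qE b abb; move: eqI; rewrite e1 e2.
clear; set I1 := Rintegral _ _ _; set I2 := Rintegral _ _ _; set I3 := Rintegral _ _ _.
set I4 := Rintegral _ _ _ => h hq hp.
have -> : I2 + I3 = q b * I1 + p a * I4 by lra.
by rewrite hp hq; ring.
Qed.
End IntegrationByParts.

(** * Second-order Sobolev functions, Green's identity and sine waves *)

Section Sobolev.
Context (R : realType).
Notation leb := (@lebesgue_measure R).
Implicit Types (a b c w : R) (u v : R -> R).

Lemma continuous_sqr u : continuous u -> continuous (fun x => u x ^+ 2).
Proof.
move=> cu x; rewrite (_ : (fun x => _) = fun x => u x * u x).
  by apply: cvgM; exact: cu.
by apply/funext => y; rewrite expr2.
Qed.

Lemma continuous_integrable_itv a b u : continuous u -> leb.-integrable `[a, b] (EFin \o u).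
Proof.
move=> cu; apply: continuous_compact_integrable; first exact: segment_compact.
exact: continuous_subspaceT.
Qed.

Lemma integrable_sqr_itv a b u : measurable_fun (`[a, b] : set R) u ->
  leb.-integrable `[a, b] (EFin \o (fun x => u x ^+ 2)) ->
  leb.-integrable `[a, b] (EFin \o u).
Proof.
move=> mu_ iu; have mab : measurable (`[a, b]%classic : set (measurableTypeR R)) by [].
have i1 : leb.-integrable `[a, b] (EFin \o (fun=> 1 : R)).
  by apply: continuous_integrable_itv => x; exact: cvg_cst.
apply: (le_integrable mab _ _ (integrableD mab i1 iu)); first exact/measurable_EFinP.
move=> x _; rewrite /= lee_fin ler_norml; apply/andP; split.
  rewrite lerNl; apply: le_trans (ler_norm _).
  by rewrite -subr_ge0; have := sqr_ge0 (u x + 2^-1); clear; nra.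
by apply: le_trans (ler_norm _); have := sqr_ge0 (u x - 2^-1); clear; nra.
Qed.

Lemma primitive_on_continuous a b u (u1 : R -> R) : a <= b -> primitive_on a b u u1 ->
  {within `[a, b], continuous u}.
Proof.
move=> ab [iu uE].
have c := parameterized_integral_continuous ab iu.
have cst : {within `[a, b], continuous (fun=> u a : R)}.
  by apply: continuous_subspaceT => x; exact: cvg_cst.
have cD : {within `[a, b], continuous (fun x => u a + \int[leb]_(t in `[a, x]) u1 t)}.
  by move=> x; apply: cvgD; [exact: cst|exact: c].
apply: subspace_eq_continuous cD => x; rewrite inE /= in_itv /= => xab.
exact/esym/uE.
Qed.

(** On a bounded interval an L^2 function is integrable, so [u1] is continuous and hence integrable
    too. *)
Lemma sobolev2_primitive a b u (u1 u2 : R -> R) : a <= b -> sobolev2 a b u u1 u2 ->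
  primitive_on a b u1 u2 /\ primitive_on a b u u1.
Proof.
move=> ab [m2 i2 E1 E2].
have p1 : primitive_on a b u1 u2 by split=> //; exact: integrable_sqr_itv.
split=> //; split=> //; apply: continuous_compact_integrable; first exact: segment_compact.
exact: primitive_on_continuous p1.
Qed.

(** Two integrations by parts share the integral of u1 v1, which cancels in the difference. *)
Lemma green_identity a b u (u1 u2 : R -> R) v (v1 v2 : R -> R) : a <= b ->
  sobolev2 a b u u1 u2 -> sobolev2 a b v v1 v2 ->
  [/\ leb.-integrable `[a, b] (EFin \o (fun x => u2 x * v x)),
      leb.-integrable `[a, b] (EFin \o (fun x => u x * v2 x)) &
  \int[leb]_(x in `[a, b]) (u2 x * v x) - \int[leb]_(x in `[a, b]) (u x * v2 x) =
  (u1 b * v b - u b * v1 b) - (u1 a * v a - u a * v1 a)].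
Proof.
move=> ab su sv.
have [pu1 pu] := sobolev2_primitive ab su.
have [pv1 pv] := sobolev2_primitive ab sv.
have [i1 _ e1] := integration_by_parts_ac ab pu1 pv.
have [_ i2 e2] := integration_by_parts_ac ab pu pv1.
split; [exact: i1|exact: i2|].
move: e1 e2; clear; set I1 := Rintegral _ _ _; set I2 := Rintegral _ _ _.
set I3 := Rintegral _ _ _ => h1 h2.
by lra.
Qed.

Lemma sobolev2_eq a b u u' (u1 u1' u2 u2' : R -> R) :
  (forall x, a <= x <= b -> u x = u' x) -> (forall x, a <= x <= b -> u1 x = u1' x) ->
  (forall x, a <= x <= b -> u2 x = u2' x) -> a <= b ->
  sobolev2 a b u u1 u2 -> sobolev2 a b u' u1' u2'.
Proof.
move=> e0 e1 e2 ab [m2 i2 E1 E2].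
have aab : a <= a <= b by rewrite lexx.
split.
- apply: eq_measurable_fun m2 => x; rewrite inE /= in_itv /=; exact: e2.
- apply: eq_integrable i2 => // x; rewrite inE /= in_itv /= => xab.
  by rewrite (e2 _ xab).
- move=> x xab; rewrite -(e1 _ xab) -(e1 _ aab) (E1 _ xab); congr (_ + _).
  apply: eq_Rintegral => t; rewrite inE /= in_itv /= => /andP[at_ tx]; apply: e2.
  by rewrite at_ (le_trans tx)//; case/andP: xab.
- move=> x xab; rewrite -(e0 _ xab) -(e0 _ aab) (E2 _ xab); congr (_ + _).
  apply: eq_Rintegral => t; rewrite inE /= in_itv /= => /andP[at_ tx]; apply: e1.
  by rewrite at_ (le_trans tx)//; case/andP: xab.
Qed.

Lemma sobolev2_lin a b c u (u1 u2 : R -> R) v (v1 v2 : R -> R) : a <= b ->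
  sobolev2 a b u u1 u2 -> sobolev2 a b v v1 v2 ->
  sobolev2 a b (fun x => u x + c * v x) (fun x => u1 x + c * v1 x) (fun x => u2 x + c * v2 x).
Proof.
move=> ab su sv; have mab : measurable (`[a, b]%classic : set (measurableTypeR R)) by [].
have [[iu2 Eu1] [iu1 Eu]] := sobolev2_primitive ab su.
have [[iv2 Ev1] [iv1 Ev]] := sobolev2_primitive ab sv.
have [mu2 iu2' _ _] := su; have [mv2 iv2' _ _] := sv.
have lin (f g : R -> R) x : a <= x <= b -> leb.-integrable `[a, b] (EFin \o f) ->
    leb.-integrable `[a, b] (EFin \o g) ->
    \int[leb]_(t in `[a, x]) (f t + c * g t) =
    \int[leb]_(t in `[a, x]) f t + c * \int[leb]_(t in `[a, x]) g t.
  move=> /andP[ax xb] if_ ig.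
  have sub : `[a, x]%classic `<=` `[a, b]%classic by apply: subset_itvl; rewrite bnd_simp.
  have max : measurable (`[a, x]%classic : set (measurableTypeR R)) by [].
  have jf := integrableS mab max sub if_; have jg := integrableS mab max sub ig.
  by rewrite (RintegralD max jf (integrableZl max c jg)) (RintegralZl _ max jg).
split.
- by apply: measurable_funD => //; exact: measurable_funM.
- have bd : leb.-integrable `[a, b]
      (EFin \o (fun x => 2 * u2 x ^+ 2 + (2 * c ^+ 2) * v2 x ^+ 2)).
    exact: (integrableD mab (integrableZl mab 2 iu2') (integrableZl mab (2 * c ^+ 2) iv2')).
  apply: (le_integrable mab _ _ bd).
    apply/measurable_EFinP; apply: measurable_funX; apply: measurable_funD => //.
    exact: measurable_funM.
  move=> x _; rewrite /= lee_fin ger0_norm ?sqr_ge0//; apply: le_trans (ler_norm _).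
  by have := sqr_ge0 (u2 x - c * v2 x); clear; nra.
- move=> x xab; rewrite (lin _ _ _ xab iu2 iv2) (Eu1 _ xab) (Ev1 _ xab) mulrDr.
  by rewrite addrACA.
- move=> x xab; rewrite (lin _ _ _ xab iu1 iv1) (Eu _ xab) (Ev _ xab) mulrDr.
  by rewrite addrACA.
Qed.

Lemma sobolev2_0 a b : sobolev2 a b (fun=> 0 : R) (fun=> 0) (fun=> 0).
Proof.
split.
- exact: measurable_cst.
- by apply: eq_integrable (integrable0 leb _) => // x _; rewrite /= expr0n.
- by move=> x _; rewrite /Rintegral integral0 addr0.
- by move=> x _; rewrite /Rintegral integral0 addr0.
Qed.

(** A free phase replaces the pair sine and cosine: differentiating multiplies by [w] and adds pi /
    2 to [ph], so one family contains all the derivatives. *)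
Definition wave w c (ph x : R) : R := sin (w * (x - c) + ph).

Lemma is_derive_wave w c (ph x : R) :
  is_derive x 1 (wave w c ph) (w * wave w c (ph + pi / 2) x).
Proof.
have h : is_derive x 1 (fun y : R => w * (y - c) + ph) w.
  have -> : (fun y : R => w * (y - c) + ph) = (w *: (id - cst c) + cst ph).
    by apply/funext => y.
  by apply: is_derive_eq; rewrite subr0 addr0 /GRing.scale /= mulr1.
have := @is_derive1_comp R sin _ x _ _ (is_derive_sin (w * (x - c) + ph)) h.
by rewrite /wave addrA sinDpihalf mulrC.
Qed.

Lemma continuous_wave w c (ph : R) : continuous (wave w c ph).
Proof.
move=> x; apply: differentiable_continuous; apply/derivable1_diffP.
by have [] := is_derive_wave w c ph x.
Qed.

Lemma waveDpi w c (ph x : R) : wave w c (ph + pi / 2 + pi / 2) x = - wave w c ph x.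
Proof. by rewrite /wave 2!addrA sinDpihalf cosDpihalf. Qed.

Lemma primitive_on_C1 a b (F f : R -> R) : a <= b ->
  (forall x : R, is_derive x 1 F (f x)) -> continuous f -> primitive_on a b F f.
Proof.
move=> ab dF cf; split; first exact: continuous_integrable_itv.
move=> x /andP[]; rewrite le_eqVlt => /predU1P[<- _|ax xb].
  by rewrite set_itv1 Rintegral_set1 addr0.
have cF y : {for y, continuous F}.
  by apply: differentiable_continuous; apply/derivable1_diffP; have [] := dF y.
rewrite /Rintegral (continuous_FTC2 ax (F := F)) /=.
- by rewrite addrCA subrr addr0.
- exact: continuous_subspaceT.
- split; first by move=> y _; have [] := dF y.
    exact: (cvg_at_right_filter (cF a)).
  exact: (cvg_at_left_filter (cF x)).
- by move=> y _; rewrite derive1E; have [_ ->] := dF y.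
Qed.

Lemma sobolev2_wave a b w c (ph : R) : a <= b ->
  sobolev2 a b (wave w c ph) (fun x => w * wave w c (ph + pi / 2) x)
    (fun x => - (w ^+ 2 * wave w c ph x)).
Proof.
move=> ab.
have d1 (x : R) : is_derive x 1 (fun x => w * wave w c (ph + pi / 2) x) (- (w ^+ 2 * wave w c ph x)).
  have := is_derive_wave w c (ph + pi / 2) x; rewrite waveDpi => h.
  have -> : (fun x => w * wave w c (ph + pi / 2) x) = w *: wave w c (ph + pi / 2) by [].
  apply: is_derive_eq; rewrite /GRing.scale /= expr2; ring.
have c2 : continuous (fun x => - (w ^+ 2 * wave w c ph x)).
  by move=> x; apply: cvgN; apply: cvgM; [exact: cvg_cst|exact: continuous_wave].
have c1 : continuous (fun x => w * wave w c (ph + pi / 2) x).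
  by move=> x; apply: cvgM; [exact: cvg_cst|exact: continuous_wave].
split.
- by apply: measurable_funTS; exact: continuous_measurable_fun.
- by apply: continuous_integrable_itv; exact: continuous_sqr.
- by have [] := primitive_on_C1 ab d1 c2.
- by have [] := primitive_on_C1 ab (is_derive_wave w c ph) c1.
Qed.

End Sobolev.

(** * Charts of the Laakso space *)

Section Charts.
Context (R : realType) (j : nat -> nat).
Notation graph n := (graph R j n).
Notation leb := (@lebesgue_measure R).
Notation tail n := (n.-tuple bool).

Definition hc (n : nat) (y : graph n) : R := @hcoord R (graph_level R j n) y.

Lemma hc_phi n (y : graph n.+1) : hc (phi y) = hc y.
Proof. by []. Qed.

Lemma hc_copy n (y : graph n) b : hc (copy y b) = hc y.
Proof. by rewrite -hc_phi /phi /copy glue_ptK. Qed.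

Lemma hc_itv n (y : graph n) : 0 <= hc y <= 1.
Proof.
elim: n y => [[x hx] //|n ih y]; rewrite -hc_phi; exact: ih.
Qed.

Lemma hc_chart n a (x : R) : 0 <= x <= 1 -> hc (chart j n a x) = x.
Proof.
move=> hx; elim: n => [|n ih] /=; last by rewrite hc_copy.
by rewrite /hc /= insubdK.
Qed.

Lemma chart_ext n (a b : nat -> bool) (x : R) : (forall i, (i < n)%N -> a i = b i) ->
  chart j n a x = chart j n b x.
Proof.
elim: n => [//|n ih] ab /=; rewrite ab// ih// => i /ltnW; exact: ab.
Qed.

Lemma copy_eqP n (y z : graph n) (b c : bool) :
  copy y b = copy z c <-> y = z /\ (b = c \/ wormhole j n.+1 (hc y)).
Proof.
split.
  move=> /eqmodP /=; rewrite /glue_rel /= => /andP[/eqP -> /orP[/eqP ->|w]].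
    by split=> //; left.
  by split=> //; right.
move=> [<- h]; apply/eqmodP; rewrite /= /glue_rel /= eqxx /=.
by case: h => [->|h]; rewrite ?eqxx// orbC h.
Qed.

(** Bit [i] chooses the copy in the passage from F_i to F_(i+1), where the gluing is along wormholes
    of level [i.+1]. *)
Lemma chart_eqP n a b (x : R) : 0 <= x <= 1 ->
  chart j n a x = chart j n b x <->
  forall i, (i < n)%N -> a i = b i \/ wormhole j i.+1 x.
Proof.
move=> hx; elim: n => [|n ih] /=; first by split.
rewrite copy_eqP hc_chart// ih; split=> [[h1 h2] i|h].
  by rewrite ltnS leq_eqVlt => /predU1P[->|/h1].
by split=> [i /ltnW|]; exact: h.
Qed.

(** At a wormhole both bits describe the point and this is the arbitrary choice of [repr];
    statements using it must not depend on that choice. *)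
Definition gbit n (y : graph n.+1) : bool :=
  (repr (y : {eq_quot (glue_equiv (@hcoord R (graph_level R j n)) (wormhole j n.+1))})).2.

Lemma copy_gbit n (y : graph n.+1) : copy (phi y) (gbit y) = y.
Proof.
rewrite /copy /phi /gbit /glue_pt /glue_proj -surjective_pairing.
exact: (@reprK _ {eq_quot (glue_equiv _ _)}).
Qed.

Fixpoint gbits (n : nat) : graph n -> nat -> bool :=
  match n return graph n -> nat -> bool with
  | 0 => fun _ _ => false
  | m.+1 => fun y i => if i == m then gbit y else gbits (phi y) i
  end.

Lemma chart_gbits n (y : graph n) : chart j n (gbits y) (hc y) = y.
Proof.
elim: n y => [y|n ih y].
  by apply: val_inj; rewrite /= insubdK//; exact: (valP y).
rewrite -[RHS]copy_gbit /= eqxx; congr copy.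
rewrite -[RHS]ih hc_phi; apply: chart_ext => i /=.
by case: eqP => [->|//]; rewrite ltnn.
Qed.

Lemma gbits_chart n a (x : R) i : 0 <= x <= 1 -> (i < n)%N ->
  gbits (chart j n a x) i = a i \/ wormhole j i.+1 x.
Proof.
move=> hx i_n; have := chart_gbits (chart j n a x); rewrite hc_chart//.
by move=> /(chart_eqP _ _ _ hx); exact.
Qed.

Definition chi (n : nat) (t a : nat -> bool) : R := \prod_(i < n) (-1) ^+ (t i && a i).

Lemma chi_sqr n t a : chi n t a ^+ 2 = 1.
Proof. by rewrite /chi -prodrXl big1// => i _; rewrite sqrr_sign. Qed.

Lemma normr_chi n t a : `|chi n t a| = 1.
Proof. by rewrite /chi normr_prod big1// => i _; rewrite normr_sign. Qed.

Lemma eq_chi n (t a b : nat -> bool) : (forall i, (i < n)%N -> t i -> a i = b i) -> chi n t a = chi n t b.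
Proof.
by move=> h; apply: eq_bigr => i _; case ti: (t i) => //=; rewrite h.
Qed.

(** The exchange of the two copies made at level [l.+1]. *)
Definition flip (l : nat) (a : nat -> bool) (i : nat) := if i == l then ~~ a i else a i.

Lemma chi_flip n (t a : nat -> bool) l : (l < n)%N -> t l -> chi n t (flip l a) = - chi n t a.
Proof.
move=> ln tl; rewrite /chi (bigD1 (Ordinal ln))//= [in RHS](bigD1 (Ordinal ln))//=.
rewrite -mulNr; congr (_ * _).
  by rewrite tl /flip eqxx; case: (a l); rewrite /= ?opprK.
by apply: eq_bigr => i il; rewrite /flip ifN.
Qed.

Lemma chart_flip n a (x : R) l : 0 <= x <= 1 -> wormhole j l.+1 x ->
  chart j n (flip l a) x = chart j n a x.
Proof.
move=> hx w; apply/chart_eqP => // i _; rewrite /flip.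
by case: eqP => [->|]; [right|left].
Qed.

Lemma phi_chart n a (x : R) : phi (chart j n.+1 a x) = chart j n a x.
Proof. exact: glue_ptK. Qed.

Lemma image_sval_unit_itv (B : set (graph 0)) :
  [set sval x | x in B] = `[0, 1]%classic `&` [set x | B (insubd (unit_itv0 R) x)].
Proof.
apply/seteqP; split=> [_ [[x hx] /= Bx <-]|x /= []]; rewrite in_itv /=.
  by split=> //; rewrite (_ : insubd _ _ = exist _ x hx)//; apply: val_inj; rewrite /= insubdK.
by move=> hx Bx; exists (insubd (unit_itv0 R) x) => //; rewrite /= -[LHS]/(val _) insubdK.
Qed.

Lemma FmeasurableP n (B : set (graph n)) :
  Fmeasurable B <-> forall a, measurable (`[0, 1]%classic `&` [set x | B (chart j n a x)]).
Proof.
elim: n B => [|n ih] B /=.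
  rewrite image_sval_unit_itv.
  by split=> [h _ //|h]; exact: (h (fun=> false)).
split=> [h a|h b]; first by have /ih := h (a n); exact.
apply/ih => a; have := h (fun i => if i == n then b else a i); rewrite eqxx.
rewrite (_ : [set x | B (copy (chart j n a x) b)] =
  [set x | B (copy (chart j n (fun i => if i == n then b else a i) x) b)])//.
apply/funext => x /=; congr (B (copy _ _)); apply: chart_ext => i.
by case: eqP => [->|//]; rewrite ltnn.
Qed.

Lemma bits_rcons n (w : tail n) b i : (i < n)%N -> bits [tuple of rcons w b] i = bits w i.
Proof. by move=> i_n; rewrite /bits /= nth_rcons size_tuple i_n. Qed.

Lemma bits_rcons_last n (w : tail n) b : bits [tuple of rcons w b] n = b.
Proof. by rewrite /bits /= nth_rcons size_tuple ltnn eqxx. Qed.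

Lemma big_tail_rcons (V : nmodType) n (G : tail n.+1 -> V) :
  \sum_(w : tail n.+1) G w = \sum_(w : tail n) (G [tuple of rcons w false] + G [tuple of rcons w true]).
Proof.
pose f (p : tail n * bool) : tail n.+1 := [tuple of rcons p.1 p.2].
have fb : bijective f.
  apply: inj_card_bij; last by rewrite card_prod !card_tuple card_bool expnSr.
  move=> [w b] [w' b'] /(congr1 val) /= /rcons_inj [ww' ->].
  by congr (_, _); exact: val_inj.
rewrite (reindex f) /=; last exact: onW_bij.
rewrite -(pair_bigA _ (fun w b => G (f (w, b)))) /=; apply: eq_bigr => w _.
by rewrite big_bool /= addrC.
Qed.

Lemma big_tail0 (V : nmodType) (G : tail 0 -> V) : \sum_(w : tail 0) G w = G [tuple].
Proof.
by apply: big_pred1 => w; rewrite /= (tuple0 w); apply/esym/eqP.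
Qed.

(** Each level halves the weight, so [mu_n] is the average of Lebesgue measure over the 2^n copies
    of [0, 1]. *)
Lemma FmeasE n (B : set (graph n)) :
  Fmeas B = (\sum_(w : tail n) ((2^-1) ^+ n)%:E *
     leb (`[0%R, 1%R]%classic `&` [set x | B (chart j n (bits w) x)]))%E.
Proof.
elim: n B => [|n ih] B.
  by rewrite big_tail0 expr0 mul1e /= image_sval_unit_itv.
rewrite /= !ih big_tail_rcons !ge0_sume_distrr; last 2 first.
  by move=> w _; rewrite mule_ge0// lee_fin exprn_ge0// invr_ge0.
  by move=> w _; rewrite mule_ge0// lee_fin exprn_ge0// invr_ge0.
rewrite -big_split /=; apply: eq_bigr => w _.
rewrite !bits_rcons_last exprS EFinM !muleA.
have E b : [set x | B (copy (chart j n (bits w) x) b)] =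
   [set x | B (copy (chart j n (bits [tuple of rcons w b]) x) b)].
  apply/funext => x /=; congr (B (copy _ _)); apply: chart_ext => i i_n.
  by rewrite bits_rcons.
by rewrite !E.
Qed.

End Charts.

(** * Integration of functions that factor through a finite level *)

Section LaaksoIntegral.
Context (R : realType) (j : nat -> nat).
Notation graph n := (graph R j n).
Notation laakso := (laaksoM R j).
Notation leb := (@lebesgue_measure R).
Notation tail n := (n.-tuple bool).

Definition xcoord (p : laakso) : R := hc (Phi p 0).

Definition pbit (p : laakso) (i : nat) : bool := gbit (Phi p i.+1).

Lemma hc_Phi n (p : laakso) : hc (Phi p n) = xcoord p.
Proof. by elim: n => [//|n ih]; rewrite -hc_phi PhiP. Qed.

Lemma xcoord_itv p : 0 <= xcoord p <= 1. Proof. exact: hc_itv. Qed.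

Lemma gbits_Phi n (p : laakso) i : (i < n)%N -> gbits (Phi p n) i = pbit p i.
Proof.
elim: n => [//|n ih]; rewrite ltnS leq_eqVlt => /predU1P[-> /=|i_n]; first by rewrite eqxx.
by rewrite /= ltn_eqF// PhiP ih.
Qed.

Lemma Phi_chart n (p : laakso) : Phi p n = chart j n (pbit p) (xcoord p).
Proof.
rewrite -[LHS]chart_gbits hc_Phi; apply: chart_ext => i; exact: gbits_Phi.
Qed.

Lemma measurable_cylinder n (B : set (graph n)) : Fmeasurable B ->
  measurable ([set p | B (Phi p n)] : set laakso).
Proof. by move=> mB; apply: sub_sigma_algebra; exists n, B. Qed.

Lemma measurable_fun_Phi d (Y : measurableType d) n (h : graph n -> Y) :
  (forall a, measurable_fun (`[0, 1]%classic : set R) (fun x : R => h (chart j n a x))) ->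
  measurable_fun setT (fun p : laakso => h (Phi p n)).
Proof.
move=> mh _ A mA; rewrite setTI.
apply: (@measurable_cylinder n [set y | A (h y)]).
by apply/FmeasurableP => a; apply: mh.
Qed.

Variable mu : {measure set laakso -> \bar R}.
Hypothesis hmu : limit_measure mu.

Lemma limit_measure1 : mu setT = 1%E.
Proof.
have := @hmu 0 setT; have -> : [set x | [set: graph 0] (Phi x 0)] = [set: laakso] by [].
have m : @Fmeasurable R j 0 setT by apply/FmeasurableP => a; rewrite setIT; exact: measurable_itv.
by move=> /(_ m) ->; rewrite FmeasE big_tail0 expr0 mul1e setIT lebesgue_measure_itv /= lte01 sube0.
Qed.

Lemma limit_measure_fin : (mu setT < +oo)%E.
Proof. by rewrite limit_measure1 ltry. Qed.

Lemma big_tail_ord (V : nmodType) n (G : tail n -> V) :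
  \sum_(w : tail n) G w =
  \sum_(k < size (enum {: tail n})) G (nth (nseq_tuple n false) (enum {: tail n}) k).
Proof.
by rewrite -[LHS]big_enum /= (big_nth (nseq_tuple n false)) big_mkord.
Qed.

(** The hypothesis on [mu] speaks of sets only. Everything is therefore pushed forward along [h] to
    the extended line, where the image of [mu] is compared with the sum of the scaled images of
    Lebesgue measure, one for each copy of [0, 1]. *)
Lemma ge0_integral_cylinder n (h : graph n -> \bar R) :
  (forall y, (0 <= h y)%E) ->
  (forall a, measurable_fun (`[0, 1]%classic : set R) (fun x : R => h (chart j n a x))) ->
  (\int[mu]_p h (Phi p n) =
   \sum_(w : tail n) ((2^-1) ^+ n)%:E * \int[leb]_(x in `[0%R, 1%R]) h (chart j n (bits w) x))%E.
Proof.
move=> h0 mh.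
have mH := measurable_fun_Phi mh.
pose H (p : laakso) := h (Phi p n).
pose g (w : tail n) := (fun x : R => h (chart j n (bits w) x)) \_ (`[0, 1]%classic : set R).
have mg w : measurable_fun setT (g w).
  by apply/(measurable_restrictT _ _).1 => //; exact: mh.
(* Extended by 0 outside [0, 1], [g w] carries a spurious infinite mass at 0. The image measures are
   compared off 0 only, which costs nothing since the integrand vanishes there. *)
pose D : set (\bar R) := ~` [set 0%E].
have mD : measurable D by apply: measurableC; exact: emeasurable_set1.
pose wk k := nth (nseq_tuple n false) (enum {: tail n}) k.
have c0 : 0 <= (2^-1 : R) ^+ n by rewrite exprn_ge0// invr_ge0.
have pushH : (\int[mu]_p h (Phi p n) = \int[pushforward mu H]_(y in D) `|y|)%E.
  rewrite (ge0_integral_pushforward mH) //.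
  rewrite integral_mkcond [RHS]integral_mkcond; apply: eq_integral => p _.
  rewrite !patchE in_setT; case: ifPn => [_|]; first by rewrite /= gee0_abs.
  by rewrite notin_setE /D /H /= => /contrapT.
have /choice[m mP] : forall k, exists m : {measure set (\bar R) -> \bar R},
    (forall A, m A = ((2^-1) ^+ n)%:E * leb (g (wk k) @^-1` A))%E /\
    (\int[m]_(y in D) `|y| =
      ((2^-1) ^+ n)%:E * \int[leb]_(x in `[0%R, 1%R]) h (chart j n (bits (wk k)) x))%E.
  move=> k; unshelve eexists (mscale (NngNum c0) (pushforward leb (g (wk k)))).
    exact: mg.
  split=> //; rewrite ge0_integral_mscale//; congr (_ * _)%E.
  rewrite ge0_integral_pushforward//; last exact: mg.
  rewrite integral_mkcond [RHS]integral_mkcond; apply: eq_integral => x _.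
  rewrite [LHS]patchE; case: ifPn => [_ /=|].
    by rewrite -/(g (wk k) x) gee0_abs// /g patchE; case: ifPn.
  by rewrite notin_setE /D /= => /contrapT.
rewrite pushH (big_tail_ord (fun w => (((2^-1) ^+ n)%:E * \int[leb]_(x in `[0%R, 1%R]) h (chart j n (bits w) x))%E)).
under eq_bigr do rewrite -(mP _).2.
rewrite -ge0_integral_measure_sum//; apply: eq_measure_integral => A mA AD.
transitivity (Fmeas [set y : graph n | A (h y)]).
  by apply: (@hmu n [set y | A (h y)]); apply/FmeasurableP => a; exact: mh.
rewrite /msum FmeasE (big_tail_ord (fun w => (((2^-1) ^+ n)%:E * leb _)%E)).
apply: eq_bigr => k _; rewrite (mP _).1; congr (_ * leb _)%E.
apply/seteqP; split => x /=.
  by move=> [x01 Ax]; rewrite /g patchE mem_set.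
rewrite /g patchE; case: ifPn => [|_ /AD []]; last by [].
by rewrite inE.
Qed.

End LaaksoIntegral.

(** Discrete summation by parts: the edge sums are regrouped by vertices, where the single value of
    [ph] multiplies a vanishing net flux. *)
Lemma kirchhoff_sum (V : eqType) (E : finType) (R : pzRingType) (al be : E -> V)
  (A B : E -> R) (ph : V -> R) :
  (forall v, \sum_(e | al e == v) A e - \sum_(e | be e == v) B e = 0) ->
  \sum_e A e * ph (al e) = \sum_e B e * ph (be e).
Proof.
(* The type [V] consists of all points of a metric graph; [s] lists the finitely many that are
   endpoints. *)
move=> K; pose s := undup ([seq al e | e : E] ++ [seq be e | e : E]).
have split_sum (c : E -> V) (C : E -> R) : (forall e, c e \in s) ->
    \sum_e C e * ph (c e) = \sum_(v <- s) (\sum_(e | c e == v) C e) * ph v.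
  move=> cs; under [RHS]eq_bigr do rewrite mulr_suml.
  rewrite (exchange_big_dep xpredT)//=; apply: eq_bigr => e _.
  rewrite (big_rem (c e))//= eqxx big1_seq ?addr0// => v /andP[/eqP <-].
  by rewrite mem_rem_uniq ?undup_uniq// inE eqxx.
have als e : al e \in s by rewrite mem_undup mem_cat map_f ?mem_enum.
have bes e : be e \in s by rewrite mem_undup mem_cat (map_f be) ?mem_enum ?orbT.
rewrite !split_sum//; apply: eq_bigr => v _; congr (_ * _).
by apply/eqP; rewrite -subr_eq0; apply/eqP.
Qed.

Section Cells.
Context (R : realType).
Notation leb := (@lebesgue_measure R).

Lemma integral_cells (h : R -> R) (d : R) k : 0 <= d ->
  (forall i, (i < k)%N -> leb.-integrable `[i%:R * d, i.+1%:R * d] (EFin \o h)) ->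
  leb.-integrable `[0, k%:R * d] (EFin \o h) /\
  \int[leb]_(x in `[0, k%:R * d]) h x =
  \sum_(i < k) \int[leb]_(x in `[i%:R * d, i.+1%:R * d]) h x.
Proof.
move=> d0; elim: k => [_|k ih ik].
  rewrite mul0r set_itv1 Rintegral_set1 big_ord0; split=> //.
  apply: null_set_integrable; [exact: measurable_set1|exact: measurable_fun_set1|].
  exact: lebesgue_measure_set1.
have [ih1 ih2] := ih (fun i i_k => ik i (ltnW i_k)).
have ikk := ik k (ltnSn k).
have k0 : 0 <= k%:R * d by rewrite mulr_ge0.
have kk : k%:R * d <= k.+1%:R * d by rewrite ler_wpM2r// ler_nat.
have U : `[0, k%:R * d]%classic `|` `]k%:R * d, k.+1%:R * d]%classic =
    `[0, k.+1%:R * d]%classic :> set (measurableTypeR R).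
  by rewrite -itv_bndbnd_setU// bnd_simp.
have m1 : measurable (`[0, k%:R * d]%classic : set (measurableTypeR R)) by [].
have m2 : measurable (`]k%:R * d, k.+1%:R * d]%classic : set (measurableTypeR R)) by [].
have m3 : measurable (`[k%:R * d, k.+1%:R * d]%classic : set (measurableTypeR R)) by [].
have io : leb.-integrable `]k%:R * d, k.+1%:R * d] (EFin \o h).
  by apply: integrableS ikk => //; apply: subset_itvr; rewrite bnd_simp.
have dis : [disjoint `[0, k%:R * d]%classic & `]k%:R * d, k.+1%:R * d]%classic]%classic.
  rewrite disj_set2E; apply/eqP; apply/seteqP; split=> x //=.
  by rewrite !in_itv /= => -[/andP[_ xk] /andP[kx _]]; move: (le_lt_trans xk kx); rewrite ltxx.
have iU : leb.-integrable (`[0, k%:R * d]%classic `|` `]k%:R * d, k.+1%:R * d]%classic)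
    (EFin \o h).
  have /integrableP[mh1 l1] := ih1; have /integrableP[mh2 l2] := io.
  have mh := (measurable_funU _ m1 m2).2 (conj mh1 mh2).
  apply/integrableP; split=> //.
  rewrite ge0_integral_setU//=.
    exact: lte_add_pinfty.
  exact: (measurableT_comp (@abse_measurable _ setT) mh).
rewrite -U; split=> //.
by rewrite Rintegral_setU// big_ord_recr /= ih2 (Rintegral_itv_obnd_cbnd io).
Qed.

End Cells.

Section CylinderFunctions.
Context (R : realType) (j : nat -> nat).
Notation graph n := (graph R j n).
Notation laakso := (laaksoM R j).
Notation leb := (@lebesgue_measure R).
Notation tail n := (n.-tuple bool).
Variable mu : {measure set laakso -> \bar R}.
Hypothesis hmu : limit_measure mu.

(** By [chart_eqP], the condition for [G] to descend to a function on F_n. *)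
Definition compatible (n : nat) (G : (nat -> bool) -> R -> R) : Prop :=
  forall a b x, 0 <= x <= 1 ->
    (forall i, (i < n)%N -> a i = b i \/ wormhole j i.+1 x) -> G a x = G b x.

Definition cyl (G : (nat -> bool) -> R -> R) (p : laakso) : R := G (pbit p) (xcoord p).

Lemma compatible_chart n (f : graph n -> R) : compatible n (fun a x => f (chart j n a x)).
Proof. by move=> a b x hx h; congr f; apply/(chart_eqP _ _ _ _ hx). Qed.

Lemma compatible_leq n m G : (n <= m)%N -> compatible n G -> compatible m G.
Proof.
by move=> nm c a b x hx h; apply: c => // i i_n; apply: h; exact: leq_trans nm.
Qed.

Lemma compatible_mul n G H : compatible n G -> compatible n H ->
  compatible n (fun a x => G a x * H a x).
Proof. by move=> cG cH a b x hx h; rewrite (cG a b)// (cH a b). Qed.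

Lemma Phi_cyl n (f : graph n -> R) p :
  f (Phi p n) = cyl (fun a x => f (chart j n a x)) p.
Proof. by rewrite Phi_chart. Qed.

Definition tail_of n (a : nat -> bool) : tail n := [tuple a i | i < n].

Lemma bits_tail_of n a i : (i < n)%N -> bits (tail_of n a) i = a i.
Proof.
move=> i_n; rewrite /bits -[i in LHS]/(nat_of_ord (Ordinal i_n)) -tnth_nth.
by rewrite tnth_mktuple.
Qed.

Lemma bits_inj n (w w' : tail n) : (forall i, (i < n)%N -> bits w i = bits w' i) -> w = w'.
Proof.
move=> h; apply/val_inj/(@eq_from_nth _ false); first by rewrite !size_tuple.
by move=> i; rewrite size_tuple => /h.
Qed.

Lemma compatible_tail n G a x : compatible n G -> 0 <= x <= 1 ->
  G a x = G (bits (tail_of n a)) x.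
Proof. by move=> c hx; apply: c => // i i_n; left; rewrite bits_tail_of. Qed.

Lemma integral_cyl n G : compatible n G ->
  (forall w : tail n, leb.-integrable `[0, 1] (EFin \o G (bits w))) ->
  mu.-integrable setT (EFin \o cyl G) /\
  \int[mu]_p cyl G p =
    \sum_(w : tail n) (2^-1) ^+ n * \int[leb]_(x in `[0, 1]) G (bits w) x.
Proof.
(* The bits of [y] are ambiguous at wormholes; compatibility makes [h] agree with [G] on every chart
   nevertheless. The formula then follows from the nonnegative case, applied to positive and
   negative parts. *)
move=> cG iG; pose h (y : graph n) := G (gbits y) (hc y).
have m01 : measurable (`[0, 1]%classic : set (measurableTypeR R)) by [].
have hE a x : 0 <= x <= 1 -> h (chart j n a x) = G a x.
  move=> hx; rewrite /h hc_chart//; apply: cG => // i i_n; exact: gbits_chart.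
have cylE : EFin \o cyl G = (fun p => (h (Phi p n))%:E).
  apply/funext => p; rewrite /cyl /h /= hc_Phi; congr EFin.
  apply: cG; first exact: xcoord_itv.
  by move=> i i_n; left; rewrite gbits_Phi.
have ih a : leb.-integrable `[0, 1] (fun x => (h (chart j n a x))%:E).
  apply: eq_integrable (iG (tail_of n a)) => // x; rewrite inE /= in_itv /= => hx.
  by rewrite /= (hE _ _ hx) [in RHS](compatible_tail _ cG hx).
have mh a : measurable_fun (`[0, 1]%classic : set R) (fun x : R => (h (chart j n a x))%:E).
  by have /integrableP[] := ih a.
have c0 : 0 <= (2^-1 : R) ^+ n by rewrite exprn_ge0// invr_ge0.
have icyl : mu.-integrable setT (EFin \o cyl G).
  rewrite cylE; apply/integrableP; split.
    exact: (measurable_fun_Phi (h := fun y => (h y)%:E)).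
  rewrite (ge0_integral_cylinder hmu (h := fun y => (`|h y|)%:E)) //; last first.
    by move=> a; apply: (measurableT_comp (@abse_measurable _ setT) (mh a)).
  apply: lte_sum_pinfty => w _; apply: lte_mul_pinfty; [by rewrite lee_fin|by []|].
  by have /integrableP[_ lt] := ih (bits w); exact: lt.
split=> //; rewrite /Rintegral.
rewrite -[X in fine X]/(integral mu setT (EFin \o cyl G)) integralE.
have part (m : \bar R -> \bar R) : (forall y, 0 <= m y)%E -> measurable_fun setT m ->
    (\int[mu]_p m ((EFin \o cyl G) p) = \sum_(w : tail n) ((2^-1) ^+ n)%:E *
     \int[leb]_(x in `[0%R, 1%R]) m ((EFin \o G (bits w)) x))%E.
  move=> m0 mm; rewrite cylE (ge0_integral_cylinder hmu (h := fun y => m (h y)%:E)) //.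
    apply: eq_bigr => w _; congr (_ * _)%E; apply: eq_integral => x.
    by rewrite inE /= in_itv /= => hx; rewrite hE.
  by move=> a; apply: (measurableT_comp mm (mh a)).
have pos : (\int[mu]_p (EFin \o cyl G)^\+ p = \sum_(w : tail n) ((2^-1) ^+ n)%:E *
    \int[leb]_(x in `[0%R, 1%R]) (EFin \o G (bits w))^\+ x)%E.
  under eq_integral do rewrite funeposE; under [RHS]eq_bigr do under eq_integral do rewrite funeposE.
  apply: (part (fun y => maxe y 0%E)) => [y|]; first by rewrite le_max lexx orbT.
  by apply: measurable_maxe => //; exact: measurable_cst.
have neg : (\int[mu]_p (EFin \o cyl G)^\- p = \sum_(w : tail n) ((2^-1) ^+ n)%:E *
    \int[leb]_(x in `[0%R, 1%R]) (EFin \o G (bits w))^\- x)%E.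
  under eq_integral do rewrite funenegE; under [RHS]eq_bigr do under eq_integral do rewrite funenegE.
  apply: (part (fun y => maxe (- y)%E 0%E)) => [y|]; first by rewrite le_max lexx orbT.
  by apply: measurable_maxe; [exact: oppe_measurable|exact: measurable_cst].
have fp w := integrable_pos_fin_num m01 (iG w).
have fn w := integrable_neg_fin_num m01 (iG w).
rewrite pos neg fineB; last 2 first.
- by apply/sum_fin_numP => w _ _; rewrite fin_numM.
- by apply/sum_fin_numP => w _ _; rewrite fin_numM.
rewrite -!sum_fine; last 2 first.
- by move=> w _; rewrite fin_numM.
- by move=> w _; rewrite fin_numM.
rewrite -sumrB; apply: eq_bigr => w _.
rewrite !fineM//.
rewrite -mulrBr -fineB; [|exact: fp|exact: fn].
by congr (_ * fine _); rewrite [RHS]integralE.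
Qed.

Lemma sq_int_cyl n G : compatible n G ->
  (forall w : tail n, leb.-integrable `[0, 1] (EFin \o G (bits w))) ->
  (forall w : tail n, leb.-integrable `[0, 1] (EFin \o (fun x => G (bits w) x ^+ 2))) ->
  sq_int mu (cyl G).
Proof.
move=> cG i1 i2; split.
  by have [/integrableP[/measurable_EFinP]] := integral_cyl cG i1.
have c2 : compatible n (fun a x => G a x ^+ 2).
  by move=> a b x hx h; rewrite (cG a b).
by have [] := integral_cyl c2 i2.
Qed.

(** Exchanging copies is an involution pairing opposite terms. This one cancellation gives the
    Kirchhoff condition at forced zeros, the orthogonality of sectors and Walsh inversion. *)
Lemma sum_tail_flip n l (G : tail n -> R) : (l < n)%N ->
  (forall w : tail n, G (tail_of n (flip l (bits w))) = - G w) -> \sum_(w : tail n) G w = 0.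
Proof.
move=> l_n hG.
have inv : involutive (fun w : tail n => tail_of n (flip l (bits w))).
  move=> w; apply: bits_inj => i i_n; rewrite bits_tail_of// /flip bits_tail_of//.
  by case: eqP => // _; rewrite negbK.
have : \sum_(w : tail n) G w = - \sum_(w : tail n) G w.
  rewrite -sumrN [LHS](reindex_inj (inv_inj inv)) /=.
  by apply: eq_bigr => w _; rewrite hG.
by move=> h; lra.
Qed.

End CylinderFunctions.

(** * Symmetry of the Laplacian on graphs *)

Section EdgesAndSymmetry.
Context (R : realType) (j : nat -> nat).
Hypothesis hj : forall i, (1 <= i)%N -> (2 <= j i)%N.
Notation graph n := (graph R j n).
Notation laakso := (laaksoM R j).
Notation leb := (@lebesgue_measure R).
Notation tail n := (n.-tuple bool).
Notation mesh := (mesh R j).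

Definition ncell (n : nat) : nat := \prod_(1 <= i < n.+1) j i.

Lemma ncellS n : ncell n.+1 = (ncell n * j n.+1)%N.
Proof. by rewrite /ncell big_nat_recr. Qed.

Lemma ncell_gt0 n : (0 < ncell n)%N.
Proof.
elim: n => [|n ih]; first by rewrite /ncell big_geq.
by rewrite ncellS muln_gt0 ih (leq_trans _ (hj (ltn0Sn n))).
Qed.

Lemma meshE n : mesh n = (ncell n)%:R^-1.
Proof.
elim: n => [|n ih]; first by rewrite /Defs.mesh /ncell !big_geq// invr1.
rewrite ncellS natrM invfM -ih /Defs.mesh big_nat_recr//.
Qed.

Lemma mesh_gt0 n : 0 < mesh n.
Proof. by rewrite meshE invr_gt0 ltr0n ncell_gt0. Qed.

Lemma ncell_mesh n : (ncell n)%:R * mesh n = 1.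
Proof. by rewrite meshE divff// pnatr_eq0 -lt0n ncell_gt0. Qed.

(** Since d_l = j_(l+1) d_(l+1), not being a multiple of d_l becomes non-divisibility of the
    index. *)
Lemma wormholeP l (x : R) : wormhole j l.+1 x <->
  exists k, [/\ (0 < k < ncell l.+1)%N, ~~ (j l.+1 %| k)%N & x = k%:R * mesh l.+1].
Proof.
have dN : mesh l = (j l.+1)%:R * mesh l.+1.
  rewrite !meshE ncellS natrM invfM mulrCA divff ?mulr1//.
  by rewrite pnatr_eq0 -lt0n (leq_trans _ (hj (ltn0Sn l))).
have mi := mulIf (lt0r_neq0 (mesh_gt0 l.+1)).
rewrite /wormhole; split=> [/asboolP[[i [i0 ilt ->]] no]|[k [/andP[k0 kN] nd ->]]].
  exists i; split=> //.
    by rewrite i0 -(ltr_nat R) -[ltRHS]invrK -meshE.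
  by apply/negP => /dvdnP[q iq]; apply: no; exists q; rewrite /= dN iq natrM mulrA.
apply/asboolP; split.
  by exists k; split=> //; rewrite meshE invrK ltr_nat.
move=> [q]; rewrite /= dN mulrA -natrM => /mi /eqP; rewrite eqr_nat => /eqP kq.
by move: nd; rewrite kq dvdn_mull.
Qed.

Variable mu : {measure set laakso -> \bar R}.
Hypothesis hmu : limit_measure mu.

Lemma cells_cover (h : R -> R) n :
  (forall i, (i < ncell n)%N ->
     leb.-integrable `[i%:R * mesh n, i.+1%:R * mesh n] (EFin \o h)) ->
  leb.-integrable `[0, 1] (EFin \o h) /\
  \int[leb]_(x in `[0, 1]) h x =
  \sum_(i < ncell n) \int[leb]_(x in `[i%:R * mesh n, i.+1%:R * mesh n]) h x.
Proof.
by move=> /(integral_cells (ltW (mesh_gt0 n))); rewrite ncell_mesh.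
Qed.

Lemma cell_le n i : i%:R * mesh n <= i.+1%:R * mesh n.
Proof. by rewrite ler_wpM2r ?ler_nat// ltW// mesh_gt0. Qed.

Lemma laplR_integrable n (f g : graph n -> R) (w : tail n) : laplR f g ->
  [/\ leb.-integrable `[0, 1] (EFin \o (fun x => f (chart j n (bits w) x))),
      leb.-integrable `[0, 1] (EFin \o (fun x => f (chart j n (bits w) x) ^+ 2)),
      leb.-integrable `[0, 1] (EFin \o (fun x => g (chart j n (bits w) x))) &
      leb.-integrable `[0, 1] (EFin \o (fun x => g (chart j n (bits w) x) ^+ 2))].
Proof.
move=> [_ [f1 [sob _]]].
have cell i : (i < ncell n)%N ->
    [/\ leb.-integrable `[i%:R * mesh n, i.+1%:R * mesh n]
          (EFin \o (fun x => f (chart j n (bits w) x))),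
        leb.-integrable `[i%:R * mesh n, i.+1%:R * mesh n]
          (EFin \o (fun x => f (chart j n (bits w) x) ^+ 2)),
        leb.-integrable `[i%:R * mesh n, i.+1%:R * mesh n]
          (EFin \o (fun x => g (chart j n (bits w) x))) &
        leb.-integrable `[i%:R * mesh n, i.+1%:R * mesh n]
          (EFin \o (fun x => g (chart j n (bits w) x) ^+ 2))].
  move=> i_N; have s := sob (Ordinal i_N, w).
  have mI : measurable (`[i%:R * mesh n, i.+1%:R * mesh n]%classic : set (measurableTypeR R)) by [].
  have [[ig _] pf] := sobolev2_primitive (cell_le n i) s.
  have cf := primitive_on_continuous (cell_le n i) pf.
  have [_ ig2 _ _] := s.
  split.
  - by apply: continuous_compact_integrable; [exact: segment_compact|exact: cf].
  - apply: continuous_compact_integrable; first exact: segment_compact.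
    rewrite (_ : (fun x => _) = fun x => f (chart j n (bits w) x) * f (chart j n (bits w) x)).
      by move=> x; apply: cvgM; exact: cf.
    by apply/funext => x; rewrite expr2.
  - apply: (eq_integrable mI) (integrableN ig) => x _.
    by rewrite /= opprK.
  - apply: (eq_integrable mI) ig2 => x _.
    by rewrite /= sqrrN.
split.
- by have [] := @cells_cover _ n (fun i i_N => let: And4 h _ _ _ := cell i i_N in h).
- by have [] := @cells_cover _ n (fun i i_N => let: And4 _ h _ _ := cell i i_N in h).
- by have [] := @cells_cover _ n (fun i i_N => let: And4 _ _ h _ := cell i i_N in h).
- by have [] := @cells_cover _ n (fun i i_N => let: And4 _ _ _ h := cell i i_N in h).
Qed.

Lemma laplR_sq_int n (f g : graph n -> R) : laplR f g ->
  sq_int mu (fun p => f (Phi p n)) /\ sq_int mu (fun p => g (Phi p n)).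
Proof.
move=> fg; have cf := compatible_chart f; have cg := compatible_chart g; split.
  apply: (eq_sq_int (u := cyl (fun a x => f (chart j n a x)))).
    by move=> p; rewrite -Phi_cyl.
  by apply: (sq_int_cyl hmu cf) => w; have [] := laplR_integrable w fg.
apply: (eq_sq_int (u := cyl (fun a x => g (chart j n a x)))).
  by move=> p; rewrite -Phi_cyl.
by apply: (sq_int_cyl hmu cg) => w; have [] := laplR_integrable w fg.
Qed.

(** Green's identity on each edge leaves the boundary terms [B]. Summed over the edges they cancel
    by the Kirchhoff conditions for both functions, each weighted by the values of the other. *)
Lemma laplR_symmetric n (f g f' g' : graph n -> R) : laplR f g -> laplR f' g' ->
  ip mu (fun p => g (Phi p n)) (fun p => f' (Phi p n)) =
  ip mu (fun p => f (Phi p n)) (fun p => g' (Phi p n)).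
Proof.
move=> [_ [f1 [sob kir]]] [_ [f1' [sob' kir']]].
pose G (a : nat -> bool) (x : R) := g (chart j n a x) * f' (chart j n a x).
pose H (a : nat -> bool) (x : R) := f (chart j n a x) * g' (chart j n a x).
have cG : compatible j n G by apply: compatible_mul; exact: compatible_chart.
have cH : compatible j n H by apply: compatible_mul; exact: compatible_chart.
pose B (e : edge j n) (x : R) :=
  f1 e x * f' (edge_pt e x) - f (edge_pt e x) * f1' e x.
have cell (w : tail n) i (i_N : (i < ncell n)%N) :
    [/\ leb.-integrable `[i%:R * mesh n, i.+1%:R * mesh n] (EFin \o G (bits w)),
        leb.-integrable `[i%:R * mesh n, i.+1%:R * mesh n] (EFin \o H (bits w)) &
     \int[leb]_(x in `[i%:R * mesh n, i.+1%:R * mesh n]) G (bits w) x -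
     \int[leb]_(x in `[i%:R * mesh n, i.+1%:R * mesh n]) H (bits w) x =
     B (Ordinal i_N, w) (i%:R * mesh n) - B (Ordinal i_N, w) (i.+1%:R * mesh n)].
  have mI : measurable (`[i%:R * mesh n, i.+1%:R * mesh n]%classic : set (measurableTypeR R)) by [].
  have [i1 i2 eq] := green_identity (cell_le n i) (sob (Ordinal i_N, w)) (sob' (Ordinal i_N, w)).
  have iG : leb.-integrable `[i%:R * mesh n, i.+1%:R * mesh n] (EFin \o G (bits w)).
    by apply: (eq_integrable mI) (integrableN i1) => x _; rewrite /= mulNr opprK.
  have iH : leb.-integrable `[i%:R * mesh n, i.+1%:R * mesh n] (EFin \o H (bits w)).
    by apply: (eq_integrable mI) (integrableN i2) => x _; rewrite /= mulrN opprK.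
  split; [exact: iG|exact: iH|].
  have -> : \int[leb]_(x in `[i%:R * mesh n, i.+1%:R * mesh n]) H (bits w) x =
     - \int[leb]_(x in `[i%:R * mesh n, i.+1%:R * mesh n])
         (f (edge_pt (Ordinal i_N, w) x) * - g' (edge_pt (Ordinal i_N, w) x)).
    rewrite -mulN1r -(RintegralZl _ mI i2); apply: eq_Rintegral => x _.
    by rewrite mulN1r mulrN opprK.
  have -> : \int[leb]_(x in `[i%:R * mesh n, i.+1%:R * mesh n]) G (bits w) x =
     - \int[leb]_(x in `[i%:R * mesh n, i.+1%:R * mesh n])
         (- g (edge_pt (Ordinal i_N, w) x) * f' (edge_pt (Ordinal i_N, w) x)).
    rewrite -mulN1r -(RintegralZl _ mI i1); apply: eq_Rintegral => x _.
    by rewrite mulN1r mulNr opprK.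
  by rewrite -[RHS]opprB opprK addrC -[LHS]opprB; congr (- _).
have coverG w := @cells_cover _ n (fun i i_N => let: And3 h _ _ := cell w i i_N in h).
have coverH w := @cells_cover _ n (fun i i_N => let: And3 _ h _ := cell w i i_N in h).
have [_ eG] := integral_cyl hmu cG (fun w => (coverG w).1).
have [_ eH] := integral_cyl hmu cH (fun w => (coverH w).1).
have -> : ip mu (fun p => g (Phi p n)) (fun p => f' (Phi p n)) = \int[mu]_p cyl G p.
  by apply: eq_Rintegral => p _; rewrite /cyl /G !(Phi_chart n p).
have -> : ip mu (fun p => f (Phi p n)) (fun p => g' (Phi p n)) = \int[mu]_p cyl H p.
  by apply: eq_Rintegral => p _; rewrite /cyl /H !(Phi_chart n p).
apply/eqP; rewrite eG eH -subr_eq0 -sumrB; apply/eqP.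
under eq_bigr => w _ do rewrite -mulrBr.
rewrite -mulr_sumr; apply/eqP; rewrite mulf_eq0; apply/orP; right; apply/eqP.
transitivity (\sum_(w : tail n) \sum_(i < ncell n)
   (B (i, w) (i%:R * mesh n) - B (i, w) (i.+1%:R * mesh n))).
  apply: eq_bigr => w _; rewrite (coverG w).2 (coverH w).2 -sumrB.
  apply: eq_bigr => -[i i_N] _; by have [_ _ ->] := cell w i i_N.
rewrite exchange_big /= (pair_bigA _ (fun (i : 'I_(ncell n)) (w : tail n) =>
  B (i, w) (i%:R * mesh n) - B (i, w) (i.+1%:R * mesh n))) /=.
transitivity (\sum_(e : edge j n) (B e (edge_lo R e) - B e (edge_hi R e))).
  by apply: eq_bigr => -[i w] _.
have K := kirchhoff_sum f' kir; have K' := kirchhoff_sum f kir'.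
rewrite sumrB /B !sumrB /= K.
have -> : \sum_(e : edge j n) f (edge_pt e (edge_lo R e)) * f1' e (edge_lo R e) =
  \sum_(e : edge j n) f (edge_pt e (edge_hi R e)) * f1' e (edge_hi R e).
  under eq_bigr => e _ do rewrite mulrC.
  by rewrite K'; apply: eq_bigr => e _; rewrite mulrC.
by rewrite subrr.
Qed.

End EdgesAndSymmetry.

(** * Kirchhoff functions with prescribed signs under exchange of copies *)

Section SectorFunctions.
Context (R : realType) (j : nat -> nat).
Hypothesis hj : forall i, (1 <= i)%N -> (2 <= j i)%N.
Notation graph n := (graph R j n).
Notation tail n := (n.-tuple bool).
Notation mesh := (mesh R j).
Notation ncell := (ncell j).

Definition dirichlet (n : nat) (t : nat -> bool) (x : R) : Prop :=
  exists l, [/\ (l < n)%N, t l & wormhole j l.+1 x].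

Lemma node_itv n k : (k <= ncell n)%N -> 0 <= k%:R * mesh n <= 1.
Proof.
move=> kN; rewrite mulr_ge0 ?(ltW (mesh_gt0 _ _ _))//=.
by rewrite -[leRHS](ncell_mesh R hj n) ler_wpM2r ?(ltW (mesh_gt0 _ _ _))// ler_nat.
Qed.

Lemma node_le n p r : (p <= r)%N -> p%:R * mesh n <= r%:R * mesh n.
Proof. by move=> pr; apply: ler_wpM2r; rewrite ?ler_nat// ltW// mesh_gt0. Qed.

Lemma cell_itv n i x : (i < ncell n)%N -> i%:R * mesh n <= x <= i.+1%:R * mesh n -> 0 <= x <= 1.
Proof.
move=> iN /andP[h1 h2].
have /andP[a _] := node_itv (ltnW iN); have /andP[_ b] := node_itv iN.
by rewrite (le_trans a h1) (le_trans h2 b).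
Qed.

(** Where a level of [t] is glued the sign of [chi] is ambiguous, but [F] is 0; gluings at other
    levels are not seen by [chi]. *)
Lemma compatible_sector n t (F : R -> R) :
  (forall x, 0 <= x <= 1 -> dirichlet n t x -> F x = 0) ->
  compatible j n (fun a x => F x * chi R n t a).
Proof.
move=> F0 a b x hx h; have [[l [ln tl w]]|no] := pselect (dirichlet n t x).
  by rewrite F0// ?mul0r//; exists l.
congr (_ * _); apply: eq_chi => i i_n ti; have [//|w] := h i i_n.
by exfalso; apply: no; exists i.
Qed.

Definition sector (n : nat) (t : nat -> bool) (F : R -> R) (y : graph n) : R :=
  F (hc y) * chi R n t (gbits y).

Lemma sector_chart n t F a x : (forall x, 0 <= x <= 1 -> dirichlet n t x -> F x = 0) ->
  0 <= x <= 1 -> sector t F (chart j n a x) = F x * chi R n t a.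
Proof.
move=> F0 hx; rewrite /sector hc_chart//.
by apply: (compatible_sector F0) => // i i_n; exact: gbits_chart.
Qed.

(** Flipping bit [l] permutes the copies that pass through [v] and reverses [chi]. At a forced zero
    the derivatives on either side thus sum to 0 separately, so a kink of [F] is allowed there. *)
Lemma fiber_sum0 n t (v : graph n) x : 0 <= x <= 1 -> dirichlet n t x ->
  \sum_(w : tail n) (if chart j n (bits w) x == v then chi R n t (bits w) else 0) = 0.
Proof.
move=> hx [l [ln tl wl]]; apply: (sum_tail_flip ln) => w.
have E a : chart j n (bits (tail_of n a)) x = chart j n a x :> graph n.
  by apply: chart_ext => i; exact: bits_tail_of.
rewrite E chart_flip//; case: ifP => _; last by rewrite oppr0.
by rewrite -(chi_flip R _ ln tl); apply: eq_chi => i i_n _; exact: bits_tail_of.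
Qed.

Lemma laplR_sector n t (F : R -> R) (F1 : nat -> R -> R) (lam : R) :
  {within `[0, 1], continuous F} ->
  (forall i, (i < ncell n)%N ->
    sobolev2 (i%:R * mesh n) (i.+1%:R * mesh n) F (F1 i) (fun x => - (lam * F x))) ->
  (forall x, 0 <= x <= 1 -> dirichlet n t x -> F x = 0) ->
  (forall i, (0 < i < ncell n)%N -> dirichlet n t (i%:R * mesh n) \/
     F1 i.-1 (i%:R * mesh n) = F1 i (i%:R * mesh n)) ->
  F1 0 0 = 0 -> F1 (ncell n).-1 1 = 0 ->
  laplR (sector (n := n) t F) (fun y => lam * sector t F y).
Proof.
move=> cF sobF F0 node left right; split.
  move=> w; have cc : {within `[0, 1], continuous (fun x => F x * chi R n t (bits w))}.
    move=> x; apply: cvgM; [exact: cF|exact: cvg_cst].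
  apply: subspace_eq_continuous cc => x; rewrite inE /= in_itv /= => hx.
  by apply/esym; exact: (sector_chart (bits w) F0 hx).
(* The summand 0 comes from viewing the function as the zero function plus a multiple of [F]. *)
exists (fun (e : edge j n) x => 0 + chi R n t (bits e.2) * F1 e.1 x); split.
  move=> [i w]; have iN := ltn_ord i.
  have s := sobolev2_lin (chi R n t (bits w)) (cell_le R hj n i)
    (sobolev2_0 (i%:R * mesh n) (i.+1%:R * mesh n)) (sobF i iN).
  apply: sobolev2_eq s => //=.
  - by move=> x /(cell_itv iN) hx; rewrite add0r /edge_pt sector_chart// mulrC.
  - by move=> x /(cell_itv iN) hx; rewrite add0r /edge_pt sector_chart//; ring.
  - exact: cell_le.
move=> v; pose S k := \sum_(w : tail n)
  (if chart j n (bits w) (k%:R * mesh n) == v then chi R n t (bits w) else 0).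
have edge_sum (c : nat -> nat) :
    \sum_(e : edge j n | edge_pt e ((c e.1)%:R * mesh n) == v)
      (0 + chi R n t (bits e.2) * F1 e.1 ((c e.1)%:R * mesh n)) =
    \sum_(i < ncell n) S (c i) * F1 i ((c i)%:R * mesh n).
  rewrite big_mkcond /= -(pair_bigA _ (fun (i : 'I_(ncell n)) (w : tail n) =>
    if edge_pt (i, w) ((c i)%:R * mesh n) == v
    then 0 + chi R n t (bits w) * F1 i ((c i)%:R * mesh n) else 0)) /=.
  apply: eq_bigr => i _; rewrite mulr_suml; apply: eq_bigr => w _.
  by rewrite /edge_pt /=; case: ifP => _; rewrite ?add0r ?mul0r.
rewrite [X in X - _](edge_sum id) [X in _ - X](edge_sum succn).
have one := ncell_mesh R hj n; have N0 := ncell_gt0 hj n.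
case NE : (ncell n) => [|M]; first by rewrite NE in N0.
rewrite NE /= in right one node.
(* After the Neumann terms at 0 and 1 are removed, the sums over left and right endpoints run over
   the same interior nodes and are compared node by node. *)
rewrite big_ord_recl mul0r left mulr0 add0r big_ord_recr /= one right mulr0 addr0.
rewrite -sumrB big1// => i _; rewrite /bump /= add1n -mulrBr.
have iM : (0 < i.+1 < M.+1)%N by rewrite /= ltnS.
have [dir|->] := node i.+1 iM; last by rewrite subrr mulr0.
rewrite /S fiber_sum0 ?mul0r//; apply: node_itv.
by rewrite NE ltnW// ltnS.
Qed.

Definition clamp (al be x : R) : R := Num.max al (Num.min x be).

Lemma clamp_id al be x : al <= x <= be -> clamp al be x = x.
Proof. by move=> /andP[h1 h2]; rewrite /clamp min_l// max_r. Qed.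

Lemma clamp_lo al be x : al <= be -> x <= al -> clamp al be x = al.
Proof. by move=> h1 h2; rewrite /clamp min_l ?(le_trans h2)// max_l. Qed.

Lemma clamp_hi al be x : al <= be -> be <= x -> clamp al be x = be.
Proof. by move=> h1 h2; rewrite /clamp min_r// max_r. Qed.

Lemma continuous_clamp al be : continuous (clamp al be).
Proof.
move=> x; apply: (@continuous_max _ _ (fun=> al) (fun y => Num.min y be)).
  exact: cvg_cst.
by apply: (@continuous_min _ _ id (fun=> be)); [exact: cvg_id|exact: cvg_cst].
Qed.

(* [wave w al ph] on [[al, be]], continued by its boundary values, which vanish at
   the Dirichlet endpoints. *)
Definition bump_wave (w al be ph x : R) : R := wave w al ph (clamp al be x).

Lemma bump_wave_lo w al be ph x : al <= be -> sin ph = 0 -> x <= al ->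
  bump_wave w al be ph x = 0.
Proof. by move=> ab s0 xal; rewrite /bump_wave clamp_lo// /wave subrr mulr0 add0r. Qed.

Lemma bump_wave_hi w al be ph x : al <= be -> sin (w * (be - al) + ph) = 0 -> be <= x ->
  bump_wave w al be ph x = 0.
Proof. by move=> ab s0 xbe; rewrite /bump_wave clamp_hi. Qed.

Lemma laplR_bump_wave n t (p r : nat) (w ph : R) :
  let al := p%:R * mesh n in let be := r%:R * mesh n in
  (p < r <= ncell n)%N ->
  (p != 0%N -> dirichlet n t al) -> (r != ncell n -> dirichlet n t be) ->
  (forall x, al < x < be -> ~ dirichlet n t x) ->
  (if p == 0%N then cos ph = 0 else sin ph = 0) ->
  (if r == ncell n then cos (w * (be - al) + ph) = 0 else sin (w * (be - al) + ph) = 0) ->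
  laplR (sector (n := n) t (bump_wave w al be ph))
    (fun y => w ^+ 2 * sector t (bump_wave w al be ph) y).
Proof.
move=> al be /andP[pr rN] dl dr inner left right.
have d0 := mesh_gt0 R hj n.
have ab : al <= be := node_le n (ltnW pr).
have Flo x : p != 0%N -> x <= al -> bump_wave w al be ph x = 0.
  by move=> p0; move: left; rewrite (negbTE p0); exact: bump_wave_lo.
have Fhi x : r != ncell n -> be <= x -> bump_wave w al be ph x = 0.
  by move=> r0; move: right; rewrite (negbTE r0); exact: bump_wave_hi.
(* The derivative jumps at the ends of the gap; these are Dirichlet nodes or the points 0 and 1. *)
pose F1 i x := if (p <= i < r)%N then w * wave w al (ph + pi / 2) x else 0.
apply: (@laplR_sector n t _ F1).
- apply: continuous_subspaceT => x; apply: continuous_comp; first exact: continuous_clamp.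
  exact: continuous_wave.
- move=> i iN; have cle := cell_le R hj n i.
  case: (boolP (p <= i < r)%N) => [pir|out].
    have /andP[pi ir] := pir.
    have inside x : i%:R * mesh n <= x <= i.+1%:R * mesh n -> al <= x <= be.
      move=> /andP[h1 h2]; apply/andP; split.
        by apply: le_trans h1; exact: node_le.
      by apply: (le_trans h2); exact: node_le.
    apply: sobolev2_eq (sobolev2_wave w al ph cle) => // x.
    - by move=> /inside h; rewrite /bump_wave clamp_id.
    - by move=> _; rewrite /F1 pir.
    - by move=> /inside h; rewrite /bump_wave clamp_id.
  have F0 x : i%:R * mesh n <= x <= i.+1%:R * mesh n -> bump_wave w al be ph x = 0.
    move=> /andP[h1 h2]; move: out; rewrite negb_and -ltnNge -leqNgt => /orP[ip|ri].
      apply: Flo; first by rewrite -lt0n (leq_ltn_trans _ ip).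
      by apply: (le_trans h2); exact: node_le.
    apply: Fhi; first by rewrite ltn_eqF// (leq_ltn_trans ri).
    by apply: le_trans h1; exact: node_le.
  apply: sobolev2_eq (sobolev2_0 (i%:R * mesh n) (i.+1%:R * mesh n)) => // x.
  - by move=> /F0 ->.
  - by move=> _; rewrite /F1 (negbTE out).
  - by move=> /F0 ->; rewrite mulr0 oppr0.
- move=> x hx dir; have [xal|alx] := leP x al.
    (* A wave starting at 0 need not vanish there, but 0 is never a wormhole; the same holds for 1
       below. *)
    case: (eqVneq p 0%N) => [p0|p0]; last exact: Flo.
    have x0 : x = 0 by apply/eqP; rewrite eq_le (andP hx).1 andbT (le_trans xal)// /al p0 mul0r.
    have [l [_ _ /(wormholeP hj)[k [/andP[k0 _] _ xE]]]] := dir.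
    move: x0; rewrite xE => /eqP; rewrite mulf_eq0 pnatr_eq0 (gtn_eqF k0) /=.
    by rewrite (gt_eqF (mesh_gt0 _ hj _)).
  have [bex|xbe] := leP be x.
    case: (eqVneq r (ncell n)) => [rn|r0]; last exact: Fhi.
    have x1 : x = 1.
      by apply/eqP; rewrite eq_le (andP hx).2 /= (le_trans _ bex)// /be rn (ncell_mesh R hj).
    have [l [_ _ /(wormholeP hj)[k [/andP[_ kN] _ xE]]]] := dir.
    have : k%:R * mesh l.+1 < (ncell l.+1)%:R * mesh l.+1.
      by rewrite ltr_pM2r ?mesh_gt0// ltr_nat.
    by rewrite -xE x1 (ncell_mesh R hj) ltxx.
  by exfalso; apply: (inner x) => //; rewrite alx xbe.
- move=> i /andP[i0 iN]; have [ip|pi] := eqVneq i p.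
    by left; rewrite ip; apply: dl; rewrite -ip -lt0n.
  have [ir|ri] := eqVneq i r.
    by left; rewrite ir; apply: dr; rewrite -ir ltn_eqF.
  (* Away from both ends, the two cells meeting at the node lie both inside or both outside the
     gap. *)
  right; rewrite /F1; congr (if _ then _ else _).
  by move: i0 pi ri; clear; lia.
- rewrite /F1; case: ifPn => // /andP[p0 _].
  move: p0 left; rewrite leqn0 => /eqP p0; rewrite p0 eqxx => c0.
  by rewrite /wave /al p0 mul0r subrr mulr0 add0r sinDpihalf c0 mulr0.
- rewrite /F1; case: ifPn => // /andP[_ hr].
  have rn : r = ncell n.
    by apply/eqP; rewrite eqn_leq rN /=; move: hr; rewrite prednK// (ncell_gt0 hj).
  move: right; rewrite rn eqxx /be rn (ncell_mesh R hj) => c0.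
  by rewrite /wave addrA sinDpihalf c0 mulr0.
Qed.

End SectorFunctions.

(** * Eigenfunctions *)

Section Gaps.
Context (R : realType) (j : nat -> nat).
Hypothesis hj : forall i, (1 <= i)%N -> (2 <= j i)%N.
Notation laakso := (laaksoM R j).
Notation mesh := (mesh R j).
Notation ncell := (ncell j).
Implicit Types (t : seq bool) (a b k : nat).

(* The sector of the levels [l.+1] with [nth false t l]; it determines [t] when the
   last bit of [t] is set. *)
Definition dir_node t k : bool :=
  `[< dirichlet j (size t) (nth false t) (k%:R * mesh (size t)) >].

Definition gap_start t a : bool := (a < ncell (size t))%N && ((a == 0%N) || dir_node t a).

(** The node [a.+2] is not tested: if [a.+1] does not end the gap, [gap_endP] shows that [a.+2]
    does. *)
Definition gap_end t a : nat :=
  if (a.+1 == ncell (size t)) || dir_node t a.+1 then a.+1 else a.+2.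

Lemma ncell_dvd n m : (n <= m)%N -> (ncell n %| ncell m)%N.
Proof.
elim: m => [|m ih]; first by rewrite leqn0 => /eqP ->.
rewrite leq_eqVlt => /predU1P[->//|]; rewrite ltnS => /ih h.
by rewrite ncellS dvdn_mulr.
Qed.

Lemma node_refine n m k : (m <= n)%N ->
  (k * (ncell n %/ ncell m))%:R * mesh n = k%:R * mesh m.
Proof.
move=> mn; rewrite !meshE natrM -mulrA; congr (_ * _).
have m0 : (ncell m)%:R != 0 :> R by rewrite pnatr_eq0 -lt0n ncell_gt0.
have n0 : (ncell n)%:R != 0 :> R by rewrite pnatr_eq0 -lt0n ncell_gt0.
apply: (mulIf n0); rewrite mulfVK//; apply: (mulIf m0).
by rewrite -natrM divnK ?ncell_dvd// mulrC mulrA divff// mul1r.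
Qed.

Lemma node_inj n (k l : nat) : k%:R * mesh n = l%:R * mesh n -> k = l.
Proof.
by move=> /(mulIf (lt0r_neq0 (mesh_gt0 R hj n))) /eqP; rewrite eqr_nat => /eqP.
Qed.

Lemma last_dirichlet t k : t != [::] -> last true t -> (0 < k < ncell (size t))%N ->
  ~~ (j (size t) %| k)%N -> dir_node t k.
Proof.
case/lastP: t => [//|s b] _; rewrite last_rcons => b1 kN nd; apply/asboolP.
exists (size s); rewrite size_rcons ltnSn nth_rcons ltnn eqxx b1; split=> //.
by apply/(wormholeP hj); exists k; rewrite size_rcons in kN nd; split.
Qed.

Lemma last_jdvd t : t != [::] -> (j (size t) %| ncell (size t))%N /\ (1 < j (size t))%N.
Proof.
case/lastP: t => [//|s b] _; rewrite size_rcons ncellS dvdn_mull//; split=> //.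
exact: hj.
Qed.

(** The last bit of [t] is set, so an interior node whose index is not divisible by [j (size t)] is
    a forced zero. The last clause locates the long gaps, which the list of eigenvalues needs. *)
Lemma gap_endP t a : last true t -> gap_start t a ->
  [/\ (a < gap_end t a <= ncell (size t))%N,
      gap_end t a != ncell (size t) -> dir_node t (gap_end t a),
      forall k, (a < k < gap_end t a)%N -> ~~ dir_node t k &
      gap_end t a = a.+2 -> (j (size t) %| a.+1)%N /\ gap_end t a != ncell (size t)].
Proof.
move=> lt /andP[aN _]; rewrite /gap_end; case: ifPn => [h|].
  split; rewrite ?ltnSn//.
  - by move: h => /orP[->|].
  - by move=> k /andP[h1 h2]; move: (leq_ltn_trans h1 h2); rewrite ltnn.
  - by move=> /eqP; rewrite eqn_leq ltnn andbF.
rewrite negb_or => /andP[aN1 nd].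
(* In the empty sector there is a single cell, so [a.+1] would be the last node. *)
have tn : t != [::].
  by apply: contraNneq aN1 => t0; move: aN; rewrite t0 /= /Defs.mesh /ncell big_geq//; case: a {nd}.
have [dN j2] := last_jdvd tn.
have a1N : (a.+1 < ncell (size t))%N by rewrite ltn_neqAle aN1.
have ja : (j (size t) %| a.+1)%N.
  by apply: contraNT nd; apply: last_dirichlet => //; rewrite a1N.
(* As [j (size t)] is at least 2 it cannot divide two consecutive integers. It does divide
   [ncell (size t)], so [a.+2] is also not the endpoint 1. *)
have nja : ~~ (j (size t) %| a.+2)%N.
  rewrite -addn1 dvdn_addr// dvdn1; by apply: contraTneq j2 => ->.
have a2N : a.+2 != ncell (size t) by apply: contraNneq nja => ->.
split=> //.
- by rewrite ltnS leqnSn.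
- by move=> _; apply: last_dirichlet => //; rewrite /= ltn_neqAle a2N.
- move=> k /andP[h1 h2]; have -> : k = a.+1 by apply/eqP; rewrite eqn_leq h1 -ltnS h2.
  exact: nd.
Qed.

Lemma dirichlet_node n (t : nat -> bool) (x : R) : dirichlet j n t x ->
  exists k, [/\ (0 < k < ncell n)%N & x = k%:R * mesh n].
Proof.
move=> [l [ln _ /(wormholeP hj)[k [/andP[k0 kN] _ ->]]]].
exists (k * (ncell n %/ ncell l.+1))%N; rewrite node_refine//; split=> //.
have q0 : (0 < ncell n %/ ncell l.+1)%N.
  by rewrite divn_gt0 ?ncell_gt0// dvdn_leq ?ncell_dvd// ncell_gt0.
rewrite muln_gt0 k0 q0 /=.
by rewrite -[ltnRHS](divnK (ncell_dvd ln)) mulnC ltn_pmul2l.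
Qed.

Lemma dirichlet_size t n (x : R) : (size t <= n)%N ->
  dirichlet j n (nth false t) x <-> dirichlet j (size t) (nth false t) x.
Proof.
move=> tn; split=> -[l [ln tl w]]; exists l; split=> //; last exact: leq_trans tn.
by rewrite ltnNge; apply: contraTN tl => /(nth_default false) ->.
Qed.

Lemma chi_size t n (c : nat -> bool) : (size t <= n)%N ->
  chi R n (nth false t) c = chi R (size t) (nth false t) c.
Proof.
move=> tn; rewrite /chi -(big_mkord xpredT (fun i => (-1) ^+ (nth false t i && c i))).
rewrite (big_cat_nat (leq0n _) tn) /= big_mkord [X in _ * X]big_nat_cond [X in _ * X]big1 ?mulr1// => i.
by move=> /andP[/andP[ti _] _]; rewrite nth_default.
Qed.

Definition gap_lo t a : R := a%:R * mesh (size t).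
Definition gap_hi t a : R := (gap_end t a)%:R * mesh (size t).
(** [phase] and [end_angle] are the arguments of the sine at the two ends of the gap: an odd
    multiple of pi / 2 for Neumann (at 0 or 1), a multiple of pi for Dirichlet. The frequency is
    then forced. *)
Definition phase a : R := if a == 0%N then pi / 2 else 0.
Definition end_angle t a k : R :=
  k%:R * pi + (if gap_end t a == ncell (size t) then pi / 2 else pi).
Definition freq t a k : R := (end_angle t a k - phase a) / (gap_hi t a - gap_lo t a).
Definition profile t a k : R -> R := bump_wave (freq t a k) (gap_lo t a) (gap_hi t a) (phase a).

Definition valid t a : bool := last true t && gap_start t a.

Lemma gap_lt t a : valid t a -> gap_lo t a < gap_hi t a.
Proof.
move=> /andP[lt gs]; have [/andP[h _] _ _ _] := gap_endP lt gs.
by rewrite /gap_lo /gap_hi ltr_pM2r ?mesh_gt0// ltr_nat.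
Qed.

Lemma end_angleE t a k : valid t a ->
  freq t a k * (gap_hi t a - gap_lo t a) + phase a = end_angle t a k.
Proof.
move=> /gap_lt h; rewrite /freq divfK ?subrK//.
by rewrite subr_eq0 gt_eqF.
Qed.

Lemma sin_natpi k (x : R) : sin (k%:R * pi + x) = (-1) ^+ k * sin x.
Proof.
elim: k => [|k ih]; first by rewrite mul0r add0r mul1r.
have -> : k.+1%:R * pi + x = (k%:R * pi + x) + pi by rewrite -natr1; ring.
by rewrite sinDpi ih exprS mulN1r mulNr.
Qed.

Lemma cos_natpi k (x : R) : cos (k%:R * pi + x) = (-1) ^+ k * cos x.
Proof.
elim: k => [|k ih]; first by rewrite mul0r add0r mul1r.
have -> : k.+1%:R * pi + x = (k%:R * pi + x) + pi by rewrite -natr1; ring.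
by rewrite cosDpi ih exprS mulN1r mulNr.
Qed.

Lemma end_angle_bc t a k :
  if gap_end t a == ncell (size t) then cos (end_angle t a k) = 0 else sin (end_angle t a k) = 0.
Proof.
rewrite /end_angle; case: (gap_end t a == ncell (size t)); first by rewrite cos_natpi cos_pihalf mulr0.
by rewrite sin_natpi sinpi mulr0.
Qed.

Lemma phase_bc a : if a == 0%N then cos (phase a) = 0 else sin (phase a) = 0.
Proof. by rewrite /phase; case: (a == 0%N); rewrite ?cos_pihalf ?sin0. Qed.

Lemma profile_lo t a k x : valid t a -> a != 0%N -> x <= gap_lo t a -> profile t a k x = 0.
Proof.
move=> va a0; apply: bump_wave_lo; first by rewrite ltW// gap_lt.
by have := phase_bc a; rewrite (negbTE a0).
Qed.

Lemma profile_hi t a k x : valid t a -> gap_end t a != ncell (size t) ->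
  gap_hi t a <= x -> profile t a k x = 0.
Proof.
move=> va b0; apply: bump_wave_hi; first by rewrite ltW// gap_lt.
by rewrite end_angleE//; have := end_angle_bc t a k; rewrite (negbTE b0).
Qed.

Lemma continuous_profile t a k : continuous (profile t a k).
Proof.
move=> x; apply: continuous_comp; first exact: continuous_clamp.
exact: continuous_wave.
Qed.

Lemma normr_profile_le1 t a k x : `|profile t a k x| <= 1.
Proof. exact: sin_max. Qed.

Lemma gap_inner t a (x : R) : valid t a -> gap_lo t a < x < gap_hi t a ->
  ~ dirichlet j (size t) (nth false t) x.
Proof.
move=> /andP[lt gs] xin dir; have [k [_ xE]] := dirichlet_node dir.
have [_ _ inner _] := gap_endP lt gs.
have kin : (a < k < gap_end t a)%N.
  by move: xin; rewrite xE /gap_lo /gap_hi !ltr_pM2r ?mesh_gt0// !ltr_nat.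
by move: (inner k kin) => /asboolPn; apply; rewrite -xE.
Qed.

Lemma profile_dirichlet t a k (x : R) : valid t a -> 0 <= x <= 1 ->
  dirichlet j (size t) (nth false t) x -> profile t a k x = 0.
Proof.
move=> va hx dir; have [xa|ax] := leP x (gap_lo t a).
  have [a0|a0] := eqVneq a 0%N; last exact: profile_lo.
  have [l [/andP[l0 _] xE]] := dirichlet_node dir.
  move: xa; rewrite /gap_lo a0 mul0r xE leNgt mulr_gt0 ?mesh_gt0// ltr0n l0.
  by [].
have [bx|xb] := leP (gap_hi t a) x; last by case: (gap_inner va _ dir); rewrite ax xb.
have [bN|bN] := eqVneq (gap_end t a) (ncell (size t)); last exact: profile_hi.
have [l [/andP[_ lN] xE]] := dirichlet_node dir.
by move: bx; rewrite /gap_hi bN xE leNgt ltr_pM2r ?mesh_gt0// ltr_nat lN.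
Qed.

Lemma gap_end_le t a a' : valid t a -> valid t a' -> (a < a')%N -> (gap_end t a <= a')%N.
Proof.
move=> /andP[lt gs] /andP[_ /andP[_ a'D]] aa'; have [_ _ inner _] := gap_endP lt gs.
rewrite gtn_eqF ?(leq_ltn_trans _ aa')//= in a'D.
by rewrite leqNgt; apply/negP => h; move: (inner a'); rewrite aa' h a'D => /(_ isT).
Qed.

(** The gap is described on the mesh of level [size t]; each of its cells splits into [q] cells of
    F_n, so node indices are multiplied by [q]. *)
Lemma laplR_profile n t a k : valid t a -> (size t <= n)%N ->
  laplR (sector (j := j) (n := n) (nth false t) (profile t a k))
    (fun y => freq t a k ^+ 2 * sector (j := j) (n := n) (nth false t) (profile t a k) y).
Proof.
move=> va tn; have /andP[lt gs] := va; have /andP[aN a0D] := gs.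
have [/andP[ab bN] bD inner _] := gap_endP lt gs.
have q0 : (0 < ncell n %/ ncell (size t))%N.
  by rewrite divn_gt0 ?ncell_gt0// dvdn_leq ?ncell_dvd// ncell_gt0.
have NE : ncell n = (ncell (size t) * (ncell n %/ ncell (size t)))%N.
  by rewrite mulnC divnK// ncell_dvd.
set q := (ncell n %/ ncell (size t))%N in q0 NE.
have := @laplR_bump_wave R j hj n (nth false t) (a * q) (gap_end t a * q)
  (freq t a k) (phase a).
rewrite /= !node_refine// -/(gap_lo t a) -/(gap_hi t a); apply.
- by rewrite ltn_pmul2r// ab NE leq_pmul2r.
- rewrite muln_eq0 (gtn_eqF q0) orbF => a0; apply/dirichlet_size => //.
  by apply/asboolP; move: a0D; rewrite (negbTE a0).
- rewrite NE eqn_pmul2r// => b0; apply/dirichlet_size => //.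
  by apply/asboolP; exact: bD.
- by move=> x xin dir; apply: (gap_inner va xin); apply/(dirichlet_size x tn).
- by rewrite muln_eq0 (gtn_eqF q0) orbF; exact: phase_bc.
- by rewrite NE eqn_pmul2r// end_angleE//; exact: end_angle_bc.
Qed.

Definition eigenfun t a k : laakso -> R :=
  cyl (fun c x => profile t a k x * chi R (size t) (nth false t) c).

Lemma eigenfun_sector n t a k (p : laakso) : (size t <= n)%N ->
  sector (j := j) (n := n) (nth false t) (profile t a k) (Phi p n) = eigenfun t a k p.
Proof.
move=> tn; rewrite /sector /eigenfun /cyl hc_Phi chi_size//; congr (_ * _).
by apply: eq_chi => i i_t _; rewrite gbits_Phi// (leq_trans i_t).
Qed.

End Gaps.

(** * Orthogonality and positivity of the eigenfunctions *)

Section EigenfunctionOrthogonality.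
Context (R : realType) (j : nat -> nat).
Hypothesis hj : forall i, (1 <= i)%N -> (2 <= j i)%N.
Notation graph n := (graph R j n).
Notation laakso := (laaksoM R j).
Notation leb := (@lebesgue_measure R).
Notation tail n := (n.-tuple bool).
Notation ncell := (ncell j).
Implicit Types (t : seq bool) (a b k : nat).
Variable mu : {measure set laakso -> \bar R}.
Hypothesis hmu : limit_measure mu.

Local Notation eigenfun := (@eigenfun R j).
Local Notation profile := (@profile R j).
Local Notation freq := (freq R j).
Local Notation valid := (valid R j).

Lemma integral_cyl_flip0 n l (G : (nat -> bool) -> R -> R) : (l < n)%N ->
  compatible j n G -> (forall w : tail n, leb.-integrable `[0, 1] (EFin \o G (bits w))) ->
  (forall c x, G (flip l c) x = - G c x) -> \int[mu]_p cyl G p = 0.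
Proof.
move=> ln cG iG hG; have [_ ->] := integral_cyl hmu cG iG.
apply: (sum_tail_flip ln) => w; rewrite -mulrN; congr (_ * _).
have m01 : measurable (`[0, 1]%classic : set (measurableTypeR R)) by [].
rewrite -mulN1r -(RintegralZl _ m01 (iG w)); apply: eq_Rintegral => x.
rewrite inE /= in_itv /= => hx; rewrite -(compatible_tail _ cG hx) hG.
by rewrite mulN1r.
Qed.

Lemma chi_flip_notin n t c l : ~~ nth false t l ->
  chi R n (nth false t) (flip l c) = chi R n (nth false t) c.
Proof. by move=> tl; apply: eq_chi => i _ ti; rewrite /flip ifN//; apply: contraTneq ti => ->. Qed.

Lemma nth_last_bit t : t != [::] -> last true t -> nth false t (size t).-1.
Proof.
case/lastP: t => [//|s b] _; rewrite last_rcons size_rcons /= => ->.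
by rewrite nth_rcons ltnn eqxx.
Qed.

Lemma sq_int_eigenfun t a k : valid t a -> sq_int mu (eigenfun t a k).
Proof.
move=> va; have lp := laplR_profile hj k va (leqnn (size t)).
have [h _] := laplR_sq_int hj hmu lp.
by apply: eq_sq_int h => p; exact: eigenfun_sector.
Qed.

Lemma compatible_eigenfun t a k n : valid t a -> (size t <= n)%N ->
  compatible j n (fun c x => profile t a k x * chi R (size t) (nth false t) c).
Proof.
move=> va tn; apply: (compatible_leq tn); apply: compatible_sector => x hx.
exact: profile_dirichlet.
Qed.

(** If the sector lives on F_n, this is symmetry against an eigenfunction. Otherwise functions on
    F_n do not see the last bit of [t], flipping it reverses the integrand, and both sides are 0. *)
Lemma laplR_eigenfun_coef n (f g : graph n -> R) t a k : valid t a -> laplR f g ->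
  ip mu (fun p => g (Phi p n)) (eigenfun t a k) =
  freq t a k ^+ 2 * ip mu (fun p => f (Phi p n)) (eigenfun t a k).
Proof.
move=> va fg; have [f_sq g_sq] := laplR_sq_int hj hmu fg.
have e_sq := sq_int_eigenfun k va.
have [tn|nt] := leqP (size t) n.
  have lp := laplR_profile hj k va tn.
  have := laplR_symmetric hj hmu fg lp.
  have E : (fun p => sector (nth false t) (profile t a k) (Phi p n)) = eigenfun t a k.
    by apply/funext => p; exact: eigenfun_sector.
  rewrite E => ->; rewrite -ipZr//.
  by apply: eq_Rintegral => p _; rewrite -E.
have vanish (h : graph n -> R) :
    (forall w : tail n, leb.-integrable `[0, 1] (EFin \o (fun x => h (chart j n (bits w) x)))) ->
    ip mu (fun p => h (Phi p n)) (eigenfun t a k) = 0.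
  move=> ih; pose G c x := h (chart j n c x) * (profile t a k x * chi R (size t) (nth false t) c).
  have -> : ip mu (fun p => h (Phi p n)) (eigenfun t a k) = \int[mu]_p cyl G p.
    by apply: eq_Rintegral => p _; rewrite /cyl /G !(Phi_chart n p).
  have ln : ((size t).-1 < size t)%N by rewrite prednK// (leq_ltn_trans _ nt).
  apply: (integral_cyl_flip0 ln).
  - apply: compatible_mul; last exact: compatible_eigenfun.
    by apply: (compatible_leq (ltnW nt)); exact: compatible_chart.
  - move=> w; have m01 : measurable (`[0, 1]%classic : set (measurableTypeR R)) by [].
    have ihw : leb.-integrable `[0, 1] (fun x => (h (chart j n (bits w) x))%:E).
      apply: (eq_integrable m01) (ih (tail_of n (bits w))) => x _.
      rewrite /= (@chart_ext R j n (bits (tail_of n (bits w))) (bits w) x) // => i.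
      exact: bits_tail_of.
    have mP : measurable_fun (`[0, 1]%classic : set R)
        (fun x => profile t a k x * chi R (size t) (nth false t) (bits w)).
      apply: measurable_funM => //; apply: measurable_funTS.
      apply: continuous_measurable_fun; exact: continuous_profile.
    have bd : [bounded profile t a k x * chi R (size t) (nth false t) (bits w) | x in
        (`[0, 1]%classic : set R)].
      exists 1; split; first exact: num_real.
      move=> M M1 x _; apply: le_trans (ltW M1).
      by rewrite normrM normr_chi mulr1; exact: normr_profile_le1.
    have := integrableMr m01 mP bd ihw.
    by apply: (eq_integrable m01) => x _; rewrite /= /G -EFinM mulrC.
  - move=> c x; rewrite /G.
    have tl : nth false t (size t).-1.
      have /andP[lt _] := va; apply: nth_last_bit lt.
      by rewrite -size_eq0 -lt0n (leq_ltn_trans _ nt).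
    rewrite (chi_flip R _ ln tl) !mulrN; congr (- (h _ * _)).
    apply: chart_ext => i i_n; rewrite /flip ifN//.
    by rewrite neq_ltn (leq_trans i_n)// -ltnS prednK// (leq_ltn_trans _ nt).
have h1 (w : tail n) := let: And4 h _ _ _ := laplR_integrable hj w fg in h.
have h2 (w : tail n) := let: And4 _ _ h _ := laplR_integrable hj w fg in h.
by rewrite (vanish g h2) (vanish f h1) mulr0.
Qed.

Lemma eigenfun_orth_eigenvalue t a k t' a' k' : valid t a -> valid t' a' ->
  freq t a k ^+ 2 != freq t' a' k' ^+ 2 ->
  ip mu (eigenfun t a k) (eigenfun t' a' k') = 0.
Proof.
move=> va va' ne.
have lp := laplR_profile hj k va (leqnn (size t)).
have := laplR_eigenfun_coef k' va' lp.
have E : (fun p => sector (nth false t) (profile t a k) (Phi p (size t))) = eigenfun t a k.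
  by apply/funext => p; exact: eigenfun_sector.
have -> : (fun p => freq t a k ^+ 2 * sector (nth false t) (profile t a k) (Phi p (size t))) =
    fun p => freq t a k ^+ 2 * eigenfun t a k p.
  by apply/funext => p; rewrite -E.
rewrite E ipZl; [|exact: sq_int_eigenfun|exact: sq_int_eigenfun].
move=> /eqP; rewrite -subr_eq0 -mulrBl mulf_eq0 subr_eq0 (negbTE ne) /=.
by move=> /eqP.
Qed.

(** For different lengths, the last bit of the longer list is set and reads as [false] in the
    shorter one. *)
Lemma sector_neq t t' : last true t -> last true t' -> t != t' ->
  exists l, (l < maxn (size t) (size t'))%N /\ nth false t l != nth false t' l.
Proof.
have key (s s' : seq bool) : last true s' -> (size s < size s')%N ->
    nth false s (size s').-1 != nth false s' (size s').-1.
  move=> ls ss; have sn : s' != [::] by rewrite -size_eq0 -lt0n (leq_ltn_trans _ ss).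
  by rewrite (nth_last_bit sn ls) nth_default// -ltnS prednK// (leq_ltn_trans _ ss).
move=> lt lt' ne; have [ss|ss|ss] := ltngtP (size t) (size t').
- exists (size t').-1; split; last exact: key.
  by rewrite prednK// (leq_ltn_trans _ ss).
- exists (size t).-1; split; last by rewrite eq_sym; exact: key.
  by rewrite prednK// (leq_ltn_trans _ ss).
- apply: contrapT => no; move/eqP: ne; apply; apply: (eq_from_nth (x0 := false) ss) => i it.
  apply/eqP; apply: contrapT => /negP h; by apply: no; exists i.
Qed.

Lemma eigenfun_orth_sector t a k t' a' k' : valid t a -> valid t' a' -> t != t' ->
  ip mu (eigenfun t a k) (eigenfun t' a' k') = 0.
Proof.
move=> va va' ne; have /andP[lt _] := va; have /andP[lt' _] := va'.
have [l [ln tl]] := sector_neq lt lt' ne.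
set n := maxn _ _ in ln.
pose P c x := profile t a k x * chi R (size t) (nth false t) c.
pose P' c x := profile t' a' k' x * chi R (size t') (nth false t') c.
pose G c x := P c x * P' c x.
have -> : ip mu (eigenfun t a k) (eigenfun t' a' k') = \int[mu]_p cyl G p by [].
apply: (integral_cyl_flip0 ln).
- by apply: compatible_mul; apply: compatible_eigenfun => //; [exact: leq_maxl|exact: leq_maxr].
- move=> w; apply: continuous_integrable_itv => x.
  by apply: cvgM; apply: cvgM; solve [exact: cvg_cst|exact: continuous_profile].
move=> c x; rewrite /G /P /P'.
have lt_size s : nth false s l -> (l < size s)%N.
  by move=> sl; rewrite ltnNge; apply: contraTN sl => /(nth_default false) ->.
move: tl; case tl: (nth false t l); case tl': (nth false t' l) => // _.
- rewrite (chi_flip R _ (lt_size _ tl) tl) (@chi_flip_notin _ t') ?tl'//.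
  by rewrite mulrN mulNr.
- rewrite (chi_flip R _ (lt_size _ tl') tl') (@chi_flip_notin _ t) ?tl//.
  by rewrite !mulrN.
Qed.

(** The first profile vanishes to the right of its gap and the second to the left of its own, the
    gaps being separated by a Dirichlet node. *)
Lemma eigenfun_orth_gap t a k a' k' : valid t a -> valid t a' -> (a < a')%N ->
  ip mu (eigenfun t a k) (eigenfun t a' k') = 0.
Proof.
move=> va va' aa'; have ba' := gap_end_le hj va va' aa'; have /andP[_ /andP[a'N _]] := va'.
have a'0 : a' != 0%N by rewrite -lt0n (leq_ltn_trans _ aa').
have bne : gap_end R j t a != ncell (size t) by rewrite ltn_eqF// (leq_ltn_trans ba').
have hi_lo : gap_hi R j t a <= gap_lo R j t a' by exact: node_le.
rewrite /ip (_ : (fun p => _) = fun=> 0); first by rewrite /Rintegral integral0.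
apply/funext => p; rewrite /eigenfun /cyl.
have [x_lo|/ltW lo_x] := leP (xcoord p) (gap_lo R j t a').
  by rewrite (profile_lo hj k' va' a'0 x_lo) mul0r mulr0.
by rewrite (profile_hi hj k va bne (le_trans hi_lo lo_x)) !mul0r.
Qed.

Lemma pi0 : 0 < pi :> R. Proof. exact: pi_gt0. Qed.

Lemma freq_inj t a k k' : valid t a -> k != k' -> freq t a k ^+ 2 != freq t a k' ^+ 2.
Proof.
move=> va kk'; have lt := gap_lt hj va.
have l0 : 0 < gap_hi R j t a - gap_lo R j t a by rewrite subr_gt0.
have e0 i : 0 <= end_angle R j t a i - phase R a.
  rewrite /end_angle /phase; have p0 := pi0; have ip : 0 <= i%:R * pi :> R.
    by rewrite mulr_ge0// ltW.
  by case: ifP => _; case: ifP => _; move: p0 ip; lra.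
have f0 i : 0 <= freq t a i by rewrite divr_ge0 ?e0// ltW.
rewrite eqrXn2//; apply/negP => /eqP /(mulIf (invr_neq0 (lt0r_neq0 l0))) /eqP.
rewrite -subr_eq0; apply/negP.
have -> : end_angle R j t a k - phase R a - (end_angle R j t a k' - phase R a) =
  (k%:R - k'%:R) * pi by rewrite /end_angle; ring.
by rewrite mulf_neq0 ?(gt_eqF pi0)// subr_eq0 eqr_nat.
Qed.

(** Integrating u u'' by parts, with boundary terms killed by the conditions on cos sin, shows that
    sin^2 and cos^2 have equal integrals, each half the length. For [w = 0] the wave is a
    constant. *)
Lemma wave_sqr_gt0 (w al be ph : R) : al < be -> (w = 0 -> sin ph != 0) ->
  cos ph * sin ph = 0 ->
  cos (w * (be - al) + ph) * sin (w * (be - al) + ph) = 0 ->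
  0 < \int[leb]_(x in `[al, be]) (wave w al ph x ^+ 2).
Proof.
move=> ab w0s c0 c1; have mI : measurable (`[al, be]%classic : set (measurableTypeR R)) by [].
have icst (c : R) : \int[leb]_(x in `[al, be]) c = c * (be - al).
  rewrite (Rintegral_cst _ mI); congr (c * _).
  transitivity (fine (leb (`[al, be]%classic : set R))) => //.
  by rewrite lebesgue_measure_itv /= lte_fin ab -EFinB.
have [w0|wn] := eqVneq w 0.
  have -> : \int[leb]_(x in `[al, be]) (wave w al ph x ^+ 2) =
      \int[leb]_(x in `[al, be]) (sin ph ^+ 2).
    by apply: eq_Rintegral => x _; rewrite /wave w0 mul0r add0r.
  by rewrite icst mulr_gt0 ?subr_gt0// exprn_even_gt0//= w0s.
have [p2 p1] := sobolev2_primitive (ltW ab) (sobolev2_wave w al ph (ltW ab)).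
have [_ _ eq] := integration_by_parts_ac (ltW ab) p2 p1.
set u1 := fun x => _ in p2 p1 eq; set u2 := fun x => _ in p2 p1 eq.
pose I := \int[leb]_(x in `[al, be]) (wave w al ph x ^+ 2).
have iw : leb.-integrable `[al, be] (EFin \o (fun x => wave w al ph x ^+ 2)).
  by apply: continuous_integrable_itv; apply: continuous_sqr; exact: continuous_wave.
have ic : leb.-integrable `[al, be] (EFin \o (fun=> w ^+ 2)).
  by apply: continuous_integrable_itv => x; exact: cvg_cst.
have e2 : \int[leb]_(x in `[al, be]) (u2 x * wave w al ph x) = - w ^+ 2 * I.
  rewrite -(RintegralZl _ mI iw); apply: eq_Rintegral => x _; rewrite /u2; ring.
have e1 : \int[leb]_(x in `[al, be]) (u1 x * u1 x) = w ^+ 2 * (be - al) - w ^+ 2 * I.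
  rewrite -icst -(RintegralZl _ mI iw) -(RintegralB mI ic (integrableZl mI (w ^+ 2) iw)).
  apply: eq_Rintegral => x _; rewrite /u1 /wave addrA sinDpihalf.
  rewrite -[w ^+ 2 - _](_ : w ^+ 2 * (1 - sin (w * (x - al) + ph) ^+ 2) = _); last by ring.
  by rewrite -cos2sin2; ring.
have bal : u1 al * wave w al ph al = 0.
  by rewrite /u1 /wave subrr mulr0 !add0r sinDpihalf -mulrA c0 mulr0.
have bbe : u1 be * wave w al ph be = 0.
  by rewrite /u1 /wave addrA sinDpihalf -mulrA c1 mulr0.
move: eq; rewrite e1 e2 bal bbe subrr => h.
have w2 : w ^+ 2 != 0 by rewrite sqrf_eq0.
have IE : I = (be - al) / 2.
  apply: (mulfI w2); apply/eqP; rewrite -subr_eq0; apply/eqP.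
  by move: h; lra.
by rewrite -/I IE divr_gt0// subr_gt0.
Qed.

Lemma profile_sqr_gt0 t a k : valid t a -> 0 < \int[leb]_(x in `[0, 1]) (profile t a k x ^+ 2).
Proof.
move=> va; have lt := gap_lt hj va; have /andP[gl gs] := va.
have [/andP[ab bN] _ _ _] := gap_endP hj gl gs.
have /andP[aN _] := gs.
have /andP[al0 _] := node_itv R hj (ltnW aN).
have /andP[_ be1] := node_itv R hj bN.
have bc0 := phase_bc R a; have bc1 := end_angle_bc R j t a k.
have p0 := pi0.
have h : 0 < \int[leb]_(x in `[gap_lo R j t a, gap_hi R j t a])
    (wave (freq t a k) (gap_lo R j t a) (phase R a) x ^+ 2).
  apply: wave_sqr_gt0 => //.
  (* Zero frequency requires a Neumann start: from phase 0 the end angle, at least pi / 2, could not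
     be reached. *)
  - move=> w0; move: bc0; rewrite /phase; case: ifP => a0; first by rewrite sin_pihalf oner_neq0.
    have := end_angleE hj k va; rewrite w0 mul0r add0r /phase a0 /end_angle => /esym/eqP.
    have : 0 <= k%:R * pi :> R by rewrite mulr_ge0// ltW.
    by case: ifP => _ kp e; exfalso; move: e => /eqP e; move: kp p0 e; lra.
  - by move: bc0; case: ifP => _ ->; rewrite ?mul0r ?mulr0.
  - by rewrite end_angleE//; move: bc1; case: ifP => _ ->; rewrite ?mul0r ?mulr0.
apply: (lt_le_trans h).
have sub : `[gap_lo R j t a, gap_hi R j t a]%classic = `[0, 1]%classic `&` `[gap_lo R j t a, gap_hi R j t a]%classic.
  rewrite setIidr// => x /=; rewrite !in_itv /= => /andP[h1 h2].
  by rewrite (le_trans al0 h1) (le_trans h2 be1).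
rewrite [in leLHS]sub Rintegral_mkcondr.
have m01 : measurable (`[0, 1]%classic : set (measurableTypeR R)) by [].
have mg : measurable (`[gap_lo R j t a, gap_hi R j t a]%classic : set (measurableTypeR R)) by [].
have iw x y : leb.-integrable `[x, y] (EFin \o
    (fun x => wave (freq t a k) (gap_lo R j t a) (phase R a) x ^+ 2)).
  by apply: continuous_integrable_itv; apply: continuous_sqr; exact: continuous_wave.
apply: le_Rintegral => //.
- rewrite -restrict_EFin; apply: (integrable_restrict _ _ _ _).1 => //.
  by rewrite -sub; exact: iw.
- by apply: continuous_integrable_itv; apply: continuous_sqr; exact: continuous_profile.
move=> x _; rewrite patchE; case: ifPn => [|_]; last exact: sqr_ge0.
by rewrite inE /= in_itv /= => hx; rewrite /profile /bump_wave clamp_id.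
Qed.

Lemma eigenfun_sqr_gt0 t a k : valid t a -> 0 < ip mu (eigenfun t a k) (eigenfun t a k).
Proof.
move=> va; have c : compatible j 0 (fun _ x => profile t a k x ^+ 2) by [].
have i (w : tail 0) : leb.-integrable `[0, 1] (EFin \o (fun x => profile t a k x ^+ 2)).
  by apply: continuous_integrable_itv; apply: continuous_sqr; exact: continuous_profile.
have [_ e] := integral_cyl hmu c i.
have -> : ip mu (eigenfun t a k) (eigenfun t a k) = \int[mu]_p cyl (fun _ x => profile t a k x ^+ 2) p.
  apply: eq_Rintegral => p _; rewrite /eigenfun /cyl -expr2 exprMn.
  by rewrite chi_sqr mulr1.
by rewrite e big_tail0 expr0 mul1r; exact: profile_sqr_gt0.
Qed.

End EigenfunctionOrthogonality.

(** * Completeness *)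

Section StepApproximation.
Context (R : realType).
Implicit Types (y z : R) (n m : nat).

Lemma bernoulli_ineq z n : -1 <= z -> 1 + n%:R * z <= (1 + z) ^+ n.
Proof.
move=> z1; elim: n => [|n ih]; first by rewrite mul0r addr0.
rewrite exprS; apply: (@le_trans _ _ ((1 + z) * (1 + n%:R * z))).
  rewrite -natr1; have : 0 <= n%:R * z ^+ 2 by rewrite mulr_ge0// sqr_ge0.
  have -> : (1 + z) * (1 + n%:R * z) = 1 + (n%:R + 1) * z + n%:R * z ^+ 2 by ring.
  by rewrite lerDl.
by rewrite ler_wpM2l// addrC -lerBlDr sub0r.
Qed.

(* An odd polynomial: its iterates at [y] are [y] times polynomials in [y ^+ 2]. *)
Definition sharpen y : R := y * (3 - y ^+ 2) / 2.

Lemma iter_sharpen0 n : iter n sharpen 0 = 0.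
Proof. by elim: n => [//|n ih]; rewrite /= ih /sharpen !mul0r. Qed.

(** The point 1 is a double root of 1 - [sharpen], whence the contraction factor 1 - (y + y^2) / 2
    <= 1 - y0 / 2. *)
Lemma sharpen_bounds (y0 y : R) : 0 < y0 -> y0 <= y <= 1 ->
  y0 <= sharpen y <= 1 /\ 1 - sharpen y <= (1 - y0 / 2) * (1 - y).
Proof.
move=> p0 /andP[h1 h2]; have yp : 0 < y by apply: lt_le_trans h1.
have e1 : 1 - sharpen y = (1 - y) ^+ 2 * (2 + y) / 2 by rewrite /sharpen; field.
have e2 : sharpen y - y = y * ((1 - y) * (1 + y)) / 2 by rewrite /sharpen; field.
have n1 : 0 <= 1 - y by rewrite subr_ge0.
have n2 : 0 <= sharpen y - y.
  have y1 : 0 <= 1 + y by rewrite addr_ge0// ltW.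
  by rewrite e2 divr_ge0// mulr_ge0 ?(ltW yp)// mulr_ge0.
have n3 : 0 <= 1 - sharpen y.
  have y1 : 0 <= 2 + y by rewrite addr_ge0// ltW.
  by rewrite e1 divr_ge0// mulr_ge0 ?sqr_ge0.
split.
  apply/andP; split; last by rewrite -subr_ge0.
  by apply: (le_trans h1); rewrite -subr_ge0.
rewrite -subr_ge0 e1.
have -> : (1 - y0 / 2) * (1 - y) - (1 - y) ^+ 2 * (2 + y) / 2 =
  (1 - y) * ((y - y0) + y ^+ 2) / 2 by field.
by rewrite divr_ge0// mulr_ge0// addr_ge0 ?sqr_ge0// subr_ge0.
Qed.

Lemma iter_sharpen_bounds (y : R) n : 0 < y <= 1 ->
  y <= iter n sharpen y <= 1 /\ 1 - iter n sharpen y <= (1 - y / 2) ^+ n.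
Proof.
move=> /andP[y0 y1]; elim: n => [|n [ih1 ih2]] /=.
  by rewrite lexx y1 expr0 lerBlDr lerDl ltW.
have [b1 b2] := sharpen_bounds y0 ih1; split=> //.
apply: (le_trans b2); rewrite exprS ler_wpM2l//.
by rewrite subr_ge0 ler_pdivrMr// mul1r (le_trans y1)// ler1n.
Qed.

Lemma iter_sharpen_cvg (y : R) : 0 < y <= 1 -> (fun n => iter n sharpen y) @ \oo --> (1 : R).
Proof.
move=> hy; have /andP[y0 y1] := hy.
have g : (fun n => (1 - y / 2) ^+ n) @ \oo --> (0 : R).
  by apply: cvg_expr; rewrite ger0_norm; lra.
have lo : (fun n => 1 - (1 - y / 2) ^+ n) @ \oo --> (1 - 0 : R).
  by apply: cvgB => //; exact: cvg_cst.
rewrite subr0 in lo; apply: (squeeze_cvgr _ lo); last exact: cvg_cst.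
near=> n; have [/andP[_ h1] h2] := iter_sharpen_bounds n hy.
by rewrite h1 andbT lerBlDr addrC -lerBlDr.
Unshelve. all: by end_near. Qed.

(* The polynomials from Brosowski and Deutsch's proof of the Stone-Weierstrass theorem. *)
Definition steep n y : R := (1 - y ^+ n) ^+ (2 ^ n).

Lemma steep_bounds n y : 0 <= y <= 1 -> 0 <= steep n y <= 1.
Proof.
move=> /andP[y0 y1]; have yn : 0 <= y ^+ n <= 1 by rewrite exprn_ge0// exprn_ile1.
have /andP[h1 h2] := yn.
by rewrite /steep exprn_ge0 ?subr_ge0//= exprn_ile1 ?subr_ge0// lerBlDr lerDl.
Qed.

(** Bernoulli gives steep n y >= 1 - (2 y)^n; the exponents n and 2^n are what puts the threshold at
    1 / 2. *)
Lemma steep_cvg1 y : 0 <= y < 2^-1 -> (fun n => steep n y) @ \oo --> (1 : R).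
Proof.
move=> /andP[y0 y1]; have g : (fun n => (2 * y) ^+ n) @ \oo --> (0 : R).
  by apply: cvg_expr; rewrite ger0_norm; lra.
have lo : (fun n => 1 - (2 * y) ^+ n) @ \oo --> (1 - 0 : R).
  by apply: cvgB => //; exact: cvg_cst.
rewrite subr0 in lo; apply: (squeeze_cvgr _ lo); last exact: cvg_cst.
near=> n; have yy : 0 <= y <= 1 by lra.
have /andP[_ h] := steep_bounds n yy; rewrite h andbT.
have /andP[yn0 yn1] : 0 <= y ^+ n <= 1.
  by case/andP: yy => a b; rewrite exprn_ge0// exprn_ile1.
have := @bernoulli_ineq (- y ^+ n) (2 ^ n); rewrite lerN2 => /(_ yn1).
by apply: le_trans; rewrite exprMn natrX mulrN.
Unshelve. all: by end_near. Qed.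

(** Multiplying by (1 + y^n)^(2^n) gives a number at most 1, while Bernoulli makes that factor at
    least (2 y)^n. *)
Lemma steep_cvg0 y : 2^-1 < y <= 1 -> (fun n => steep n y) @ \oo --> (0 : R).
Proof.
move=> /andP[y0 y1]; have yp : 0 < y by lra.
have g : (fun n => ((2 * y)^-1) ^+ n) @ \oo --> (0 : R).
  apply: cvg_expr; rewrite ger0_norm; last by rewrite invr_ge0; lra.
  by rewrite invf_lt1; lra.
apply: (squeeze_cvgr (f := fun=> 0) _ _ g); last exact: cvg_cst.
near=> n.
have yy : 0 <= y <= 1 by lra.
have /andP[-> _] /= := steep_bounds n yy.
have yn0 : 0 < y ^+ n by rewrite exprn_gt0.
have yn1 : y ^+ n <= 1 by case/andP: yy => a b; rewrite exprn_ile1.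
have z0 : 0 <= 1 - y ^+ n by rewrite subr_ge0.
have m0 : 0 < 2 ^+ n :> R by rewrite exprn_gt0.
have le1 : steep n y * (1 + (2 ^ n)%:R * y ^+ n) <= 1.
  apply: (@le_trans _ _ (steep n y * (1 + y ^+ n) ^+ (2 ^ n))).
    rewrite ler_wpM2l ?exprn_ge0//; apply: bernoulli_ineq.
    by apply: le_trans (ltW yn0); rewrite lerN10.
  rewrite /steep -exprMn exprn_ile1//.
    by rewrite mulr_ge0// addr_ge0// ltW.
  have -> : (1 - y ^+ n) * (1 + y ^+ n) = 1 - (y ^+ n) ^+ 2 by ring.
  by rewrite lerBlDr lerDl sqr_ge0.
rewrite exprVn exprMn -[leRHS]mul1r ler_pdivlMr ?mulr_gt0//.
apply: le_trans le1; rewrite ler_wpM2l ?exprn_ge0// natrX.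
by rewrite lerDr.
Unshelve. all: by end_near. Qed.

End StepApproximation.

Section IntegralDynkin.
Local Open Scope ereal_scope.
Context d1 d2 (X : measurableType d1) (Y : measurableType d2) (R : realType).
Variable mu : {measure set X -> \bar R}.

(** Sets over which [f] integrates to 0 form a Dynkin system. It serves once for the horizontal
    coordinate and once, with [phi] the identity, for cylinder sets. *)
Lemma integral_preimage_eq0 (G : set (set Y)) (phi : X -> Y) (f : X -> \bar R) :
  @measurable _ Y = <<s G >> -> setI_closed G -> measurable_fun setT phi ->
  mu.-integrable setT f -> \int[mu]_x f x = 0 ->
  (forall A, G A -> \int[mu]_(x in phi @^-1` A) f x = 0) ->
  forall A, measurable A -> \int[mu]_(x in phi @^-1` A) f x = 0.
Proof.
move=> mG GI mphi fi fT fG.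
have mpre A : measurable A -> measurable (phi @^-1` A).
  by move=> mA; rewrite -[X in measurable X]setTI; exact: mphi.
have mf := measurable_int mu fi.
move=> A; rewrite mG.
apply: (dynkin_induction (P := fun A => \int[mu]_(x in phi @^-1` A) f x = 0) mG GI) => //.
- move=> S mS S0; have mS' := mpre S mS.
  have mSc : measurable (~` (phi @^-1` S)) by exact: measurableC.
  have U : phi @^-1` S `|` ~` (phi @^-1` S) = setT by exact: setUv.
  have := fT; rewrite -{1}U integral_setU//.
  + by rewrite S0 add0e.
  + by rewrite U.
  + by rewrite disj_set2E setICr.
- move=> F mF tF F0; rewrite preimage_bigcup integral_bigcup.
  + by rewrite eseries0// => i _ _; exact: F0.
  + move=> i k _ _ [x [Fi Fk]]; apply: (tF i k I I); by exists (phi x).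
  + by move=> k; exact: mpre.
  + by apply: integrableS fi => //; apply: bigcup_measurable => k _; exact: mpre.
Qed.

End IntegralDynkin.

(** * From orthogonality on one gap to indicators of half-gaps *)

Section MomentProblem.
Context d (X : measurableType d) (R : realType) (mu : {measure set X -> \bar R}).
Hypothesis mu_fin : (mu setT < +oo)%E.
Implicit Types f g : X -> R.

(** These functions multiply L^2 into itself and, unlike [sq_int], are closed under products. *)
Definition bounded_meas f := measurable_fun setT f /\ exists M, forall x, `|f x| <= M.

Lemma bounded_meas_cst (c : R) : bounded_meas (fun=> c).
Proof. by split; [exact: measurable_cst|exists `|c|]. Qed.

Lemma bounded_measD f g : bounded_meas f -> bounded_meas g -> bounded_meas (fun x => f x + g x).
Proof.
move=> [mf [M fM]] [mg [N gN]]; split; first exact: measurable_funD.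
by exists (M + N) => x; rewrite (le_trans (ler_normD _ _))// lerD.
Qed.

Lemma bounded_measM f g : bounded_meas f -> bounded_meas g -> bounded_meas (fun x => f x * g x).
Proof.
move=> [mf [M fM]] [mg [N gN]]; split; first exact: measurable_funM.
by exists (M * N) => x; rewrite normrM ler_pM.
Qed.

Lemma bounded_meas_sum (I : Type) (r : seq I) (F : I -> X -> R) :
  (forall i, bounded_meas (F i)) -> bounded_meas (fun x => \sum_(i <- r) F i x).
Proof.
move=> bF; elim: r => [|i r ih].
  rewrite (_ : (fun x => _) = fun=> 0); first exact: bounded_meas_cst.
  by apply/funext => x; rewrite big_nil.
rewrite (_ : (fun x => _) = fun x => F i x + \sum_(i <- r) F i x); first exact: bounded_measD.
by apply/funext => x; rewrite big_cons.
Qed.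

Lemma bounded_meas_sq_int f : bounded_meas f -> sq_int mu f.
Proof. by move=> [mf [M fM]]; exact: (sq_int_bounded mu_fin mf fM). Qed.

Lemma bounded_meas_indic (A : set X) : measurable A -> bounded_meas (\1_A : X -> R).
Proof.
move=> mA; split; first exact: measurable_indic.
by exists 1 => x; rewrite indicE; case: (x \in A); rewrite ?normr1 ?normr0.
Qed.

Lemma sq_int_mul_bounded f g : sq_int mu f -> bounded_meas g -> sq_int mu (fun x => f x * g x).
Proof.
move=> [mf if2] [mg [M gM]]; split; first exact: measurable_funM.
have mg2 : measurable_fun setT (fun x => g x ^+ 2) by exact: measurable_funX.
have bd : [bounded g x ^+ 2 | x in [set: X]].
  exists (M ^+ 2); split; first exact: num_real.
  move=> K MK x _; apply: le_trans (ltW MK); rewrite normrX lerXn2r ?nnegrE//.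
  exact: le_trans (gM x).
have := integrableMr measurableT mg2 bd if2.
by apply: (eq_integrable measurableT) => x _; rewrite /= -EFinM mulrC exprMn.
Qed.

Lemma integral_ip f g (A : set X) : sq_int mu f -> sq_int mu g -> measurable A ->
  (\int[mu]_(x in A) (f x * g x)%:E = (ip mu f (fun x => g x * \1_A x))%:E)%E.
Proof.
move=> sf sg mA; have sgA := sq_int_mul_bounded sg (bounded_meas_indic mA).
have ifg := sq_int_mul sf sgA.
rewrite /ip /Rintegral fineK; last exact: integrable_fin_num ifg.
rewrite integral_mkcond; apply: eq_integral => x _.
rewrite patchE indicE; case: (x \in A); first by rewrite mulr1.
by rewrite !mulr0.
Qed.

(* On a gap, [e k] is the [k]-th eigenfunction and [co] the cosine of the rescaled coordinate. *)
Variables (v : X -> R) (e : nat -> X -> R) (co : X -> R) (E : {poly R}) (c0 : R) (k0 : nat).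
Hypothesis v_sq : sq_int mu v.
Hypothesis e_meas : forall k, measurable_fun setT (e k).
Hypothesis co_meas : measurable_fun setT co.
Hypothesis e_le1 : forall k x, `|e k x| <= 1.
Hypothesis co_le1 : forall x, `|co x| <= 1.
Hypothesis recurrence : forall k x, 2 * co x * e k.+1 x = e k.+2 x + e k x.
Hypothesis recurrence0 : forall x, 2 * co x * e 0 x = e 1%N x + c0 * e k0 x.
Hypothesis e0_sqr : forall x, e 0 x ^+ 2 = E.[co x].
Hypothesis e0_ge0 : forall x, 0 <= e 0 x.
Hypothesis e_orth : forall k, ip mu v (e k) = 0.

Let e_bounded k : bounded_meas (e k).
Proof. by split; [exact: e_meas|exists 1]. Qed.

Let horner_bounded (P : {poly R}) : bounded_meas (fun x => P.[co x]).
Proof.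
elim/poly_ind: P => [|P c ih].
  rewrite (_ : (fun x => _) = fun=> 0); first exact: bounded_meas_cst.
  by apply/funext => x; rewrite horner0.
rewrite (_ : (fun x => _) = fun x => P.[co x] * co x + c).
  apply: bounded_measD; last exact: bounded_meas_cst.
  by apply: bounded_measM => //; split; [exact: co_meas|exists 1].
by apply/funext => x; rewrite hornerMXaddC.
Qed.

(** Multiplication by [co] maps each [e k] to a combination of members of the family, so raising the
    degree of [P] only moves the index; hence the induction is for all [k] at once. *)
Lemma moment_eq0 (P : {poly R}) k : ip mu v (fun x => e k x * P.[co x]) = 0.
Proof.
have sq i (Q : {poly R}) : sq_int mu (fun x => e i x * Q.[co x]).
  by apply: bounded_meas_sq_int; exact: bounded_measM.
elim/poly_ind: P k => [|P c ih] k.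
  by rewrite ipC -[RHS](ip0l mu v); apply: eq_ip => // x; rewrite horner0 mulr0.
(* This form covers the general recurrence, with [r = 1] and the previous index, and the initial
   one, with [c0] and [k0]. *)
have key i (r : R) : (forall x, 2 * co x * e k x = e k.+1 x + r * e i x) ->
    ip mu v (fun x => e k x * (P * 'X + c%:P).[co x]) = 0.
  move=> rec; rewrite (eq_ip mu (u := v) (u' := v)
    (v' := fun x => (2^-1 * (e k.+1 x * P.[co x]) + (r / 2) * (e i x * P.[co x])) + c * e k x) _ _)//; last first.
    move=> x; rewrite hornerMXaddC.
    have -> : e k x * (P.[co x] * co x + c) = 2^-1 * P.[co x] * (2 * co x * e k x) + c * e k x by field.
    by rewrite rec; field.
  have s1 := sq_intZ (2^-1) (sq k.+1 P); have s2 := sq_intZ (r / 2) (sq i P).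
  have se := bounded_meas_sq_int (e_bounded k).
  rewrite (ipDr (sq_intD s1 s2) (sq_intZ c se) v_sq) (ipDr s1 s2 v_sq).
  rewrite (ipZr _ (sq k.+1 P) v_sq) (ipZr _ (sq i P) v_sq) (ipZr _ se v_sq) !ih e_orth.
  by rewrite !mulr0 !addr0.
case: k key => [|k] key; first exact: (key k0 c0).
by apply: (key k 1) => x; rewrite mul1r.
Qed.

Lemma iter_sharpen_horner n :
  exists Q : {poly R}, forall x, iter n (@sharpen R) (e 0 x) = e 0 x * Q.[co x].
Proof.
elim: n => [|n [Q ih]]; first by exists 1 => x; rewrite hornerC mulr1.
exists (2^-1 *: (Q * (3%:P - E * Q ^+ 2))) => x.
rewrite /= ih /sharpen hornerZ hornerM hornerD hornerN hornerC hornerM horner_exp -e0_sqr.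
by field.
Qed.

(* The iterates of [sharpen] at [e 0] tend to the indicator of [0 < e 0], and [steep n] cuts
   this limit down to [co < kap]; both factors keep the form required by [moment_eq0]. *)
Lemma indicator_eq0 (kap : R) g : -1 <= kap <= 1 -> measurable_fun setT g ->
  {ae mu, forall x, (0 < e 0 x /\ co x < kap /\ g x = 1) \/
                    ((e 0 x = 0 \/ kap < co x) /\ g x = 0)} ->
  ip mu v g = 0.
Proof.
move=> /andP[kap1 kap2] mg gP.
(* As [co] and [kap] lie in [-1, 1], this maps [co] affinely into [0, 1] and [kap] to the threshold
   1 / 2 of [steep]. *)
pose y x := 2^-1 + (co x - kap) / 4.
have yb x : 0 <= y x <= 1.
  by have := co_le1 x; rewrite ler_norml /y => /andP[h1 h2]; apply/andP; split; lra.
have eb x : 0 <= e 0 x <= 1.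
  by rewrite e0_ge0 /=; apply: le_trans (e_le1 0 x); exact: ler_norm.
pose f n x := iter n (@sharpen R) (e 0 x) * steep n (y x).
have f0 n : bounded_meas (f n) /\ ip mu v (f n) = 0.
  have [Q QE] := iter_sharpen_horner n.
  pose S : {poly R} := (1 - ((2^-1 - kap / 4)%:P + 4^-1 *: 'X) ^+ n) ^+ (2 ^ n).
  have fE : f n = fun x => e 0 x * (Q * S).[co x].
    apply/funext => x; rewrite /f QE hornerM -mulrA; congr (_ * (_ * _)).
    rewrite /steep /S horner_exp hornerD hornerN hornerC horner_exp hornerD hornerC hornerZ hornerX.
    by congr ((1 - _ ^+ n) ^+ _); rewrite /y; field.
  by rewrite fE; split; [exact: bounded_measM|exact: moment_eq0].
have fb n x : `|f n x| <= 1.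
  have /andP[s0 s1] := steep_bounds n (yb x).
  have [e0|ep] := eqVneq (e 0 x) 0.
    have -> : f n x = 0; last by rewrite normr0.
    by rewrite /f e0 iter_sharpen0 mul0r.
  have ei : 0 < e 0 x <= 1 by rewrite lt_def ep /=; exact: eb.
  have [/andP[h1 h2] _] := iter_sharpen_bounds n ei.
  have h0 : 0 <= iter n (@sharpen R) (e 0 x) by apply: le_trans h1.
  by rewrite /f normrM !ger0_norm// mulr_ile1.
have [mv _] := v_sq.
have iv : mu.-integrable setT (fun x => `|v x|%:E).
  have := sq_int_integrable mu_fin v_sq => /integrable_abse.
  by apply: (eq_integrable measurableT) => x _.
have [ig _ cv] : [/\ mu.-integrable setT (fun x => (v x * g x)%:E),
     (\int[mu]_x `|(v x * f n x)%:E - (v x * g x)%:E| @[n --> \oo] --> 0)%E &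
     (\int[mu]_x (v x * f n x)%:E @[n --> \oo] --> \int[mu]_x (v x * g x)%:E)%E].
  apply: (dominated_convergence measurableT (f_ := fun n x => (v x * f n x)%:E)
    (f := fun x => (v x * g x)%:E) (g := fun x => `|v x|%:E)).
  - by move=> n; apply/measurable_EFinP; apply: measurable_funM mv _; have [[]] := f0 n.
  - by apply/measurable_EFinP; exact: measurable_funM.
  - apply: filterS gP => x h _; apply: cvg_EFin_comp; apply: cvgM; first exact: cvg_cst.
    have /andP[y0 y1] := yb x; have /andP[e00 e01] := eb x.
    case: h => [[ep [ck ->]]|[h ->]].
      rewrite -[X in _ --> X](mulr1 1); apply: cvgM.
        by apply: iter_sharpen_cvg; rewrite ep e01.
      by apply: steep_cvg1; rewrite y0 /=; rewrite /y; lra.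
    have [e0|ep] := eqVneq (e 0 x) 0.
      rewrite (_ : (fun n => _) = fun=> 0); first exact: cvg_cst.
      by apply/funext => n; rewrite /f e0 iter_sharpen0 mul0r.
    case: h => [e0|ck]; first by rewrite e0 eqxx in ep.
    rewrite -[X in _ --> X](mulr0 1); apply: cvgM.
      by apply: iter_sharpen_cvg; rewrite lt_def ep e00 e01.
    by apply: steep_cvg0; rewrite y1 andbT /y; lra.
  - exact: iv.
  - by apply: aeW => x n _; rewrite /= lee_fin normrM ler_piMr.
have z n : (\int[mu]_x (v x * f n x)%:E = 0)%E.
  have [bf ipf] := f0 n; have i := sq_int_mul v_sq (bounded_meas_sq_int bf).
  have := integrable_fin_num measurableT i => fin.
  by move: ipf; rewrite /ip /Rintegral => h; rewrite -[LHS]fineK ?h.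
rewrite /ip /Rintegral.
suff -> : (\int[mu]_x (v x * g x)%:E = 0)%E by [].
have c0' : (\int[mu]_x (v x * f n x)%:E @[n --> \oo] --> 0)%E.
  by rewrite (_ : (fun n => _) = fun=> 0%E); [exact: cvg_cst|exact/funext].
exact: (cvg_unique _ cv c0').
Qed.

End MomentProblem.

(** * Measurability in the coordinate and trigonometric recurrences *)

Section HorizontalCoordinate.
Context (R : realType) (j : nat -> nat).
Hypothesis hj : forall i, (1 <= i)%N -> (2 <= j i)%N.
Notation graph n := (graph R j n).
Notation laakso := (laaksoM R j).
Notation mesh := (mesh R j).
Notation ncell := (ncell j).
Implicit Types (t : seq bool) (a b k : nat).

Lemma measurable_fun_cocountable (D C : set R) (f : R -> R) c : measurable D -> countable C ->
  (forall x, D x -> ~ C x -> f x = c) -> measurable_fun D f.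
Proof.
move=> mD cC fc _ A mA.
have mC (B : set R) : B `<=` C -> measurable B.
  move=> BC; apply: countable_measurable; first exact: measurable_set1.
  exact: sub_countable (subset_card_le BC) cC.
have [Ac|nAc] := pselect (A c).
  have -> : D `&` f @^-1` A = D `\` (C `&` ~` (f @^-1` A)).
    apply/seteqP; split=> x /= [Dx h]; split=> //; first by case.
    apply: contrapT => nA; apply: (h); split=> // .
    by apply: contrapT => nC; apply: nA; rewrite (fc _ Dx nC).
  by apply: measurableD => //; apply: mC; exact: subIsetl.
apply: mC => x /= [Dx Afx]; apply: contrapT => nC; apply: nAc.
by rewrite -(fc _ Dx nC).
Qed.

Lemma countable_nodes : countable [set x : R | exists n k, x = k%:R * mesh n].
Proof.
have -> : [set x : R | exists n k, x = k%:R * mesh n] =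
    (fun p : nat * nat => p.2%:R * mesh p.1) @` setT.
  by apply/seteqP; split=> x /= [n] => [[k ->]|_ <-]; [exists (n, k)|exists n.1, n.2].
exact: sub_countable (card_image_le _ _) (countableP _).
Qed.

Lemma measurable_xcoord : measurable_fun setT (@xcoord R j).
Proof.
apply: (measurable_fun_Phi (n := 0) (h := @hc R j 0)) => a.
apply: (eq_measurable_fun id); last exact: measurable_id.
by move=> x; rewrite inE /= in_itv /= => hx; rewrite -[RHS]/(hc (chart j 0 a x)) hc_chart.
Qed.

(** The bits of a point are arbitrary at wormholes; these have countably many coordinates, and off
    them [chi] is constant on each chart. *)
Lemma measurable_chi n (s : nat -> bool) : measurable_fun setT (fun p : laakso => chi R n s (pbit p)).
Proof.
rewrite (_ : (fun p => _) = fun p : laakso => chi R n s (gbits (Phi p n))); last first.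
  by apply/funext => p; apply: eq_chi => i i_n _; rewrite gbits_Phi.
apply: (measurable_fun_Phi (h := fun y : graph n => chi R n s (gbits y))) => a.
apply: (@measurable_fun_cocountable _ _ _ (chi R n s a) _ countable_nodes) => //.
move=> x /=; rewrite in_itv /= => hx nd; apply: eq_chi => i i_n _.
have [//|w] := gbits_chart j a hx i_n.
by exfalso; apply: nd; have [k [_ _ ->]] := (wormholeP hj i x).1 w; exists i.+1, k.
Qed.

Lemma sin_recurrence (A th : R) (k : nat) :
  2 * cos th * sin (A + k.+1%:R * th) = sin (A + k.+2%:R * th) + sin (A + k%:R * th).
Proof.
have -> : A + k.+2%:R * th = (A + k.+1%:R * th) + th by rewrite -[k.+2]addn1 natrD; ring.
have -> : A + k%:R * th = (A + k.+1%:R * th) - th by rewrite -[k.+1]addn1 natrD; ring.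
by move: (A + k.+1%:R * th) => B; rewrite sinD sinB; ring.
Qed.

(** The gap rescaled to [0, pi], where cosine is strictly decreasing, and constant on either side of
    it. *)
Definition angle t a (x : R) : R :=
  pi * ((clamp (gap_lo R j t a) (gap_hi R j t a) x - gap_lo R j t a) /
        (gap_hi R j t a - gap_lo R j t a)).

Lemma profile_angle t a k x : valid R j t a ->
  profile j t a k x = sin (((end_angle R j t a 0 - phase R a) / pi * angle t a x + phase R a)
    + k%:R * angle t a x).
Proof.
move=> va; have lt := gap_lt hj va; have p0 := pi0 R.
have l0 : gap_hi R j t a - gap_lo R j t a != 0 by rewrite subr_eq0 gt_eqF.
have pn : pi != 0 :> R by rewrite gt_eqF.
rewrite /profile /bump_wave /wave /freq /angle /end_angle; congr sin.
by clear p0; move: (@pi R) pn => P pn; field; rewrite pn l0.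
Qed.

Lemma angle_itv t a x : valid R j t a -> 0 <= angle t a x <= pi.
Proof.
move=> va; have lt := gap_lt hj va; have p0 := pi0 R.
have l0 : 0 < gap_hi R j t a - gap_lo R j t a by rewrite subr_gt0.
rewrite /angle mulr_ge0 ?(ltW p0)//=; last first.
  by rewrite divr_ge0 ?(ltW l0)// subr_ge0 /clamp le_max lexx.
rewrite -[leRHS]mulr1 ler_wpM2l ?(ltW p0)// ler_pdivrMr// mul1r lerD2r.
by rewrite /clamp ge_max (ltW lt) ge_min lexx orbT.
Qed.

Lemma angle_lt t a x y : valid R j t a -> x < y -> x < gap_hi R j t a -> gap_lo R j t a < y ->
  angle t a x < angle t a y.
Proof.
move=> va xy xh ly; have lt := gap_lt hj va.
have l0 : 0 < gap_hi R j t a - gap_lo R j t a by rewrite subr_gt0.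
rewrite /angle ltr_pM2l ?pi0// ltr_pM2r ?invr_gt0// ltrD2r /clamp.
rewrite (min_l (ltW xh)) gt_max lt_max lt_max !lt_min ly lt xy xh !orbT.
by rewrite andbT.
Qed.

(** The argument of the lowest profile interpolates between its values at the two ends, both in
    [0, pi]; its sine is therefore nonnegative. *)
Lemma base_angle_convex t a (x : R) :
  (end_angle R j t a 0 - phase R a) / pi * angle t a x + phase R a =
  (angle t a x / pi) * end_angle R j t a 0 + (1 - angle t a x / pi) * phase R a.
Proof. by move: (@pi R)^-1 => q; ring. Qed.

Lemma profile0_ge0 t a (x : R) : valid R j t a -> 0 <= profile j t a 0 x.
Proof.
move=> va; rewrite profile_angle// mul0r addr0 base_angle_convex.
have p0 := pi0 R; have /andP[h1 h2] := angle_itv x va.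
have r0 : 0 <= angle t a x / pi by rewrite divr_ge0// ltW.
have r1 : 0 <= 1 - angle t a x / pi by rewrite subr_ge0 ler_pdivrMr// mul1r.
have e1 : 0 <= end_angle R j t a 0 <= pi.
  by rewrite /end_angle mul0r add0r; case: ifP => _; lra.
have e2 : 0 <= phase R a <= pi by rewrite /phase; case: ifP => _; lra.
have /andP[e11 e12] := e1; have /andP[e21 e22] := e2.
apply: sin_ge0_pi; apply/andP; split; first by apply: addr_ge0; exact: mulr_ge0.
move: (angle t a x / pi) r0 r1 => r r0 r1.
rewrite -[leRHS](_ : r * pi + (1 - r) * pi = pi); last by ring.
by apply: lerD; rewrite ler_wpM2l.
Qed.

Lemma profile0_gt0 t a (x : R) : valid R j t a -> gap_lo R j t a < x < gap_hi R j t a ->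
  0 < profile j t a 0 x.
Proof.
move=> va /andP[lx xh]; rewrite profile_angle// mul0r addr0 base_angle_convex.
have p0 := pi0 R; have lt := gap_lt hj va.
have l0 : 0 < gap_hi R j t a - gap_lo R j t a by rewrite subr_gt0.
have E : angle t a x / pi = (x - gap_lo R j t a) / (gap_hi R j t a - gap_lo R j t a).
  by rewrite /angle clamp_id ?(ltW lx) ?(ltW xh)// mulrAC divff ?mul1r// gt_eqF.
have r0 : 0 < angle t a x / pi by rewrite E divr_gt0// subr_gt0.
have r1 : 0 < 1 - angle t a x / pi by rewrite subr_gt0 E ltr_pdivrMr// mul1r ltrD2r.
have e1 : 0 < end_angle R j t a 0 <= pi.
  by rewrite /end_angle mul0r add0r; case: ifP => _; lra.
have e2 : 0 <= phase R a < pi by rewrite /phase; case: ifP => _; lra.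
have /andP[e11 e12] := e1; have /andP[e21 e22] := e2.
apply: sin_gt0_pi; apply/andP; split.
  by apply: ltr_wpDr; [rewrite mulr_ge0// ltW|rewrite mulr_gt0].
move: (angle t a x / pi) r0 r1 => r r0 r1.
rewrite -[ltRHS](_ : r * pi + (1 - r) * pi = pi); last by ring.
by apply: ler_ltD; [rewrite ler_wpM2l ?(ltW r0)|rewrite ltr_pM2l].
Qed.

Lemma profile_recurrence t a k (x : R) : valid R j t a ->
  2 * cos (angle t a x) * profile j t a k.+1 x = profile j t a k.+2 x + profile j t a k x.
Proof. by move=> va; rewrite !profile_angle// sin_recurrence. Qed.

(** The missing neighbour of index -1 is folded back by the boundary conditions: it is e_1 for
    Neumann-Neumann, e_0 for Neumann-Dirichlet, -e_0 for Dirichlet-Neumann and 0 for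
    Dirichlet-Dirichlet. The lowest profiles are 1, cos(th/2), sin(th/2) and sin th, whose squares
    give [E]. *)
Lemma profile_recurrence0 t a : valid R j t a ->
  exists (E : {poly R}) (c : R) k0, forall x,
    2 * cos (angle t a x) * profile j t a 0 x = profile j t a 1 x + c * profile j t a k0 x /\
    profile j t a 0 x ^+ 2 = E.[cos (angle t a x)].
Proof.
move=> va; have pn : pi != 0 :> R by rewrite gt_eqF ?pi0.
have half (y : R) : cos y = 2 * cos (y / 2) ^+ 2 - 1.
  have {1}-> : y = y / 2 + y / 2 by field.
  by rewrite cosD -!expr2 sin2cos2; ring.
have sc (y : R) : sin y ^+ 2 = 1 - cos y ^+ 2 by rewrite sin2cos2.
have key k x : profile j t a k x = sin (((end_angle R j t a 0 - phase R a) / pi * angle t a x + phase R a)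
    + k%:R * angle t a x) by exact: profile_angle.
have step A th : 2 * cos th * sin (A : R) = sin (A + th) + sin (A - th).
  by rewrite sinD sinB; ring.
have half_pi1 (P y : R) : P != 0 -> (P - P / 2) / P * y = y / 2 by move=> h; field.
have half_pi2 (P y : R) : P != 0 -> P / 2 / P * y = y / 2 by move=> h; field.
case a0 : (a == 0%N); case b0 : (gap_end R j t a == ncell (size t)).
- exists 1, 1, 1%N => x; rewrite !key /end_angle /phase a0 b0 hornerC; set th := angle t a x.
  rewrite mul0r add0r subrr !mul0r !add0r mul1r addr0 step mul1r.
  have -> : sin (pi / 2 - th) = sin (pi / 2 + th) by rewrite sinB sinD sin_pihalf cos_pihalf; ring.
  by split=> //; rewrite sin_pihalf expr1n.
- exists (2^-1 *: (1 + 'X)), 1, 0%N => x; rewrite !key /end_angle /phase a0 b0.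
  set th := angle t a x; rewrite mul0r add0r mul0r addr0 mul1r mul1r step.
  rewrite (half_pi1 _ _ pn).
  have -> : th / 2 + pi / 2 - th = - (th / 2) + pi / 2 by field.
  rewrite !sinDpihalf cosN; split=> //.
  by rewrite hornerZ hornerD hornerC hornerX (half th); field.
- exists (2^-1 *: (1 - 'X)), (-1), 0%N => x; rewrite !key /end_angle /phase a0 b0.
  set th := angle t a x; rewrite mul0r add0r mul0r !addr0 mul1r step subr0.
  rewrite (half_pi2 _ _ pn).
  have -> : th / 2 - th = - (th / 2) by field.
  rewrite sinN mulN1r; split=> //.
  by rewrite hornerZ hornerD hornerN hornerC hornerX sc (half th); field.
- exists (1 - 'X ^+ 2), 0, 0%N => x; rewrite !key /end_angle /phase a0 b0.
  set th := angle t a x; rewrite mul0r add0r mul0r !addr0 mul1r step subr0.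
  rewrite divff// mul1r subrr sin0 mul0r addr0; split=> //.
  by rewrite hornerD hornerN hornerC horner_exp hornerX.
Qed.

End HorizontalCoordinate.

(** * From gaps to all Borel sets of the Laakso space *)

Section Completeness.
Context (R : realType) (j : nat -> nat).
Hypothesis hj : forall i, (1 <= i)%N -> (2 <= j i)%N.
Notation graph n := (graph R j n).
Notation laakso := (laaksoM R j).
Notation tail n := (n.-tuple bool).
Notation mesh := (mesh R j).
Notation ncell := (ncell j).
Implicit Types (t : seq bool) (a b k : nat).
Variable mu : {measure set laakso -> \bar R}.
Hypothesis hmu : limit_measure mu.
Let mu_fin : (mu setT < +oo)%E := limit_measure_fin hmu.

Local Notation eigenfun := (@eigenfun R j).
Local Notation profile := (@profile R j).
Local Notation valid := (valid R j).
Local Notation xcoord := (@xcoord R j).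

(** The horizontal coordinate is distributed by Lebesgue measure on [0, 1]. *)
Lemma ae_xcoord (C : set R) : countable C -> {ae mu, forall p, ~ C (xcoord p)}.
Proof.
move=> cC; pose B := [set y : graph 0 | C (hc y)].
have sub (b : nat -> bool) : (`[0, 1]%classic `&` [set x | B (chart j 0 b x)] : set R) `<=` C.
  by move=> x [] /=; rewrite in_itv /= => hx; rewrite /B /= -/(chart j 0 b x) hc_chart.
have cS (b : nat -> bool) : countable (`[0, 1]%classic `&` [set x | B (chart j 0 b x)] : set R).
  exact: sub_countable (subset_card_le (sub b)) cC.
have mB : Fmeasurable B.
  apply/FmeasurableP => b; apply: countable_measurable (cS b).
  exact: measurable_set1.
exists [set p | B (Phi p 0)]; split.
- exact: measurable_cylinder.
- by rewrite (hmu mB) FmeasE big_tail0 expr0 mul1e; exact: countable_lebesgue_measure0.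
- by move=> p /= h; apply: contrapT.
Qed.

Lemma bounded_meas_chi n (s : nat -> bool) : bounded_meas (fun p : laakso => chi R n s (pbit p)).
Proof. by split; [exact: measurable_chi|exists 1 => p; rewrite normr_chi]. Qed.

Lemma bounded_meas_xcoord_indic (A : set R) : measurable A ->
  bounded_meas (fun p : laakso => \1_A (xcoord p) : R).
Proof.
move=> mA; split; last by exists 1 => p; rewrite indicE; case: (_ \in _); rewrite ?normr1 ?normr0.
apply: (measurableT_comp (f := \1_A : R -> R)); first exact: measurable_indic.
exact: measurable_xcoord.
Qed.

(** Cosine decreases on [0, pi], so inside the gap x > c means that [co] is below its value at [c],
    which is the threshold. The points [c] and the two ends of the gap form a null set. *)
Lemma gap_indicator_eq0 (v : laakso -> R) t a (c : R) : sq_int mu v -> valid t a ->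
  (forall k, ip mu v (fun p => profile t a k (xcoord p)) = 0) ->
  ip mu v (fun p => \1_(`]Num.max c (gap_lo R j t a), gap_hi R j t a[%classic : set R) (xcoord p)) = 0.
Proof.
move=> sv va orth; have lt := gap_lt hj va.
have [E [c0 [k0 rec]]] := profile_recurrence0 hj va.
have mx := @measurable_xcoord R j.
have cang : continuous (angle j t a : R -> R).
  move=> x; apply: cvgM; first exact: cvg_cst.
  apply: cvgM; last exact: cvg_cst.
  by apply: cvgB; [exact: continuous_clamp|exact: cvg_cst].
have mcos : measurable_fun setT (fun p => cos (angle j t a (xcoord p))).
  apply: (measurableT_comp (f := fun x => cos (angle j t a x))) mx.
  apply: continuous_measurable_fun => x; apply: continuous_comp; first exact: cang.
  exact: continuous_cos.
apply: (@indicator_eq0 _ laakso R mu mu_fin v (fun k p => profile t a k (xcoord p))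
  (fun p => cos (angle j t a (xcoord p))) E c0 k0 sv _ _ _ _ _ _ _ _ orth (cos (angle j t a c))).
- move=> k; apply: (measurableT_comp (f := profile t a k)) mx.
  by apply: continuous_measurable_fun; exact: continuous_profile.
- exact: mcos.
- by move=> k p; exact: normr_profile_le1.
- by move=> p; exact: cos_max.
- by move=> k p; exact: profile_recurrence.
- by move=> p; have [] := rec (xcoord p).
- by move=> p; have [] := rec (xcoord p).
- by move=> p; exact: profile0_ge0.
- by have := cos_max (angle j t a c); rewrite ler_norml.
- by have [] := @bounded_meas_xcoord_indic `]Num.max c (gap_lo R j t a), gap_hi R j t a[%classic (measurable_itv _).
have cC : countable [set c; gap_lo R j t a; gap_hi R j t a].
  by apply: finite_set_countable; exact: finite_set3.
apply: filterS (ae_xcoord cC) => p hp; set x := xcoord p in hp *.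
have xc : x != c by apply/eqP => h; apply: hp; left; left.
have xl : x != gap_lo R j t a by apply/eqP => h; apply: hp; left; right.
have xh : x != gap_hi R j t a by apply/eqP => h; apply: hp; right.
have cosE (y z : R) : angle j t a y < angle j t a z ->
    cos (angle j t a z) < cos (angle j t a y).
  by move=> h; rewrite ltr_cos// in_itv /= (angle_itv hj _ va).
have /andP[x0 x1] := xcoord_itv p.
have indE (b : bool) : ((Num.max c (gap_lo R j t a) < x < gap_hi R j t a) = b) ->
    \1_(`]Num.max c (gap_lo R j t a), gap_hi R j t a[%classic : set R) x = b%:R :> R.
  by move=> <-; rewrite indicE; congr (nat_of_bool _)%:R; apply/idP/idP; rewrite inE /= in_itv.
have [xlo|lox|/eqP] := ltgtP x (gap_lo R j t a); last by rewrite (negbTE xl).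
  right; split; last by rewrite (indE false)// gt_max [gap_lo R j t a < x]ltNge (ltW xlo) andbF.
  left; apply: profile_lo => //; last exact: ltW.
  by apply: contraTneq xlo => ->; rewrite /gap_lo mul0r -leNgt.
have [xhi|hix|/eqP] := ltgtP x (gap_hi R j t a); last by rewrite (negbTE xh).
  have [xltc|cx|/eqP] := ltgtP x c; last by rewrite (negbTE xc).
    right; split; last by rewrite (indE false)// gt_max ltNge (ltW xltc).
    by right; apply: cosE; apply: angle_lt => //; exact: lt_trans xltc.
  left; split; first by apply: profile0_gt0 => //; rewrite lox xhi.
  split; last by rewrite (indE true)// gt_max cx lox xhi.
  by apply: cosE; apply: angle_lt => //; exact: lt_trans xhi.
right; split; last by rewrite (indE false)// [x < gap_hi R j t a]ltNge (ltW hix) andbF.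
left; apply: profile_hi => //; last exact: ltW.
apply: contraTneq hix => bN; rewrite /gap_hi bN (ncell_mesh R hj) -leNgt.
exact: x1.
Qed.

Lemma gap_cover t (x : R) : last true t -> 0 < x < 1 ->
  (forall k, x <> k%:R * mesh (size t)) ->
  exists a, valid t a /\ gap_lo R j t a < x < gap_hi R j t a.
Proof.
move=> lt /andP[x0 x1] nx; have d0 := mesh_gt0 R hj (size t).
pose i := Num.truncn (x / mesh (size t)).
have : (i%:R <= x / mesh (size t) < i.+1%:R)%R by apply: truncn_itv; rewrite divr_ge0// ltW.
rewrite ler_pdivlMr// ltr_pdivrMr// => /andP[ix xi].
have iN : (i < ncell (size t))%N.
  rewrite -(ltr_nat R) -(ltr_pM2r d0) (ncell_mesh R hj); exact: le_lt_trans x1.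
have g0 : gap_start R j t 0 by rewrite /gap_start (ncell_gt0 hj).
have ub m : gap_start R j t m && (m <= i)%N -> (m <= i)%N by case/andP.
have ex : exists m, gap_start R j t m && (m <= i)%N by exists 0%N; rewrite g0.
case: (ex_maxnP ex ub) => a /andP[ga ai] amax.
exists a; split; first by rewrite /valid lt.
have [/andP[ab bN] bD _ _] := gap_endP hj lt ga.
have ib : (i < gap_end R j t a)%N.
  (* If the gap ended by node [i], its end would be a later gap start not beyond [i], against the
     maximality of [a]. *)
  rewrite ltnNge; apply/negP => bi; have bN' := leq_ltn_trans bi iN.
  have : (gap_end R j t a <= a)%N.
    by apply: amax; rewrite bi andbT /gap_start bN' bD ?orbT// ltn_eqF.
  by rewrite leqNgt ab.
apply/andP; split.
  rewrite lt_neqAle; apply/andP; split; first by apply/eqP => h; exact: (nx a).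
  by apply: le_trans ix; exact: node_le.
by apply: (lt_le_trans xi); exact: node_le.
Qed.

Lemma gap_disjoint t a a' (x : R) : valid t a -> valid t a' ->
  gap_lo R j t a < x < gap_hi R j t a -> gap_lo R j t a' < x < gap_hi R j t a' -> a = a'.
Proof.
move=> va va' /andP[l h] /andP[l' h']; have [aa'|a'a|//] := ltngtP a a'.
  have := lt_trans l' h; rewrite ltNge; apply: contraNeq => _.
  by apply: node_le => //; exact: gap_end_le.
have := lt_trans l h'; rewrite ltNge; apply: contraNeq => _.
by apply: node_le => //; exact: gap_end_le.
Qed.

(** With [chi] moved onto [v], the indicator of the ray is almost everywhere the sum of its
    restrictions to the gaps; indices that start no gap contribute 0. *)
Lemma ray_sector_eq0 (v : laakso -> R) t (c : R) : sq_int mu v -> last true t ->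
  (forall a k, valid t a -> ip mu v (eigenfun t a k) = 0) ->
  ip mu v (fun p => chi R (size t) (nth false t) (pbit p) *
                    \1_(`]c, +oo[%classic : set R) (xcoord p)) = 0.
Proof.
move=> sv lt orth; have bchi := bounded_meas_chi (size t) (nth false t).
pose v' p := v p * chi R (size t) (nth false t) (pbit p).
have sv' : sq_int mu v' by exact: sq_int_mul_bounded.
pose I a := `]Num.max c (gap_lo R j t a), gap_hi R j t a[%classic : set R.
pose u a (p : laakso) : R := if valid t a then \1_(I a) (xcoord p) else 0.
have bu a : bounded_meas (u a).
  rewrite /u; case: (valid t a); last exact: bounded_meas_cst.
  by apply: bounded_meas_xcoord_indic; exact: measurable_itv.
have su a : sq_int mu (u a) by exact: bounded_meas_sq_int.
have u0 a : ip mu v' (u a) = 0.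
  rewrite /u; case va : (valid t a); last by rewrite ipC ip0l.
  apply: gap_indicator_eq0 => // k; rewrite -[RHS](orth a k va).
  by apply: eq_Rintegral => p _; rewrite /v' /eigenfun /cyl; ring.
have bray := bounded_meas_xcoord_indic (measurable_itv `]c, +oo[).
transitivity (ip mu v' (fun p => \1_(`]c, +oo[%classic : set R) (xcoord p))).
  by apply: eq_Rintegral => p _; rewrite /v' mulrA.
transitivity (ip mu v' (fun p => \sum_(a <- iota 0 (ncell (size t))) u a p)); last first.
  by rewrite (ip_sumr mu_fin)// big1.
have bs : bounded_meas (fun p => \sum_(a <- iota 0 (ncell (size t))) u a p).
  by apply: bounded_meas_sum.
have [mray _] := bray; have [ms _] := bs; have [mv' _] := sv'.
rewrite ipC [RHS]ipC; apply: eq_ae_ip => //.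
have cn := @countable_nodes R j.
apply: filterS (ae_xcoord cn) => p hp; set x := xcoord p in hp *.
have /andP[h0 h1] := xcoord_itv p.
have nd k : x <> k%:R * mesh (size t) by move=> h; apply: hp; exists (size t), k.
have x01 : 0 < x < 1.
  rewrite !lt_neqAle h0 h1 !andbT; apply/andP; split.
    by apply/eqP => h; apply: (nd 0%N); rewrite mul0r h.
  by apply/eqP => h; apply: (nd (ncell (size t))); rewrite (ncell_mesh R hj).
have [a [va ax]] := gap_cover lt x01 nd; have /andP[lx xh] := ax.
have aN : a \in iota 0 (ncell (size t)).
  by rewrite mem_iota /= add0n; have /andP[_ /andP[]] := va.
rewrite (bigD1_seq a) ?iota_uniq//= big1 ?addr0 => [|b ba].
  by rewrite /u va !indicE /I !mem_setE !in_itv /= gt_max lx xh !andbT.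
rewrite /u; case: ifPn => // vb; rewrite indicE /I mem_setE in_itv /= gt_max.
apply/eqP; rewrite pnatr_eq0 eqb0; apply/negP => /andP[/andP[_ lb] hb]; move/eqP: ba; apply.
by apply: (gap_disjoint vb va _ ax); rewrite lb hb.
Qed.

Lemma chi_trim n (s : nat -> bool) :
  exists t, last true t /\ chi R n s =1 chi R (size t) (nth false t).
Proof.
elim: n => [|n [t [lt e]]].
  by exists [::]; split=> // b; rewrite /chi !big_ord0.
have [sn|sn] := boolP (s n).
  exists (mkseq s n.+1); split.
    by rewrite mkseqS last_rcons.
  move=> b; rewrite size_mkseq; apply: eq_bigr => i _.
  by rewrite nth_mkseq.
exists t; split=> // b; rewrite -e /chi big_ord_recr /= (negbTE sn) /=.
by rewrite expr0 mulr1.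
Qed.

Definition agrees n (w : tail n) (p : laakso) : R :=
  [forall i : 'I_n, bits w i == pbit p i]%:R.

(** Inversion for the characters of (Z/2)^n: where [w] and the bits of [p] differ at [i], flipping
    [s] at [i] reverses the summand. *)
Lemma agreesE n (w : tail n) p : agrees w p =
  \sum_(s : tail n) (2^-1) ^+ n * chi R n (bits s) (bits w) * chi R n (bits s) (pbit p).
Proof.
under eq_bigr do rewrite -mulrA; rewrite -mulr_sumr /agrees.
case: (boolP [forall i, _]) => [/forallP h|/forallPn[i wi]].
  under eq_bigr => s _.
    rewrite (eq_chi R (b := pbit p)); last by move=> i i_n _; exact/eqP/(h (Ordinal i_n)).
    rewrite -expr2 chi_sqr; over.
  by rewrite sumr_const card_tuple card_bool natrX -exprMn mulVf ?expr1n// pnatr_eq0.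
rewrite (sum_tail_flip (ltn_ord i)) ?mulr0// => s.
pose x l := bits w l (+) pbit p l.
have comb (s' : nat -> bool) : chi R n s' (bits w) * chi R n s' (pbit p) = chi R n x s'.
  rewrite /chi -big_split /=; apply: eq_bigr => l _; rewrite /x -signr_addb.
  by case: (s' l); case: (bits w l); case: (pbit p l).
rewrite !comb -(chi_flip R _ (ltn_ord i)); last by move: wi; rewrite /x; case: (bits w i); case: (pbit p i).
by apply: eq_chi => l ln _; rewrite bits_tail_of.
Qed.

Lemma bounded_meas_agrees n (w : tail n) : bounded_meas (agrees w).
Proof.
rewrite (_ : agrees w = fun p => \sum_(s : tail n)
  (2^-1) ^+ n * chi R n (bits s) (bits w) * chi R n (bits s) (pbit p)); last first.
  by apply/funext => p; exact: agreesE.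
apply: bounded_meas_sum => s; apply: bounded_measM; last exact: bounded_meas_chi.
exact: bounded_meas_cst.
Qed.

Lemma Fmeasurable_lift n m (B : set (graph n)) : (n <= m)%N -> Fmeasurable B ->
  exists B' : set (graph m), Fmeasurable B' /\
    [set p : laakso | B (Phi p n)] = [set p : laakso | B' (Phi p m)].
Proof.
elim: m => [|m ih]; first by case: n B => // B _ mB; exists B.
rewrite leq_eqVlt => /predU1P[nm|]; first by subst n => mB; exists B.
rewrite ltnS => /ih h /h[B' [/FmeasurableP mB' ->]].
exists [set y | B' (phi y)]; split.
  apply/FmeasurableP => a; rewrite (_ : [set x | _] = [set x | B' (chart j m a x)]).
    exact: mB'.
  by apply/funext => x /=; rewrite -/(chart j m.+1 a x) phi_chart.
by apply/funext => p /=; rewrite PhiP.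
Qed.

Lemma cylinders_setI_closed : setI_closed (@cylinders R j).
Proof.
move=> _ _ [n [B [mB ->]]] [m [C [mC ->]]].
have [B' [/FmeasurableP mB' ->]] := Fmeasurable_lift (leq_maxl n m) mB.
have [C' [/FmeasurableP mC' ->]] := Fmeasurable_lift (leq_maxr n m) mC.
exists (maxn n m), (B' `&` C'); split=> //; apply/FmeasurableP => a.
rewrite (_ : _ `&` _ = (`[0, 1]%classic `&` [set x | B' (chart j (maxn n m) a x)]) `&`
  (`[0, 1]%classic `&` [set x | C' (chart j (maxn n m) a x)])); first exact: measurableI.
by rewrite setIACA setIid.
Qed.

Lemma eigenfun_complete (v : laakso -> R) : sq_int mu v ->
  (forall t a k, valid t a -> ip mu v (eigenfun t a k) = 0) ->
  {ae mu, forall p, v p = 0}.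
Proof.
move=> sv orth; have iv := sq_int_integrable mu_fin sv.
have bray (c : R) := bounded_meas_xcoord_indic (measurable_itv `]c, +oo[).
have ray n (w : tail n) (c : R) :
    ip mu v (fun p => agrees w p * \1_(`]c, +oo[%classic : set R) (xcoord p)) = 0.
  pose u (s : tail n) (p : laakso) := chi R n (bits s) (pbit p) * \1_(`]c, +oo[%classic : set R) (xcoord p) : R.
  have su (s : tail n) : sq_int mu (u s).
    apply: (bounded_meas_sq_int mu_fin); apply: bounded_measM; first exact: bounded_meas_chi.
    exact: bray.
  have -> : (fun p : laakso => agrees w p * \1_(`]c, +oo[%classic : set R) (xcoord p)) =
      fun p => \sum_(s : tail n) ((2^-1) ^+ n * chi R n (bits s) (bits w)) * u s p.
    apply/funext => p; rewrite agreesE mulr_suml; apply: eq_bigr => s _.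
    by rewrite /u mulrA.
  rewrite (ip_sumr mu_fin)//; last by move=> s; exact: sq_intZ.
  apply: big1 => s _; rewrite ipZr//.
  have [t [lt e]] := chi_trim n (bits s).
  rewrite /u (_ : (fun p => _) = fun p => chi R (size t) (nth false t) (pbit p) *
    \1_(`]c, +oo[%classic : set R) (xcoord p)); last by apply/funext => p; rewrite e.
  by rewrite ray_sector_eq0 ?mulr0// => a k; exact: orth.
have cell n (w : tail n) (A : set R) : measurable A ->
    ip mu v (fun p => agrees w p * \1_A (xcoord p)) = 0.
  have sw := bounded_meas_sq_int mu_fin (bounded_meas_agrees w).
  have mpre (B : set R) : measurable B -> measurable (xcoord @^-1` B).
    by move=> mB; rewrite -[X in measurable X]setTI; exact: measurable_xcoord.
  have conv (B : set R) : measurable B -> (\int[mu]_(p in xcoord @^-1` B) (v p * agrees w p)%:E =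
      (ip mu v (fun p => agrees w p * \1_B (xcoord p)))%:E)%E.
    by move=> mB; rewrite (integral_ip sv sw (mpre _ mB)).
  move=> mA; apply/EFin_inj; rewrite -conv//.
  have := @integral_preimage_eq0 _ _ laakso (measurableTypeR R) R mu (@RGenOInfty.G R) xcoord
    (fun p => (v p * agrees w p)%:E); apply; last exact: mA.
  - exact: RGenOInfty.measurableE.
  - move=> _ _ [x ->] [y ->]; exists (Num.max x y).
    by apply/seteqP; split=> z /=; rewrite !in_itv /= !andbT gt_max => /andP.
  - exact: measurable_xcoord.
  - exact: sq_int_mul.
  (* The whole space is itself the preimage of a ray, so its integral is already known to be 0. *)
  - have -> : [set: laakso] = xcoord @^-1` `]-1, +oo[%classic.
      apply/esym/seteqP; split=> // p _ /=; rewrite in_itv /= andbT.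
      by have /andP[h _] := xcoord_itv p; apply: lt_le_trans h.
    by rewrite conv// ray.
  - by move=> _ [x ->]; rewrite conv// ray.
(* A cylinder set splits according to the first [n] bits; on each piece it is a condition [A w] on
   the coordinate. *)
have cyl0 n (B : set (graph n)) : Fmeasurable B ->
    (\int[mu]_(p in [set p | B (Phi p n)]) (v p)%:E = 0)%E.
  move=> mB; have mC := measurable_cylinder mB; have /FmeasurableP mA := mB.
  pose A (w : tail n) := `[0, 1]%classic `&` [set x | B (chart j n (bits w) x)] : set R.
  pose u (w : tail n) (p : laakso) : R := agrees w p * \1_(A w) (xcoord p).
  have su w : sq_int mu (u w).
    apply: (bounded_meas_sq_int mu_fin); apply: bounded_measM; first exact: bounded_meas_agrees.
    by apply: bounded_meas_xcoord_indic; exact: mA.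
  have s1 := bounded_meas_sq_int mu_fin (bounded_meas_cst laakso (1 : R)).
  have := integral_ip sv s1 mC.
  have -> : (fun p => 1 * \1_[set p | B (Phi p n)] p) = fun p => \sum_(w : tail n) u w p.
    apply/funext => p; rewrite mul1r (bigD1 (tail_of n (pbit p)))//= big1 ?addr0 => [|w wp].
      rewrite /u /agrees (_ : [forall i, _]); last first.
        by apply/forallP => i; rewrite bits_tail_of.
      rewrite mul1r !indicE; congr (nat_of_bool _)%:R.
      have E : chart j n (bits (tail_of n (pbit p))) (xcoord p) = Phi p n.
        by rewrite Phi_chart; apply: chart_ext => i; exact: bits_tail_of.
      have hx := xcoord_itv p.
      apply/idP/idP; rewrite !inE /A /= in_itv /= E; [by split|by case].
    rewrite /u /agrees (negbTE (_ : ~~ [forall i, _])) ?mul0r//.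
    apply: contra wp => /forallP h; apply/eqP/bits_inj => i i_n.
    by rewrite bits_tail_of//; exact/eqP/(h (Ordinal i_n)).
  rewrite (ip_sumr mu_fin)// big1; last by move=> w _; apply: (cell n w (A w)); exact: mA.
  by apply: etrans; apply: eq_integral => p _; rewrite mulr1.
have mT : @Fmeasurable R j 0 setT.
  by apply/FmeasurableP => a; rewrite setIT; exact: measurable_itv.
(* Second use of the Dynkin argument, now on the Laakso space itself. *)
have zero (A : set laakso) : measurable A -> (\int[mu]_(p in A) (v p)%:E = 0)%E.
  apply: (integral_preimage_eq0 (Y := laakso) (G := @cylinders R j) (phi := id)) => //.
  - exact: cylinders_setI_closed.
  - exact: (cyl0 0 setT mT).
  - by move=> _ [n [B [mB ->]]]; exact: cyl0.
have : ae_eq mu setT (EFin \o v) (cst 0%E).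
  apply: integral_ae_eq => // A _ mA; rewrite integral0.
  exact: zero.
by apply: filterS => p /(_ I) [].
Qed.

End Completeness.

(** * The spectrum *)

Section Frequencies.
Context (R : realType) (j : nat -> nat).
Hypothesis hj : forall i, (1 <= i)%N -> (2 <= j i)%N.
Notation mesh := (mesh R j).
Notation ncell := (ncell j).
Implicit Types (t : seq bool) (a k : nat).
Local Notation valid := (valid R j).

Definition frequencies : set R :=
  (\bigcup_n \bigcup_k [set k%:R ^+ 2 * pi ^+ 2 / mesh n ^+ 2]) `|`
  (\bigcup_(n in [set n | (2 <= n)%N]) \bigcup_(k in [set k | (1 <= k)%N])
     [set k%:R ^+ 2 * pi ^+ 2 / (4 * mesh n ^+ 2)]) `|`
  (\bigcup_(n in [set n | (1 <= n)%N]) \bigcup_k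
     [set (2 * k + 1)%:R ^+ 2 * pi ^+ 2 / (4 * mesh n ^+ 2)]).

(* The eigenfunctions on a gap have a whole number of quarter wavelengths. *)
Definition quarter_waves t a k : nat :=
  (2 * k + (if gap_end R j t a == ncell (size t) then 1 else 2) - (a == 0))%N.

Lemma freqE t a k : freq R j t a k =
  (quarter_waves t a k)%:R * pi / (2 * ((gap_end R j t a)%:R - a%:R) * mesh (size t)).
Proof.
have num : end_angle R j t a k - phase R a = (quarter_waves t a k)%:R * pi / 2.
  rewrite /quarter_waves natrB; last by case: ifP => _; case: (a == 0%N) => //=; rewrite addnC.
  rewrite natrD natrM /end_angle /phase.
  by case: ifP => _; case: (a == 0%N) => /=; field.
by rewrite /freq num /gap_hi /gap_lo -mulrBl !invfM !mulrA.
Qed.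

Lemma ncell0 : ncell 0 = 1%N.
Proof. by rewrite /ncell big_geq. Qed.

Lemma ncell_gt1 n : (0 < n)%N -> (1 < ncell n)%N.
Proof.
case: n => // n _; rewrite ncellS; apply: leq_trans (hj (ltn0Sn n)) _.
by rewrite leq_pmull// ncell_gt0.
Qed.

(** A gap of length d_n gives the first or the third family according to the parity of its number of
    quarter waves; a gap of length 2 d_n gives the second. *)
Lemma freq_sqr_frequencies t a k : valid t a -> frequencies (freq R j t a k ^+ 2).
Proof.
move=> /andP[lt gs]; have [/andP[ab bN] bD _ long] := gap_endP hj lt gs.
have d0 : mesh (size t) != 0 by rewrite gt_eqF ?mesh_gt0.
have : gap_end R j t a = a.+1 \/ gap_end R j t a = a.+2.
  by rewrite /gap_end; case: ifP => _; [left|right].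
rewrite freqE /quarter_waves => -[b1|b2].
  rewrite b1 -[a.+1]addn1 natrD addrAC subrr add0r mulr1.
  set q := (_ - _)%N.
  have qE := odd_double_half q; case: (boolP (odd q)) qE => qo qE.
    right; exists (size t).
      (* In the empty sector both ends are Neumann and the number of quarter waves is even. *)
      case: (posnP (size t)) => // /size0nil t0; move: qo bN ab.
      rewrite /q b1 t0 /= ncell0 => + a1 _; have -> : a = 0%N by move: a1; clear; case: a.
      rewrite eqxx addnK.
      by rewrite mul2n odd_double.
    exists q./2 => //; rewrite /= mul2n addnC qE.
    by field.
  left; left; exists (size t) => //; exists q./2 => //=.
  rewrite -[in LHS]qE add0n -mul2n natrM.
  by field.
have [ja bne] := long b2; rewrite b2 in bN.
(* The midpoint of a long gap is an interior multiple of d_(n-1) with n = [size t]; for n = 1 there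
   is none, as d_0 = 1. *)
have t2 : (1 < size t)%N.
  rewrite ltnNge; apply/negP => t1; move: t1 bN ja.
  rewrite leq_eqVlt ltnS leqn0 => /predU1P[->|/eqP ->]; last by rewrite ncell0.
  by rewrite (ncellS j 0) ncell0 mul1n => aj /(dvdn_leq (ltn0Sn a)); rewrite leqNgt aj.
have a0 : a != 0%N.
  apply: contraTneq ja => ->; rewrite dvdn1 gtn_eqF//.
  exact: hj (ltnW t2).
left; right; exists (size t) => //; exists k.+1 => //=.
rewrite b2 -b2 (negbTE bne) (negbTE a0) subn0 b2.
have -> : a.+2%:R - a%:R = 2 :> R by rewrite -[a.+2]addn2 natrD addrAC subrr add0r.
have -> : (2 * k + 2)%:R = 2 * k.+1%:R :> R by rewrite -natrM mulnS addnC.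
by field.
Qed.

(** The sector of the single level [n], enough to realize the second and third families. *)
Definition top_level n : seq bool := rcons (nseq n.-1 false) true.

Lemma size_top_level n : (0 < n)%N -> size (top_level n) = n.
Proof. by move=> n0; rewrite /top_level size_rcons size_nseq prednK. Qed.

Lemma dir_node_top_level n k : (0 < n)%N -> (0 < k < ncell n)%N ->
  dir_node R j (top_level n) k = ~~ (j n %| k)%N.
Proof.
move=> n0 kN; have sz := size_top_level n0; apply/idP/idP; last first.
  move=> h; have := @last_dirichlet R j hj (top_level n) k.
  apply; rewrite ?sz ?last_rcons//.
  by rewrite -size_eq0 sz -lt0n.
move=> /asboolP[l [ln tl /(wormholeP hj)[k' [_ nd xE]]]]; move: ln tl xE nd; rewrite sz => ln.
rewrite nth_rcons size_nseq nth_nseq if_same; case: ltnP => // nl; case: eqP => // lE _.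
by rewrite lE prednK// => /(node_inj hj) <-.
Qed.

Lemma frequencies_freq_sqr x : frequencies x ->
  exists t a k, valid t a /\ freq R j t a k ^+ 2 = x.
Proof.
case=> [[[n _ [k _ ->]]|[n /= n2 [k /= k1 ->]]]|[n /= n1 [k _ ->]]].
(* Since 1 / d_n is the integer [ncell n], the Neumann modes of the whole interval give this family
   for every [n]. *)
- exists [::], 0%N, (k * ncell n)%N.
  have v : valid [::] 0 by rewrite /valid /gap_start /= ncell0.
  split=> //; rewrite freqE /quarter_waves /gap_end /= ncell0 eqxx /= addnK.
  rewrite meshE ncell0 meshE natrM invr1 mulr1 subr0 mulr1 natrM exprVn invrK.
  by field.
- have n0 := ltnW n2; have sz := size_top_level n0.
  have jn := hj n0; have jN : (j n < ncell n)%N.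
    case: n n2 {n0 sz jn} => // n n0; rewrite ncellS ltn_Pmull ?ncell_gt1//.
    exact: leq_trans (hj (ltn0Sn n)).
  have jp : ((j n).-1.+1 = j n)%N by rewrite prednK// ltnW.
  have j0 : (0 < (j n).-1)%N by rewrite -ltnS jp.
  have v : valid (top_level n) (j n).-1.
    rewrite /valid last_rcons /gap_start sz (leq_ltn_trans (leq_pred _) jN) /=.
    rewrite dir_node_top_level// ?j0 ?(leq_ltn_trans (leq_pred _) jN)//.
    apply/orP; right; rewrite gtnNdvd//.
    by rewrite prednK// ltnW.
  (* The gap of length 2 d_n centred at j_n d_n = d_(n-1), which is interior because n >= 2. Index 0
     already has one half wave, hence [k.-1]. *)
  exists (top_level n), (j n).-1, k.-1; split=> //.
  have be : gap_end R j (top_level n) (j n).-1 = (j n).-1.+2.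
    rewrite /gap_end sz jp (ltn_eqF jN) dir_node_top_level// ?dvdnn ?jN ?andbT//.
    exact: ltnW.
  have /andP[lt gs] := v; have [_ _ _ /(_ be)[_ bne]] := gap_endP hj lt gs.
  rewrite freqE /quarter_waves (negbTE bne) be sz (gtn_eqF j0) subn0.
  have -> : (j n).-1.+2%:R - (j n).-1%:R = 2 :> R by rewrite -[_.+2]addn2 natrD addrAC subrr add0r.
  have -> : (2 * k.-1 + 2)%:R = 2 * k%:R :> R by rewrite -natrM -[in RHS](prednK k1) mulnS addnC.
  by field; rewrite gt_eqF ?mesh_gt0.
- have sz := size_top_level n1; have N1 := ncell_gt1 n1.
  have v : valid (top_level n) 0 by rewrite /valid last_rcons /gap_start sz (ltnW N1).
  (* The gap [0, d_n], with a Neumann condition at 0 and a Dirichlet condition at d_n. *)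
  exists (top_level n), 0%N, k; split=> //.
  have be : gap_end R j (top_level n) 0 = 1%N.
    by rewrite /gap_end sz dir_node_top_level// dvdn1 (gtn_eqF (hj n1)) orbT.
  rewrite freqE /quarter_waves be sz (ltn_eqF N1) /= subr0 mulr1.
  have -> : (2 * k + 2 - 1)%N = (2 * k + 1)%N by rewrite addn2 addn1 subn1.
  by field; rewrite gt_eqF ?mesh_gt0.
Qed.

Lemma frequencies_quarter_squares x : frequencies x -> exists M : nat, x = (M%:R * (pi / 2)) ^+ 2.
Proof.
have E n : (mesh n)^-1 = (ncell n)%:R by rewrite meshE invrK.
case=> [[[n _ [k _ ->]]|[n _ [k _ ->]]]|[n _ [k _ ->]]].
- by exists (2 * k * ncell n)%N; rewrite -exprVn E !natrM; field.
- by exists (k * ncell n)%N; rewrite invfM -exprVn E !natrM; field.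
- by exists ((2 * k + 1) * ncell n)%N; rewrite invfM -exprVn E natrM; field.
Qed.

Lemma quarter_squares_discrete (x : R) :
  exists2 delta : R, 0 < delta & forall M : nat, (M%:R * (pi / 2)) ^+ 2 != x ->
    delta <= `|(M%:R * (pi / 2)) ^+ 2 - x|.
Proof.
pose c (M : nat) : R := (M%:R * (pi / 2)) ^+ 2.
have fin K : exists2 delta : R, 0 < delta & forall M : nat, (M < K)%N -> c M != x -> delta <= `|c M - x|.
  elim: K => [|K [d d0 dP]]; first by exists 1.
  have [cx|cx] := eqVneq (c K) x.
    by exists d => // M; rewrite ltnS leq_eqVlt => /predU1P[->|/dP//]; rewrite cx eqxx.
  exists (Num.min d `|c K - x|) => [|M]; first by rewrite lt_min d0 normr_gt0 subr_eq0.
  rewrite ltnS leq_eqVlt ge_min => /predU1P[->|/dP h /h ->//]; by rewrite lexx orbT.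
(* For M >= K one has (M pi / 2)^2 >= M >= x + 1, so these squares are at distance at least 1;
   finitely many remain. *)
pose K := (Num.bound `|x + 1|).+1.
have [d d0 dP] := fin K; exists (Num.min d 1) => [|M Mx]; first by rewrite lt_min d0 ltr01.
rewrite ge_min; have [/dP->//|KM] := ltnP M K.
apply/orP; right; apply: le_trans (ler_norm _); rewrite lerBrDr addrC.
have xb : x + 1 <= K%:R.
  apply: le_trans (ler_norm _) _; apply: ltW; apply: lt_trans (archi_boundP (normr_ge0 _)) _.
  rewrite ltr_nat ltnS; exact: leqnn.
apply: (le_trans xb); apply: (@le_trans _ _ (M%:R : R)); first by rewrite ler_nat.
have M1 : 1 <= (M%:R : R) by rewrite ler1n (leq_trans _ KM).
have p1 : 1 <= (pi / 2 : R) by rewrite ler_pdivlMr// mul1r pi_ge2.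
rewrite expr2 -[leLHS]mulr1; apply: ler_pM => //.
  by rewrite -[leLHS]mulr1 ler_pM.
by rewrite -[leLHS]mulr1 ler_pM.
Qed.

End Frequencies.

Section GraphLaplacian.
Context (R : realType) (j : nat -> nat).
Hypothesis hj : forall i, (1 <= i)%N -> (2 <= j i)%N.
Notation graph n := (graph R j n).

Lemma laplR_lin n (f g f' g' : graph n -> R) (c : R) : laplR f g -> laplR f' g' ->
  laplR (fun y => f y + c * f' y) (fun y => g y + c * g' y).
Proof.
move=> [cf [f1 [s K]]] [cf' [f1' [s' K']]]; split.
  move=> w x; apply: cvgD; first exact: cf.
  by apply: cvgM; [exact: cvg_cst|exact: cf'].
exists (fun e x => f1 e x + c * f1' e x); split=> [e|v].
  have le : edge_lo R e <= edge_hi R e by exact: cell_le.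
  apply: sobolev2_eq (sobolev2_lin c le (s e) (s' e)) => // x _.
  by rewrite opprD mulrN.
by rewrite !big_split /= -!mulr_sumr opprD addrACA -mulrBr K K' mulr0 addr0.
Qed.

Lemma laplR0 n : laplR (fun=> 0 : R) (fun _ : graph n => 0).
Proof.
split; first by move=> w x; exact: cvg_cst.
exists (fun _ _ => 0); split=> [e|v]; last by rewrite !big1 ?subrr.
have le : edge_lo R e <= edge_hi R e by exact: cell_le.
by apply: sobolev2_eq (sobolev2_0 (edge_lo R e) (edge_hi R e)) => // x _; rewrite oppr0.
Qed.

End GraphLaplacian.

(** * The eigenfunctions as one normalized sequence *)

Section Eigenbasis.
Context (R : realType) (j : nat -> nat).
Hypothesis hj : forall i, (1 <= i)%N -> (2 <= j i)%N.
Notation graph n := (graph R j n).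
Notation laakso := (laaksoM R j).
Variable mu : {measure set laakso -> \bar R}.
Hypothesis hmu : limit_measure mu.
Let mu_fin : (mu setT < +oo)%E := limit_measure_fin hmu.
Local Notation index := (seq bool * nat * nat)%type.
Implicit Types (x y : index).

Definition mode (i : nat) : option index :=
  (* Unlike [unpickle], [pickle_inv] is injective where it is defined. *)
  if @pickle_inv index i is Some x then if valid R j x.1.1 x.1.2 then Some x else None else None.

Lemma mode_pickle x : valid R j x.1.1 x.1.2 -> mode (pickle x) = Some x.
Proof. by move=> vx; rewrite /mode pickleK_inv vx. Qed.

Lemma modeP i x : mode i = Some x -> valid R j x.1.1 x.1.2 /\ pickle x = i.
Proof.
rewrite /mode; have := @pickle_invK index i; case: pickle_inv => //= y yi.
by case: ifP => // vy [<-].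
Qed.

Definition eig x : laakso -> R := @eigenfun R j x.1.1 x.1.2 x.2.

(** Integers that encode no gap receive the null vector, which orthogonal expansions tolerate. *)
Definition basis (i : nat) : laakso -> R :=
  if mode i is Some x then fun p => (Num.sqrt (ip mu (eig x) (eig x)))^-1 * eig x p else fun=> 0.

Definition eigval (i : nat) : R := if mode i is Some x then freq R j x.1.1 x.1.2 x.2 ^+ 2 else 0.

Lemma sq_int_eig x : valid R j x.1.1 x.1.2 -> sq_int mu (eig x).
Proof. exact: sq_int_eigenfun. Qed.

Lemma basis_sq_int i : sq_int mu (basis i).
Proof.
rewrite /basis; case mi: (mode i) => [x|]; last exact: sq_int0.
by apply/sq_intZ/sq_int_eig; have [] := modeP mi.
Qed.

(** Three mechanisms: a sign change between sectors, separated gaps within a sector, distinct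
    eigenvalues on one gap. *)
Lemma eig_orth x y : valid R j x.1.1 x.1.2 -> valid R j y.1.1 y.1.2 -> x != y ->
  ip mu (eig x) (eig y) = 0.
Proof.
case: x y => [[t a] k] [[t' a'] k'] /= va va' ne.
have [tt|tt] := eqVneq t t'; last exact: (eigenfun_orth_sector hj hmu).
rewrite -{}tt in va' ne *.
have [aa|aa|aa] := ltngtP a a'.
- exact: (eigenfun_orth_gap hj).
- by rewrite ipC; exact: (eigenfun_orth_gap hj).
rewrite -{}aa in va' ne *.
apply: (eigenfun_orth_eigenvalue hj hmu) => //; apply: (freq_inj hj) => //.
by apply: contraNneq ne => /= ->.
Qed.

Lemma basis_orth i k : i != k -> ip mu (basis i) (basis k) = 0.
Proof.
move=> ik; rewrite /basis; case mi: (mode i) => [x|]; last exact: ip0l.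
case mk: (mode k) => [y|]; last by rewrite ipC; exact: ip0l.
have [vx xi] := modeP mi; have [vy yk] := modeP mk.
have sx := sq_int_eig vx; have sy := sq_int_eig vy.
have xy : x != y by apply: contraNneq ik => xy; rewrite -xi -yk xy.
by rewrite (ipZl _ sx (sq_intZ _ sy)) (ipZr _ sy sx) (eig_orth vx vy xy) !mulr0.
Qed.

Lemma basis_norm1 i x : mode i = Some x -> ip mu (basis i) (basis i) = 1.
Proof.
move=> mi; have [vx _] := modeP mi.
have sx := sq_int_eig vx.
have n0 : 0 < ip mu (eig x) (eig x) := eigenfun_sqr_gt0 hj hmu _ vx.
rewrite /basis mi (ipZl _ sx (sq_intZ _ sx)) (ipZr _ sx sx).
by rewrite mulrA -expr2 exprVn sqr_sqrtr ?(ltW n0)// mulVf// gt_eqF.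
Qed.

Lemma basis_norm0 i : mode i = None -> ip mu (basis i) (basis i) = 0.
Proof. by move=> mi; rewrite /basis mi ip0l. Qed.

Lemma basis_norm i : ip mu (basis i) (basis i) = 0 \/ ip mu (basis i) (basis i) = 1.
Proof.
by case mi: (mode i) => [x|]; [right; exact: basis_norm1 mi|left; exact: basis_norm0].
Qed.

Lemma basis_complete (v : laakso -> R) : sq_int mu v -> (forall i, ip mu v (basis i) = 0) ->
  {ae mu, forall p, v p = 0}.
Proof.
move=> sv orth; apply: (eigenfun_complete hj hmu sv) => t a k va.
have se := sq_int_eigenfun hj hmu k va; have e0 := eigenfun_sqr_gt0 hj hmu k va.
have := orth (pickle (t, a, k)); rewrite /basis mode_pickle// ipZr// => /eqP.
rewrite mulf_eq0 invr_eq0 sqrtr_eq0 leNgt => /orP[/negP[]|/eqP//].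
exact: e0.
Qed.

Lemma basis_coef n (f g : graph n -> R) i : laplR f g ->
  ip mu (fun p => g (Phi p n)) (basis i) = eigval i * ip mu (fun p => f (Phi p n)) (basis i).
Proof.
move=> fg; have [sf sg] := laplR_sq_int hj hmu fg.
rewrite /basis /eigval; case mi: (mode i) => [x|]; last by rewrite mul0r ipC ip0l.
have [vx _] := modeP mi.
have sx := sq_int_eig vx.
by rewrite !ipZr// (laplR_eigenfun_coef hj hmu x.2 vx fg) mulrCA.
Qed.

(** Finitely many sectors fit on one graph F_n, so a partial sum is a single cylinder function. *)
Lemma laplR_psum (c : nat -> R) N n :
  (forall i x, (i < N)%N -> mode i = Some x -> (size x.1.1 <= n)%N) ->
  exists f g : graph n -> R, [/\ laplR f g, forall p, f (Phi p n) = psum basis c N p &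
    forall p, g (Phi p n) = psum basis (fun i => eigval i * c i) N p].
Proof.
elim: N => [_|N ih szN].
  exists (fun=> 0), (fun=> 0); split; first exact: laplR0.
  - by move=> p; rewrite /psum big_ord0.
  - by move=> p; rewrite /psum big_ord0.
have [f [g [fg fE gE]]] := ih (fun i x iN => szN i x (ltnW iN)).
case mN: (mode N) => [x|]; last first.
  exists f, g; split=> // p; rewrite /psum big_ord_recr /= {2}/basis mN mulr0 addr0.
  - exact: fE.
  - exact: gE.
have [vx _] := modeP mN; have tn := szN N x (ltnSn N) mN.
pose s := sector (j := j) (n := n) (nth false x.1.1) (@profile R j x.1.1 x.1.2 x.2).
have sE p : s (Phi p n) = eig x p by exact: eigenfun_sector.
pose r := (Num.sqrt (ip mu (eig x) (eig x)))^-1.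
exists (fun v => f v + (c N * r) * s v).
exists (fun v => g v + (c N * r) * (freq R j x.1.1 x.1.2 x.2 ^+ 2 * s v)); split.
- by apply: (laplR_lin hj) => //; exact: laplR_profile.
- move=> p; rewrite fE sE /psum big_ord_recr /= {3}/basis mN -mulrA.
  by [].
- move=> p; rewrite gE sE /psum big_ord_recr /= {3}/basis {3}/eigval mN /r.
  by congr (_ + _); ring.
Qed.

Lemma lapl_psum (a b : nat -> R) N :
  @laakso_cyl_laplacian R j (fun p => psum basis a N p +i* psum basis b N p)
    (fun p => psum basis (fun i => eigval i * a i) N p +i*
              psum basis (fun i => eigval i * b i) N p).
Proof.
pose sz i := if mode i is Some x then size x.1.1 else 0%N.
pose n := (\max_(i < N) sz i)%N.
have szn i x : (i < N)%N -> mode i = Some x -> (size x.1.1 <= n)%N.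
  move=> iN mi; have := @leq_bigmax _ (fun i : 'I_N => sz i) (Ordinal iN).
  by rewrite {1}/sz /= mi.
have [f [g [fg fE gE]]] := laplR_psum a szn.
have [f' [g' [fg' fE' gE']]] := laplR_psum b szn.
exists n, (fun v => f v +i* f' v), (fun v => g v +i* g' v); split=> //.
- by apply/funext => p; rewrite fE fE'.
- by apply/funext => p; rewrite gE gE'.
Qed.

Lemma eigval_frequencies :
  [set (eigval i)%:C | i in [set i | ip mu (basis i) (basis i) = 1]] =
  [set z%:C | z in @frequencies R j].
Proof.
apply/seteqP; split=> [_ [i /= ei <-]|_ [z /(frequencies_freq_sqr hj)[t [a [k [va <-]]]] <-]].
  exists (eigval i) => //; rewrite /eigval.
  case mi: (mode i) => [x|]; last by move: ei; rewrite basis_norm0// => /esym/eqP; rewrite oner_eq0.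
  by have [vx _] := modeP mi; exact: freq_sqr_frequencies.
exists (pickle (t, a, k)) => /=; first by apply: basis_norm1; exact: mode_pickle.
by rewrite /eigval mode_pickle.
Qed.

(** For z off the real axis its imaginary part bounds the distance; for real z the isolation of the
    squares (M pi / 2)^2 does. *)
Lemma eigval_discrete (z : R[i]) :
  (forall i, ip mu (basis i) (basis i) = 1 -> z != (eigval i)%:C) ->
  exists2 delta : R, 0 < delta & forall i, ip mu (basis i) (basis i) = 1 ->
    delta ^+ 2 <= (eigval i - complex.Re z) ^+ 2 + complex.Im z ^+ 2.
Proof.
case: z => re im ne /=; have [im0|im0] := eqVneq im 0; last first.
  exists `|im|; first by rewrite normr_gt0.
  by move=> i _; rewrite real_normK ?num_real// lerDr sqr_ge0.
have [d d0 dP] := quarter_squares_discrete re; exists d => // i ei.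
have : @frequencies R j (eigval i).
  have : [set z%:C | z in @frequencies R j] (eigval i)%:C.
    by rewrite -eigval_frequencies; exists i.
  by case=> q qf [<-].
move=> /frequencies_quarter_squares[M eM].
have : (M%:R * (pi / 2)) ^+ 2 != re.
  by apply: contraTneq (ne i ei) => <-; rewrite im0 -eM negbK.
move=> /dP; rewrite -eM im0 expr0n addr0 => h.
rewrite -[leRHS]real_normK ?num_real//.
by rewrite lerXn2r// nnegrE ltW.
Qed.

End Eigenbasis.

Theorem theorem6p1 (R : realType) (j : nat -> nat)
    (hj : forall i, (1 <= i)%N -> (2 <= j i)%N)
    (mu : {measure set (laaksoM R j) -> \bar R}) (hmu : limit_measure mu) :
  spectrum mu (laakso_laplacian mu) =
  [set x%:C | x in
    (\bigcup_n \bigcup_k [set k%:R ^+ 2 * pi ^+ 2 / mesh R j n ^+ 2]) `|`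
    (\bigcup_(n in [set n | (2 <= n)%N]) \bigcup_(k in [set k | (1 <= k)%N])
       [set k%:R ^+ 2 * pi ^+ 2 / (4 * mesh R j n ^+ 2)]) `|`
    (\bigcup_(n in [set n | (1 <= n)%N]) \bigcup_k
       [set (2 * k + 1)%:R ^+ 2 * pi ^+ 2 / (4 * mesh R j n ^+ 2)])].
Proof.
have mu_fin := limit_measure_fin hmu.
rewrite -/(@frequencies R j) -(eigval_frequencies hj hmu).
apply: (spectral_theorem mu_fin).
- by move=> i; exact: basis_sq_int.
- by move=> i k; exact: basis_orth.
- by move=> i; exact: basis_norm.
- by move=> v; exact: basis_complete.
- move=> _ _ [n [f [g [[fgr fgi] -> ->]]]].
  have [fr gr] := laplR_sq_int hj hmu fgr; have [fi gi] := laplR_sq_int hj hmu fgi.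
  split.
  + exact/L2P.
  + exact/L2P.
  + by move=> i; exact: (basis_coef hj hmu i fgr).
  + by move=> i; exact: (basis_coef hj hmu i fgi).
- by move=> a b N; exact: lapl_psum.
- by move=> z; exact: eigval_discrete.
Qed.
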